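(* Let $n\ge 1$, $0\le\delta<1$, $a\in S^{-n}_{0,\delta}$ and $\omega\in A_1$. Then there is a constant $C$ (depending on $n,\delta$, finitely many symbol seminorms of $a$, and $[\omega]_1$) such that for all Schwartz functions $u$ on $\mathbb{R}^n$, $$\|T_a u\|_{L^{1,\infty}_\omega}\le C\|u\|_{L^1_\omega}.$$
   Context: For $m\in\mathbb{R}$, $0\le\varrho,\delta\le1$, the Hörmander class $S^m_{\varrho,\delta}$ consists of $a\in C^\infty(\mathbb{R}^n\times\mathbb{R}^n)$ such that for all multi-indices $\alpha,\beta$, $|\partial_x^\beta\partial_\xi^\alpha a(x,\xi)|\le C_{\alpha,\beta}\langle\xi\rangle^{m-\varrho|\alpha|+\delta|\beta|}$, where $\langle\xi\rangle=(1+|\xi|^2)^{1/2}$. The pseudo-differential operator with symbol $a$ is $T_a u(x)=(2\pi)^{-n}\int_{\mathbb{R}^n}e^{i\langle x,\xi\rangle}a(x,\xi)\hat u(\xi)\,d\xi$, with $\hat u(\xi)=\int e^{-i\langle y,\xi\rangle}u(y)\,dy$. A nonnegative locally integrable $\omega$ is in $A_1$ if $M\omega(x)\le C\omega(x)$ for a.e. $x$, where $M$ is the Hardy–Littlewood maximal function over axis-parallel cubes containing the point. Weighted norms: $\|u\|_{L^1_\omega}=\int|u|\omega\,dx$ and $\|u\|_{L^{1,\infty}_\omega}=\sup_{\lambda>0}\lambda\,\omega(\{x:|u(x)|>\lambda\})$, where $\omega(E)=\int_E\omega$. *)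

(* Defs.v *)
From HB Require Import structures.
From mathcomp Require Import all_boot all_order all_algebra.
From mathcomp Require Import all_classical all_reals all_analysis.
From mathcomp Require Import complex.

Set Implicit Arguments.
Unset Strict Implicit.
Unset Printing Implicit Defensive.

Import Order.TTheory GRing.Theory Num.Theory.
Import numFieldNormedType.Exports.

Local Open Scope classical_set_scope.
Local Open Scope ring_scope.

Section Defs.
Variable R : realType.

Definition coord (n : nat) (x : 'rV[R]_n) (i : 'I_n) : R := x ord0 i.
Definition ebasis (n : nat) (i : 'I_n) : 'rV[R]_n := delta_mx ord0 i.
Definition dotRn (n : nat) (x y : 'rV[R]_n) : R :=
  \sum_(i < n) coord x i * coord y i.
Definition jbr (n : nat) (xi : 'rV[R]_n) : R := Num.sqrt (1 + dotRn xi xi).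
Definition monom (n : nat) (alpha : 'I_n -> nat) (x : 'rV[R]_n) : R :=
  \prod_(i < n) coord x i ^+ alpha i.

Definition cmod (z : R[i]) : R := Num.sqrt (@complex.Re R z ^+ 2 + @complex.Im R z ^+ 2).
Definition mkC (a b : R) : R[i] := Complex a b.
Definition expi (t : R) : R[i] := Complex (cos t) (sin t).

Definition dirs (V : normedModType R) (I : Type) (e : I -> V) (s : seq I)
  (f : V -> R) : V -> R :=
  foldr (fun i g => fun p => 'D_(e i) g p) f s.

Definition smoothR (V : normedModType R) (I : Type) (e : I -> V) (f : V -> R) :=
  forall (s : seq I) (p : V), differentiable (dirs e s f) p.
Definition smoothC (V : normedModType R) (I : Type) (e : I -> V) (f : V -> R[i]) :=
  smoothR e (fun p =>@complex.Re R (f p)) /\ smoothR e (fun p =>@complex.Im R (f p)).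
Definition dirsC (V : normedModType R) (I : Type) (e : I -> V) (s : seq I)
  (f : V -> R[i]) : V -> R[i] :=
  fun p => mkC (dirs e s (fun q =>@complex.Re R (f q)) p) (dirs e s (fun q =>@complex.Im R (f q)) p).

Definition schwartz (n : nat) (u : 'rV[R]_n -> R[i]) :=
  smoothC (@ebasis n) u /\
  forall (alpha : 'I_n -> nat) (s : seq 'I_n), exists C : R,
    forall x, `|monom alpha x| * cmod (dirsC (@ebasis n) s u x) <= C.

Definition sdir (n : nat) (k : 'I_n + 'I_n) : 'rV[R]_n * 'rV[R]_n :=
  match k with inl i => (ebasis i, 0) | inr i => (0, ebasis i) end.
Definition symder (n : nat) (sx sxi : seq 'I_n)
  (a : 'rV[R]_n * 'rV[R]_n -> R[i]) : 'rV[R]_n * 'rV[R]_n -> R[i] :=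
  dirsC (@sdir n) (map inl sx ++ map inr sxi) a.
Definition symbol_bound (n : nat) (m rho delta : R)
  (a : 'rV[R]_n * 'rV[R]_n -> R[i]) (sx sxi : seq 'I_n) (C : R) :=
  forall x xi, cmod (symder sx sxi a (x, xi)) <=
     C * jbr xi `^ (m - rho * (size sxi)%:R + delta * (size sx)%:R).
Definition symbol_class (n : nat) (m rho delta : R)
  (a : 'rV[R]_n * 'rV[R]_n -> R[i]) :=
  smoothC (@sdir n) a /\
  forall sx sxi : seq 'I_n, exists C : R, symbol_bound m rho delta a sx sxi C.
Definition seminorms_le (n : nat) (m rho delta : R)
  (a : 'rV[R]_n * 'rV[R]_n -> R[i]) (N : nat) (K : R) :=
  forall sx sxi : seq 'I_n, (size sx + size sxi <= N)%N ->
    symbol_bound m rho delta a sx sxi K.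

Definition shiftseq (t : R) (x : nat -> R) : nat -> R :=
  fun k => if k is k'.+1 then x k' else t.
Fixpoint iint (n : nat) (f : (nat -> R) -> \bar R) : \bar R :=
  match n with
  | 0 => f (fun _ => 0)
  | m.+1 => (\int[@lebesgue_measure R]_(t in setT)
               iint m (fun x => f (shiftseq t x)))%E
  end.
Definition intRn (n : nat) (g : 'rV[R]_n -> \bar R) : \bar R :=
  iint n (fun x => g (\row_(i < n) x (nat_of_ord i))).
Definition intRnC (n : nat) (g : 'rV[R]_n -> R[i]) : R[i] :=
  mkC (fine (intRn (fun x => (@complex.Re R (g x))%:E)))
      (fine (intRn (fun x => (@complex.Im R (g x))%:E))).

Definition fourier (n : nat) (u : 'rV[R]_n -> R[i]) (xi : 'rV[R]_n) : R[i] :=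
  intRnC (fun y => expi (- dotRn y xi) * u y).
Definition psido (n : nat) (a : 'rV[R]_n * 'rV[R]_n -> R[i])
  (u : 'rV[R]_n -> R[i]) (x : 'rV[R]_n) : R[i] :=
  mkC ((2 * pi) ^- n) 0 *
    intRnC (fun xi => expi (dotRn x xi) * a (x, xi) * fourier u xi).

Definition cube (n : nat) (c : 'rV[R]_n) (l : R) : set 'rV[R]_n :=
  [set y | forall i, coord c i <= coord y i <= coord c i + l].
Definition lnull (n : nat) (N : set 'rV[R]_n) :=
  forall eps : R, 0 < eps -> exists (c : nat -> 'rV[R]_n) (l : nat -> R),
    (forall k, 0 < l k) /\ N `<=` \bigcup_k cube (c k) (l k) /\
    forall m, \sum_(k < m) l k ^+ n <= eps.
Definition ae_Rn (n : nat) (P : 'rV[R]_n -> Prop) :=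
  exists N, lnull N /\ forall x, ~ N x -> P x.
Definition borel_Rn (n : nat) : set (set 'rV[R]_n) :=
  smallest (sigma_algebra setT) (@open 'rV[R]_n).
Definition lmeasurable_set (n : nat) (A : set 'rV[R]_n) :=
  exists B N, borel_Rn B /\ lnull N /\ (A `\` B) `|` (B `\` A) `<=` N.
Definition lmeasurable_fun (n : nat) (f : 'rV[R]_n -> R) :=
  forall c : R, lmeasurable_set [set x | f x < c].

Definition locally_integrable (n : nat) (w : 'rV[R]_n -> R) :=
  lmeasurable_fun w /\
  forall c l, 0 < l -> (intRn (fun x => (\1_(cube c l) x * `|w x|)%:E) < +oo)%E.
Definition wmeas (n : nat) (w : 'rV[R]_n -> R) (E : set 'rV[R]_n) : \bar R :=
  intRn (fun x => (\1_E x * w x)%:E).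
Definition maximal (n : nat) (w : 'rV[R]_n -> R) (x : 'rV[R]_n) : \bar R :=
  ereal_sup [set y | exists (c : 'rV[R]_n) (l : R), (0 < l)%R /\ cube c l x /\
                       y = ((l ^+ n)^-1)%:E * wmeas w (cube c l)]%E.
(* M w <= A w a.e.; [w]_1 is the least such A *)
Definition A1_const (n : nat) (w : 'rV[R]_n -> R) (A : R) :=
  ae_Rn (fun x => (maximal w x <= (A * w x)%:E)%E).
Definition A1_weight (n : nat) (w : 'rV[R]_n -> R) :=
  (forall x, 0 <= w x) /\ locally_integrable w /\ exists A, A1_const w A.

Definition L1w_norm (n : nat) (w : 'rV[R]_n -> R) (u : 'rV[R]_n -> R[i]) : \bar R :=
  intRn (fun x => (cmod (u x) * w x)%:E).
Definition L1winf_norm (n : nat) (w : 'rV[R]_n -> R) (u : 'rV[R]_n -> R[i]) : \bar R :=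
  ereal_sup [set y | exists2 lam : R, (0 < lam)%R &
                y = lam%:E * wmeas w [set x | (lam < cmod (u x))%R]]%E.

End Defs.

(* Main.v *)
Require Import Defs.
From HB Require Import structures.
From mathcomp Require Import all_boot all_order all_algebra.
From mathcomp Require Import all_classical all_reals all_analysis.
From mathcomp Require Import complex ring lra measurable_realfun.
Import Order.TTheory GRing.Theory Num.Theory.
Import numFieldNormedType.Exports.
Set Implicit Arguments.
Unset Strict Implicit.
Unset Printing Implicit Defensive.
Local Open Scope classical_set_scope.
Local Open Scope ring_scope.

(** An operator of order -n with rho = 0 is bounded on L^1_w itself, and the weak-type inequality
    follows from this by Chebyshev. Write k(x,y) for the integral of e^{i<x-y,xi>} a(x,xi) over xi.
    By Tonelli it suffices that the integral of |k(x,y)| w(x) in x is at most C w(y) for almost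
    every y.

    Decay off the diagonal. Derivatives in xi do not worsen the size of a, so 2n integrations by
    parts in each xi_i give k(x,y) = k_b(x,y) / h(x-y), where h(z) = 1 + sum z_i^(2n) and b is again
    of size <xi>^(-n) ([osc_hw], [cutsym_symhyp]). If the integral of |k_b(.,y)| w over each cube Q
    of side 2^r, r >= 0, is at most C w(Q) ([kernel_cube]), then a sum over dyadic cubes centred at
    y, on which w has average at most A w(y), gives the claim ([kernel_weight]).

    Estimate on a cube. Cut b into dyadic annuli |xi| ~ 2^j; the j-th piece must gain u^j with u < 1
    ([kernel_piece]). Choose sigma strictly between 2^delta and 2, which is possible because delta <
    1, split Q into cells of side l ~ sigma^(-j), and on each cell freeze the variable x of b
    ([frozen_cell]). An x-derivative costs 2^(delta j) and the integral of |b| over the annulus is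
    O(1), so freezing costs O((2^delta/sigma)^j). To pass from Lebesgue measure to w, use the
    reverse Hoelder inequality of A_1 weights ([reverse_holder], by a Bellman function): the region
    where w is larger than T times its average carries a fraction O(T^(-p)) of w, and there the
    trivial bound O(1) on the kernel suffices ([cell_bound]). Letting T grow geometrically in j,
    slowly, makes every term decay geometrically.

    Rigour. A factor [env e], tending to 1 as e tends to 0, makes all integrals absolutely
    convergent with bounds uniform in e; Fatou's lemma removes it ([strong_bound]). Complex
    integrals are split into real ones, each with a cosine and a phase ([osc], [psidoE]). The weight
    is replaced by a Borel function off a null set ([borel_weight]), and the iterated integral
    [intRn] is compared with the integral against the product measure [lebn]. *)

(** * Borel structure and Lebesgue measure on row vectors, and the iterated integral *)

Section BorelSpace.
Variable R : realType.

(** The sigma-algebra is the one of [borel_Rn], so the Borel sets occurring in [lmeasurable_set] are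
    measurable sets here without translation. *)
Definition Tn (n : nat) := g_sigma_algebraType (@open 'rV[R]_n).

Definition consR (n : nat) (t : R) (v : 'rV[R]_n) : 'rV[R]_n.+1 :=
  \row_i (if unlift ord0 i is Some j then v ord0 j else t).

Lemma consR0 n t (v : 'rV[R]_n) : consR t v ord0 ord0 = t.
Proof. by rewrite mxE unlift_none. Qed.

Lemma consR_lift n t (v : 'rV[R]_n) j : consR t v ord0 (lift ord0 j) = v ord0 j.
Proof. by rewrite mxE liftK. Qed.

Lemma intRnS n (g : 'rV[R]_n.+1 -> \bar R) :
  intRn g = (\int[@lebesgue_measure R]_t intRn (fun v => g (consR t v)))%E.
Proof.
rewrite /intRn /=; apply: eq_integral => t _; congr iint; apply/funext => x.
congr g; apply/rowP => i; rewrite !mxE.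
by case: unliftP => [j ->|->]; rewrite ?mxE.
Qed.

Lemma intRn0 (g : 'rV[R]_0 -> \bar R) : intRn g = g 0.
Proof. by rewrite /intRn /=; congr g; apply/rowP => -[]. Qed.

(** A countable base of the topology: through it, measurability into [Tn] can be tested on
    coordinates. *)
Definition ratbox n (p : 'rV[rat]_n * rat) : set 'rV[R]_n :=
  [set x | forall i, `|x ord0 i - ratr (p.1 ord0 i)| < ratr p.2].

Lemma open_ratbox n (U : set 'rV[R]_n) : open U ->
  U = \bigcup_(p in [set p | ratbox p `<=` U]) ratbox p.
Proof.
move=> oU; apply/seteqP; split=> [x Ux|x [p pU px]]; last exact: pU.
have /nbhs_ballP[e /= e0 eU] : nbhs x U by exact: open_nbhs_nbhs.
have [r] := @rat_in_itvoo R 0 (e / 2) (divr_gt0 e0 (@ltr0Sn _ 1)).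
rewrite in_itv /= => /andP[r0 re].
have /choice[q qP] : forall i, exists q : rat, `|x ord0 i - ratr q| < ratr r.
  move=> i; have [] := @rat_in_itvoo R (x ord0 i - ratr r) (x ord0 i + ratr r).
    by rewrite ltrD2l gtrN.
  by move=> q; rewrite in_itv /= => qi; exists q; rewrite distrC ltr_distl.
exists (\row_i q i, r) => [y /= yb|]; last by move=> i; rewrite mxE; exact: qP.
apply: eU; split=> // i j; rewrite ord1 {i}.
rewrite /ball /= [e]splitr (le_lt_trans (ler_distD (ratr (q j)) _ _)) //.
apply: ltrD; first by apply: lt_trans re.
by rewrite distrC; apply: lt_trans re; have := yb j; rewrite /= mxE.
Qed.

Lemma measurable_Tn d (X : measurableType d) n (g : X -> 'rV[R]_n) :
  (forall i, measurable_fun setT (fun x => g x ord0 i)) ->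
  measurable_fun setT (g : X -> Tn n).
Proof.
move=> mg; apply: (@measurability _ _ X (Tn n) setT g (@open 'rV[R]_n)) => //.
move=> _ [U oU <-]; rewrite setTI (open_ratbox oU) preimage_bigcup.
rewrite bigcup_mkcond; apply: countable_bigcupT_measurable => [//|p].
case: ifPn => // _.
rewrite (_ : g @^-1` ratbox p = \bigcap_(i in [set: 'I_n])
   ((fun x => g x ord0 i) @^-1` `](ratr (p.1 ord0 i) - ratr p.2),
                                 (ratr (p.1 ord0 i) + ratr p.2)[)); last first.
  apply/seteqP; split => x /=.
    by move=> h i _ /=; rewrite in_itv /= -ltr_distl; exact: h.
  by move=> h i; have := h i I; rewrite /= in_itv /= -ltr_distl.
apply: fin_bigcap_measurable => // i _.
by rewrite -[X in measurable X]setTI; apply: mg.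
Qed.

Lemma open_measurable_Tn n (U : set 'rV[R]_n) :
  open U -> measurable (U : set (Tn n)).
Proof. by move=> oU; apply: sub_sigma_algebra. Qed.

Lemma cont_measurable_Tn n (f : 'rV[R]_n -> R) :
  continuous f -> measurable_fun setT (f : Tn n -> R).
Proof.
move=> /continuousP cf; apply: (measurability _ (RGenOpens.measurableE R)).
move=> _ [_ [a [b ->] <-]]; rewrite setTI; apply: open_measurable_Tn.
exact/cf/interval_open.
Qed.

Lemma continuous_coord n (i : 'I_n) : continuous (fun x : 'rV[R]_n => x ord0 i).
Proof. exact: coord_continuous. Qed.

Lemma measurable_coord n i : measurable_fun setT (fun x : Tn n => x ord0 i).
Proof. by apply: cont_measurable_Tn; apply: continuous_coord. Qed.

(** The product sigma-algebra is generated by rectangles, while continuity of [f] speaks of open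
    sets of the product topology. The two meet because such an open set is a countable union of
    products of rational boxes. *)
Lemma measurable_Tn2 d (X : measurableType d) m n (f : 'rV[R]_m * 'rV[R]_n -> R)
    (g : X -> 'rV[R]_m) (h : X -> 'rV[R]_n) : continuous f ->
  measurable_fun setT (g : X -> Tn m) -> measurable_fun setT (h : X -> Tn n) ->
  measurable_fun setT (fun x => f (g x, h x)).
Proof.
move=> /continuousP cf mg mh.
have mratbox k (p : 'rV[rat]_k * rat) : measurable (ratbox p : set (Tn k)).
  rewrite (_ : ratbox p = \bigcap_(i in [set: 'I_k])
     ((fun x : Tn k => x ord0 i) @^-1` `](ratr (p.1 ord0 i) - ratr p.2),
                                 (ratr (p.1 ord0 i) + ratr p.2)[)); last first.
    apply/seteqP; split => x /=.
      by move=> H i _ /=; rewrite in_itv /= -ltr_distl; exact: H.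
    by move=> H i; have := H i I; rewrite /= in_itv /= -ltr_distl.
  apply: fin_bigcap_measurable => // i _.
  by rewrite -[X in measurable X]setTI; apply: measurable_coord.
apply: (measurability _ (RGenOpens.measurableE R)).
move=> _ [_ [a [b ->] <-]]; rewrite setTI.
set W := f @^-1` `]a, b[%classic.
have oW : open W by exact/cf/interval_open.
rewrite (_ : _ @^-1` _ = \bigcup_(pq in [set pq : ('rV[rat]_m * rat) * ('rV[rat]_n * rat) |
    ratbox pq.1 `*` ratbox pq.2 `<=` W])
    (g @^-1` ratbox pq.1 `&` h @^-1` ratbox pq.2)).
  rewrite bigcup_mkcond; apply: countable_bigcupT_measurable => [//|p].
  case: ifPn => // _; apply: measurableI; rewrite -[X in measurable X]setTI.
    exact: mg.
  exact: mh.
apply/seteqP; split=> x /= => [Wx|[[p q] /= pqW [gp hq]]]; last exact: (pqW (_, _)).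
have [[A B] /= [nA nB] ABW] : nbhs (g x, h x) W by exact: open_nbhs_nbhs.
have := nbhs_singleton (nbhs_interior nA); rewrite (open_ratbox (@open_interior _ A)).
have := nbhs_singleton (nbhs_interior nB); rewrite (open_ratbox (@open_interior _ B)).
move=> [q qB hq] [p pA gp]; exists (p, q) => //= -[u v] [/= pu qv].
by apply: ABW; split => /=; apply: interior_subset; [apply: pA|apply: qB].
Qed.

Lemma measurable_cons n : measurable_fun setT
  ((fun z : measurableTypeR R * Tn n => consR z.1 z.2) : _ -> Tn n.+1).
Proof.
apply: measurable_Tn => i; case: (unliftP ord0 i) => [j ->|->].
  under eq_fun do rewrite consR_lift.
  exact: (measurableT_comp (measurable_coord j) measurable_snd).
by under eq_fun do rewrite consR0; exact: measurable_fst.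
Qed.

Lemma measurable_cons1 n (t : R) : measurable_fun setT (consR t : Tn n -> Tn n.+1).
Proof.
apply: measurable_Tn => i; case: (unliftP ord0 i) => [j ->|->].
  by under eq_fun do rewrite consR_lift; exact: measurable_coord.
by under eq_fun do rewrite consR0; exact: measurable_cst.
Qed.

Section push.
Variables (n : nat) (m : {sigma_finite_measure set (Tn n) -> \bar R}).

Definition pushcons : set (Tn n.+1) -> \bar R :=
  @pushforward _ _ _ (Tn n.+1) _ (@lebesgue_measure R \x m)%E
    (fun z => consR z.1 z.2).

HB.instance Definition _ := Measure.copy pushcons
  (measure_function_pushforward__canonical__measure_function_Measure
     (@lebesgue_measure R \x m)%E (@measurable_cons n)).

Let pushcons_sigma_finite : sigma_finite setT pushcons.
Proof.
have /sigma_finiteP[F [TF ndF Foo]] := sigma_finiteT (@lebesgue_measure R).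
have /sigma_finiteP[G [TG ndG Goo]] := sigma_finiteT m.
exists (fun k => [set x : Tn n.+1 | F k (x ord0 ord0) /\
    G k (\row_j x ord0 (lift ord0 j))]).
  apply/esym; rewrite -subTset => x _.
  have [i _ Fi] : (\bigcup_i F i) (x ord0 ord0) by rewrite -TF.
  have [j _ Gj] : (\bigcup_i G i) (\row_j x ord0 (lift ord0 j)) by rewrite -TG.
  exists (maxn i j) => //; split.
    by move: Fi; exact/subsetPset/ndF/leq_maxl.
  by move: Gj; exact/subsetPset/ndG/leq_maxr.
move=> k; have [mF Fk] := Foo k; have [mG Gk] := Goo k; split.
  apply: measurableI; rewrite -[X in measurable X]setTI.
    exact: measurable_coord.
  suff: measurable_fun setT (fun x : Tn n.+1 => \row_j x ord0 (lift ord0 j) : Tn n).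
    by apply.
  apply: measurable_Tn => i; under eq_fun do rewrite mxE.
  exact: measurable_coord.
rewrite /pushcons /pushforward.
rewrite (_ : _ @^-1` _ = F k `*` G k).
  by rewrite product_measure1E// lte_mul_pinfty// ge0_fin_numE.
apply/seteqP; split => -[t v] /=; rewrite consR0;
  (have -> : \row_j consR t v ord0 (lift ord0 j) = v
    by apply/rowP => j; rewrite mxE consR_lift) => //.
Qed.

HB.instance Definition _ := Measure_isSigmaFinite.Build _ _ _ pushcons
  pushcons_sigma_finite.
End push.

(** Built one coordinate at a time so that integrals against it unfold in step with [iint]. *)
Fixpoint lebn (n : nat) : {sigma_finite_measure set (Tn n) -> \bar R} :=
  match n with
  | 0 => (@dirac _ (Tn 0) (0 : 'rV[R]_0) R
      : {sigma_finite_measure set (Tn 0) -> \bar R})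
  | k.+1 => pushcons (lebn k)
  end.

Lemma measurable_consT n (g : Tn n.+1 -> \bar R) : measurable_fun setT g ->
  measurable_fun setT (fun z : measurableTypeR R * Tn n => g (consR z.1 z.2)).
Proof. by move=> mg; apply: (measurableT_comp mg (@measurable_cons n)). Qed.

Lemma ge0_integral_lebnS n (g : Tn n.+1 -> \bar R) : measurable_fun setT g ->
  (forall x, 0 <= g x)%E ->
  (\int[lebn n.+1]_x g x =
   \int[@lebesgue_measure R]_t \int[lebn n]_v g (consR t v))%E.
Proof.
move=> mg g0.
rewrite [LHS](@ge0_integral_pushforward _ _ (measurableTypeR R * Tn n)%type
  (Tn n.+1) R _ (@measurable_cons n) (@lebesgue_measure R \x lebn n)%E) //.
rewrite preimage_setT.
rewrite (fubini_tonelli1 (fun z : measurableTypeR R * Tn n => g (consR z.1 z.2))) //=.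
exact: measurable_consT.
Qed.

Lemma ge0_intRnE n (g : 'rV[R]_n -> \bar R) :
  measurable_fun setT (g : Tn n -> \bar R) -> (forall x, 0 <= g x)%E ->
  intRn g = (\int[lebn n]_x g x)%E.
Proof.
elim: n g => [|n ih] g mg g0.
  by rewrite intRn0 integral_dirac // diracT mul1e.
rewrite intRnS ge0_integral_lebnS //; apply: eq_integral => t _.
rewrite ih //; exact: (measurableT_comp mg (@measurable_cons1 _ _)).
Qed.

Section nonmeasurable.
Local Open Scope ereal_scope.
Import HBNNSimple.
Context d (T : measurableType d) (mu : {measure set T -> \bar R}).

(* The integral of an arbitrary nonnegative function is its lower integral *)
Lemma le_lower_integral (N : set T) (f g : T -> \bar R) :
  measurable N -> mu N = 0 -> (forall x, 0 <= f x) -> (forall x, 0 <= g x) ->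
  (forall x, ~ N x -> f x <= g x) -> \int[mu]_x f x <= \int[mu]_x g x.
Proof.
move=> mN N0 f0 g0 fg; rewrite !ge0_integralTE //; apply: ge_ereal_sup.
move=> _ [h /= hf <-].
have mNC : measurable (~` N) by exact: measurableC.
(* A simple function below [f], cut to 0 on [N], lies below [g] and keeps its integral. *)
apply: le_ereal_sup_tmp; exists (sintegral mu (proj_nnsfun h mNC)).
  exists (proj_nnsfun h mNC) => //= x; rewrite mindicE.
  have [xN|xN] := pselect (N x).
    by rewrite memNset ?mulr0 // => /(_ xN).
  by rewrite mem_set // mulr1 (le_trans (hf x)) // fg.
rewrite -!integralT_nnsfun (ge0_negligible_integral mN) //.
  rewrite setTD integral_mkcond le_eqVlt; apply/orP; left; apply/eqP.
  apply: eq_integral => x _ /=.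
  rewrite patchE mindicE; case: ifPn => _; rewrite ?mulr1 ?mulr0 //.
  exact/measurable_EFinP.
by move=> x _ /=; rewrite lee_fin.
Qed.

Lemma eq_ae_integral (N : set T) (f g : T -> \bar R) :
  measurable N -> mu N = 0 -> (forall x, ~ N x -> f x = g x) ->
  \int[mu]_x f x = \int[mu]_x g x.
Proof.
move=> mN N0 fg; rewrite integralE [RHS]integralE; congr (_ - _).
  by apply/eqP; rewrite eq_le; apply/andP; split;
    apply: (le_lower_integral mN N0) => // x Nx; rewrite !funeposE fg.
by apply/eqP; rewrite eq_le; apply/andP; split;
  apply: (le_lower_integral mN N0) => // x Nx; rewrite !funenegE fg.
Qed.
End nonmeasurable.

Lemma intRn_ge0 n (f : 'rV[R]_n -> \bar R) :
  (forall x, 0 <= f x)%E -> (0 <= intRn f)%E.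
Proof.
elim: n f => [|n ih] f f0; first by rewrite intRn0.
by rewrite intRnS integral_ge0 // => t _; exact: ih.
Qed.

(** Tonelli for the indicator of [N]: the measures of the sections are nonnegative and have integral
    0 in [t]. *)
Lemma lebn_section0 n (N : set (Tn n.+1)) : measurable N -> lebn n.+1 N = 0%E ->
  exists2 M : set (measurableTypeR R), measurable M /\ lebesgue_measure M = 0%E &
    forall t, ~ M t -> measurable (consR t @^-1` N : set (Tn n)) /\
                       lebn n (consR t @^-1` N) = 0%E.
Proof.
move=> mN N0.
have mNt t : measurable (consR t @^-1` N : set (Tn n)).
  by rewrite -[X in measurable X]setTI; exact: measurable_cons1.
have mg : measurable_fun setT (fun x : Tn n.+1 => (\1_N x)%:E : \bar R).
  by apply/measurable_EFinP; exact: measurable_indic.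
have Nt t : (\int[lebn n]_v (\1_N (consR t v))%:E)%E = lebn n (consR t @^-1` N).
  by rewrite -(setIT (_ @^-1` _)) -integral_indic.
have : (\int[@lebesgue_measure R]_t lebn n (consR t @^-1` N) = 0)%E.
  under eq_integral do rewrite -Nt.
  by rewrite -(ge0_integral_lebnS mg) ?integral_indic ?setIT.
have mF : measurable_fun setT (fun t : measurableTypeR R => lebn n (consR t @^-1` N)).
  under eq_fun do rewrite -Nt.
  exact: (measurable_fun_fubini_tonelli_F
    (fun z : measurableTypeR R * Tn n => (\1_N (consR z.1 z.2))%:E) (measurable_consT mg)).
move=> h.
have /(ae_eq_integral_abs lebesgue_measure measurableT mF)[M [mM M0 NM]] :
    (\int[@lebesgue_measure R]_t `|lebn n (consR t @^-1` N)| = 0)%E.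
  by rewrite -[RHS]h; apply: eq_integral => t _; rewrite gee0_abs.
exists M => // t Mt; split=> //; apply: contrapT => Nt0.
by apply/Mt/NM => /= /(_ I).
Qed.

(** Integrals of nonnegative functions are lower integrals, hence monotone without measurability of
    [f] or [g]. This is what allows a Lebesgue measurable weight to be exchanged for a Borel one
    inside [intRn]. *)
Lemma le_intRn_ae n (N : set (Tn n)) (f g : 'rV[R]_n -> \bar R) :
  measurable N -> lebn n N = 0%E ->
  (forall x, 0 <= f x)%E -> (forall x, 0 <= g x)%E ->
  (forall x, ~ N x -> f x <= g x)%E -> (intRn f <= intRn g)%E.
Proof.
elim: n N f g => [|n ih] N f g mN N0 f0 g0 fg.
  rewrite !intRn0; apply: fg => N00; move: N0.
  by rewrite /= diracE mem_set // => /eqP; rewrite onee_eq0.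
rewrite !intRnS; have [M [mM M0] hM] := lebn_section0 mN N0.
apply: (le_lower_integral mM M0); [by move=> t; exact: intRn_ge0.. |].
move=> t /hM[mNt Nt0]; apply: (ih _ _ _ mNt Nt0) => // v; exact: fg.
Qed.

Lemma eq_intRn_ae n (N : set (Tn n)) (f g : 'rV[R]_n -> \bar R) :
  measurable N -> lebn n N = 0%E ->
  (forall x, 0 <= f x)%E -> (forall x, 0 <= g x)%E ->
  (forall x, ~ N x -> f x = g x)%E -> intRn f = intRn g.
Proof.
move=> mN N0 f0 g0 fg; apply/eqP; rewrite eq_le.
by apply/andP; split; apply: (le_intRn_ae mN N0) => // x /fg ->.
Qed.

Lemma integral_lebnS n (g : Tn n.+1 -> \bar R) :
  (lebn n.+1).-integrable setT g ->
  (\int[lebn n.+1]_x g x =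
   \int[@lebesgue_measure R]_t \int[lebn n]_v g (consR t v))%E /\
  exists2 M : set (measurableTypeR R), measurable M /\ lebesgue_measure M = 0%E &
    forall t, ~ M t -> (lebn n).-integrable setT (fun v => g (consR t v)).
Proof.
move=> ig; have mg := measurable_int _ ig.
pose g2 (z : measurableTypeR R * Tn n) := g (consR z.1 z.2).
have ig2 : (@lebesgue_measure R \x lebn n)%E.-integrable setT g2.
  apply/integrable12ltyP; first exact: measurable_consT.
  rewrite -(@ge0_integral_lebnS _ (fun x => `|g x|)%E); first last.
  - by move=> x.
  - exact: measurableT_comp.
  by move/integrableP : ig => [].
split.
  rewrite (integral12_prod_meas1 ig2).
  exact: (@integral_pushforward _ _ (measurableTypeR R * Tn n)%type
    (Tn n.+1) R _ (@measurable_cons n) (@lebesgue_measure R \x lebn n)%E).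
have [M [mM M0 NM]] := ae_integrable1 ig2.
by exists M => // t Mt; apply: contrapT => Nt; apply/Mt/NM.
Qed.

Lemma intRnE n (g : 'rV[R]_n -> \bar R) : (lebn n).-integrable setT (g : Tn n -> _) ->
  intRn g = (\int[lebn n]_x g x)%E.
Proof.
elim: n g => [|n ih] g ig.
  by rewrite intRn0 integral_dirac ?diracT ?mul1e //; exact: measurable_int ig.
have [-> [M [mM M0 hM]]] := integral_lebnS ig.
rewrite intRnS; apply: (eq_ae_integral mM M0) => t /hM; exact: ih.
Qed.

End BorelSpace.

(** * Translation invariance, product integrands, cubes and null sets *)

Section LebnProps.
Variable R : realType.
Local Notation mu := (@lebesgue_measure R).

(** Lebesgue measure is determined by its values on half-open intervals, and its image under a
    translation has the same values. *)
Lemma ge0_integral_shift1 (f : R -> \bar R) (a : R) :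
  measurable_fun setT f -> (forall x, 0 <= f x)%E ->
  (\int[mu]_x f (x + a)%R = \int[mu]_x f x)%E.
Proof.
move=> mf f0.
have ms : measurable_fun setT ((fun x => x + a) : measurableTypeR R -> measurableTypeR R).
  by apply: measurable_funD => //; exact: measurable_cst.
have := @ge0_integral_pushforward _ _ (measurableTypeR R) (measurableTypeR R) R _ ms mu setT f
   measurableT mf (fun y _ => f0 y).
rewrite preimage_setT => <-.
apply: eq_measure_integral => /= A mA _.
apply/esym/lebesgue_measure_unique => //= _ [[u v]] _ <-; rewrite /pushforward.
rewrite (_ : _ @^-1` _ = `]u - a, v - a]%classic); last first.
  by apply/seteqP; split=> x /=; rewrite !in_itv/= ltrBlDr lerBrDr.
rewrite !lebesgue_measure_itv /= !lte_fin ltrD2r; case: ifPn => // _.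
by rewrite -!EFinB; congr (_%:E); lra.
Qed.

Lemma measurable_shift n (v : 'rV[R]_n) :
  measurable_fun setT ((fun x => x + v) : Tn R n -> Tn R n).
Proof.
apply: measurable_Tn => i; under eq_fun do rewrite mxE.
by apply: measurable_funD => //; exact: measurable_coord.
Qed.

Lemma ge0_integral_shift n (f : Tn R n -> \bar R) (v : 'rV[R]_n) :
  measurable_fun setT f -> (forall x, 0 <= f x)%E ->
  (\int[lebn R n]_x f (x + v)%R = \int[lebn R n]_x f x)%E.
Proof.
elim: n f v => [|n ih] f v mf f0.
  by apply: eq_integral => x _; congr f; apply/rowP => -[].
have mfv : measurable_fun setT (fun x : Tn R n.+1 => f (x + v)).
  exact: (measurableT_comp mf (@measurable_shift _ v)).
rewrite !ge0_integral_lebnS // -[RHS](@ge0_integral_shift1 _ (v ord0 ord0)) //; last 2 first.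
- exact: (measurable_fun_fubini_tonelli_F
    (fun z : measurableTypeR R * Tn R n => f (consR z.1 z.2)) (measurable_consT mf) (fun z => f0 _)).
- by move=> t; apply: integral_ge0 => *; exact: f0.
apply: eq_integral => t _.
rewrite -[RHS](ih _ (\row_j v ord0 (lift ord0 j))) => [|//|x]; last exact: f0.
  apply: eq_integral => x _; congr f; apply/rowP => i.
  rewrite [LHS]mxE; case: (unliftP ord0 i) => [j ->|->].
    by rewrite !consR_lift [RHS]mxE mxE.
  by rewrite !consR0.
exact: (measurableT_comp mf (@measurable_cons1 _ _ _)).
Qed.

Lemma integral_shift n (f : Tn R n -> \bar R) (v : 'rV[R]_n) :
  measurable_fun setT f ->
  (\int[lebn R n]_x f (x + v)%R = \int[lebn R n]_x f x)%E.
Proof.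
move=> mf; rewrite integralE [RHS]integralE; congr (_ - _)%E.
  rewrite -(@ge0_integral_shift _ (f^\+)%E v) //; last exact: measurable_funepos.
  by apply: eq_integral => x _; rewrite !funeposE.
rewrite -(@ge0_integral_shift _ (f^\-)%E v) //; last exact: measurable_funeneg.
by apply: eq_integral => x _; rewrite !funenegE.
Qed.

Lemma measurable_prodc n (g : 'I_n -> R -> R) :
  (forall i, measurable_fun setT (g i)) ->
  measurable_fun setT (fun x : Tn R n => \prod_i g i (x ord0 i)).
Proof.
move=> mg; apply: measurable_prod => i _.
exact: (measurableT_comp (mg i) (measurable_coord i)).
Qed.

Lemma integral_prod n (g : 'I_n -> R -> R) (c : 'I_n -> R) :
  (forall i, measurable_fun setT (g i)) -> (forall i t, 0 <= g i t) ->
  (forall i, \int[mu]_t (g i t)%:E = (c i)%:E)%E ->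
  (\int[lebn R n]_x (\prod_i g i (x ord0 i))%:E = (\prod_i c i)%:E)%E.
Proof.
elim: n g c => [|n ih] g c mg g0 gc.
  rewrite big_ord0 (eq_integral (cst 1%:E)); last by move=> x _; rewrite big_ord0.
  by rewrite integral_dirac ?diracT ?mul1e.
rewrite ge0_integral_lebnS; last 2 first.
- by apply/measurable_EFinP; apply: measurable_prodc.
- by move=> x; rewrite lee_fin prodr_ge0.
transitivity (\int[mu]_t ((g ord0 t)%:E * (\prod_(i < n) c (lift ord0 i))%:E))%E.
  apply: eq_integral => t _.
  rewrite -(ih (fun i => g (lift ord0 i))) // -ge0_integralZl //.
  - apply: eq_integral => x _; rewrite big_ord_recl consR0 -EFinM; congr (_ * _)%:E.
    by apply: eq_bigr => i _; rewrite consR_lift.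
  - by apply/measurable_EFinP; apply: (measurable_prodc (g := fun i => g (lift ord0 i))).
  - by move=> x _; rewrite lee_fin prodr_ge0.
  - by rewrite lee_fin.
rewrite ge0_integralZr //.
- by rewrite gc big_ord_recl EFinM.
- by apply/measurable_EFinP; exact: mg.
- by move=> t _; rewrite lee_fin.
- rewrite lee_fin prodr_ge0 // => i _; rewrite -lee_fin -gc.
  by apply: integral_ge0 => t _; rewrite lee_fin.
Qed.

(** Half-open, so that the 2^n children of a cube form an exact partition. *)
Definition hcube n (c : 'rV[R]_n) (l : R) : set 'rV[R]_n :=
  [set x | forall i, c ord0 i <= x ord0 i < c ord0 i + l].

Lemma indic_box n (P : 'I_n -> set R) (x : 'rV[R]_n) :
  \1_[set x : 'rV[R]_n | forall i, P i (x ord0 i)] x = \prod_i \1_(P i) (x ord0 i) :> R.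
Proof.
rewrite indicE; case: (boolP (x \in _)) => [|] /=; rewrite ?inE ?notin_setE /= => h.
  by rewrite big1 // => i _; rewrite indicE mem_set.
have /existsNP[i Pi] := h.
by rewrite (bigD1 i) //= indicE memNset // mul0r.
Qed.

Lemma measurable_box n (P : 'I_n -> set (measurableTypeR R)) :
  (forall i, measurable (P i)) ->
  measurable ([set x | forall i, P i (x ord0 i)] : set (Tn R n)).
Proof.
move=> mP; rewrite [X in measurable X](_ : _ =
  \bigcap_(i in [set: 'I_n]) ((fun x : Tn R n => x ord0 i) @^-1` P i)).
  apply: fin_bigcap_measurable => // i _.
  by rewrite -[X in measurable X]setTI; apply: measurable_coord => //; exact: mP.
by apply/seteqP; split => x /= h i; [move=> _|]; apply: (h i).
Qed.

Lemma lebn_box n (P : 'I_n -> set (measurableTypeR R)) (l : R) :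
  (forall i, measurable (P i)) -> (forall i, mu (P i) = l%:E) ->
  lebn R n [set x | forall i, P i (x ord0 i)] = (l ^+ n)%:E.
Proof.
move=> mP Pl; rewrite -[X in lebn R n X]setIT -integral_indic //; last exact: measurable_box.
under eq_integral do rewrite indic_box.
rewrite (integral_prod (g := fun i => \1_(P i)) (c := fun=> l)) //.
- by rewrite prodr_const card_ord.
- by move=> i; apply: measurable_indic; exact: mP.
- by move=> i; rewrite (integral_indic _ measurableT (mP i)) setIT; exact: Pl.
Qed.

Lemma hcubeE n (c : 'rV[R]_n) l : hcube c l =
  [set x | forall i, `[c ord0 i, c ord0 i + l[%classic (x ord0 i)].
Proof. by apply/seteqP; split => x /= h i; have := h i; rewrite in_itv. Qed.

Lemma cubeE n (c : 'rV[R]_n) l : cube c l =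
  [set x | forall i, `[c ord0 i, c ord0 i + l]%classic (x ord0 i)].
Proof. by apply/seteqP; split => x /= h i; have := h i; rewrite in_itv. Qed.

Lemma measurable_hcube n (c : 'rV[R]_n) l : measurable (hcube c l : set (Tn R n)).
Proof.
rewrite hcubeE; apply: (measurable_box (P := fun i => `[c ord0 i, c ord0 i + l[%classic)) => i.
exact: measurable_itv.
Qed.

Lemma measurable_cube n (c : 'rV[R]_n) l : measurable (cube c l : set (Tn R n)).
Proof.
rewrite cubeE; apply: (measurable_box (P := fun i => `[c ord0 i, c ord0 i + l]%classic)) => i.
exact: measurable_itv.
Qed.

Lemma lebn_hcube n (c : 'rV[R]_n) l : 0 < l -> lebn R n (hcube c l) = (l ^+ n)%:E.
Proof.
move=> l0; rewrite hcubeE.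
apply: (lebn_box (P := fun i => `[c ord0 i, c ord0 i + l[%classic)) => i.
  exact: measurable_itv.
by rewrite lebesgue_measure_itv /= lte_fin ltrDl l0 -EFinB addrAC subrr add0r.
Qed.

Lemma lebn_cube n (c : 'rV[R]_n) l : 0 < l -> lebn R n (cube c l) = (l ^+ n)%:E.
Proof.
move=> l0; rewrite cubeE.
apply: (lebn_box (P := fun i => `[c ord0 i, c ord0 i + l]%classic)) => i.
  exact: measurable_itv.
by rewrite lebesgue_measure_itv /= lte_fin ltrDl l0 -EFinB addrAC subrr add0r.
Qed.

(** For each k there is a countable union of cubes of measure at most 1/(k+1) containing [N]; the
    intersection over k is the required Borel set. *)
Lemma lnull_Borel n (N : set 'rV[R]_n) : lnull N ->
  exists2 G : set (Tn R n), measurable G /\ lebn R n G = 0%E & N `<=` G.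
Proof.
move=> hN.
have /choice[F hF] : forall k : nat, exists F : set (Tn R n),
    [/\ measurable F, N `<=` F & (lebn R n F <= (k.+1%:R^-1)%:E)%E].
  move=> k; have [|c [l [l0 [Nc lc]]]] := hN (k.+1%:R^-1); first by rewrite invr_gt0.
  exists (\bigcup_j cube (c j) (l j)).
  have mU : measurable (\bigcup_j cube (c j) (l j) : set (Tn R n)).
    by apply: bigcupT_measurable => j; exact: measurable_cube.
  split=> //; apply: le_trans (generalized_Boole_inequality (lebn R n) _ mU) _.
    by move=> j; exact: measurable_cube.
  apply: lime_le; first by apply: is_cvg_nneseries.
  apply: nearW => m; rewrite big_mkord.
  rewrite (eq_bigr (fun j : 'I_m => (l j ^+ n)%:E)).
    by rewrite sumEFin lee_fin; exact: lc.
  by move=> j _; apply: lebn_cube; exact: l0.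
exists (\bigcap_k F k); last by move=> x Nx k _; have [_ + _] := hF k; exact.
have mF : measurable (\bigcap_k F k) by apply: bigcapT_measurable => k; have [] := hF k.
split => //; apply/eqP; rewrite eq_le measure_ge0 andbT; apply/lee_addgt0Pr => e e0.
have [k] := @ltr_add_invr R 0 e e0; rewrite !add0r => ke.
have [mFk _ Fk] := hF k.
apply: (@le_trans _ _ (lebn R n (F k))).
  by apply: le_measure; rewrite ?inE//; exact: bigcap_inf.
by apply: le_trans Fk _; rewrite lee_fin ltW.
Qed.
End LebnProps.

(** * Integrals of real-valued functions *)

Section RealIntegral.
Context d (T : measurableType d) (R : realType) (mu : {measure set T -> \bar R}).
Implicit Types f g : T -> R.

Definition itg (f : T -> R) := mu.-integrable setT (EFin \o f).

Lemma itg_measurable f : itg f -> measurable_fun setT f.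
Proof. by move=> /measurable_int/measurable_EFinP. Qed.

Lemma itg_le f g : measurable_fun setT f -> (forall x, `|f x| <= g x) ->
  itg g -> itg f.
Proof.
move=> mf fg ig; apply: le_integrable ig => //; first exact/measurable_EFinP.
by move=> x _ /=; rewrite lee_fin (le_trans (fg x)) // ler_norm.
Qed.

Lemma itg0 : itg (fun=> 0).
Proof. exact: integrable0. Qed.

Lemma itgD f g : itg f -> itg g -> itg (fun x => f x + g x).
Proof. by move=> /integrableD h /h => /(_ measurableT). Qed.

Lemma itgZ k f : itg f -> itg (fun x => k * f x).
Proof. by move=> /(integrableZl measurableT k). Qed.

Lemma itg_sum (I : Type) (s : seq I) (f : I -> T -> R) :
  (forall i, itg (f i)) -> itg (fun x => \sum_(i <- s) f i x).
Proof.
move=> h; elim: s => [|i s ih].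
  by rewrite (_ : (fun _ => _) = fun=> 0) ?itg0 //; apply/funext => x; rewrite big_nil.
rewrite (_ : (fun _ => _) = fun x => f i x + \sum_(i <- s) f i x); first exact: itgD.
by apply/funext => x; rewrite big_cons.
Qed.

Lemma itg_norm f : itg f -> itg (fun x => `|f x|).
Proof. exact: integrable_norm. Qed.

Lemma EFin_Rintegral f : itg f -> (\int[mu]_x f x)%:E = (\int[mu]_x (f x)%:E)%E.
Proof. by move=> h; rewrite /Rintegral fineK // integrable_fin_num. Qed.

Lemma Rintegral_norm_le f g : measurable_fun setT f -> (forall x, `|f x| <= g x) ->
  itg g -> `|\int[mu]_x f x| <= \int[mu]_x g x.
Proof.
move=> mf fg ig; have jf := itg_le mf fg ig.
apply: le_trans (le_normr_Rintegral measurableT jf) _.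
by apply: le_Rintegral => //; exact: itg_norm.
Qed.

Lemma Rintegral_sum (I : Type) (s : seq I) (f : I -> T -> R) :
  (forall i, itg (f i)) ->
  \int[mu]_x (\sum_(i <- s) f i x) = \sum_(i <- s) \int[mu]_x f i x.
Proof.
move=> h; elim: s => [|i s ih].
  rewrite big_nil /Rintegral integral0_eq // => x _.
  by rewrite big_nil.
rewrite big_cons -ih -RintegralD //; [|exact: h|exact: itg_sum].
by apply: eq_Rintegral => x _; rewrite big_cons.
Qed.

Lemma itg_ltey f : measurable_fun setT f -> (forall x, 0 <= f x) ->
  (\int[mu]_x (f x)%:E < +oo)%E -> itg f.
Proof.
move=> mf f0 h; apply/integrableP; split; first exact/measurable_EFinP.
by apply: le_lt_trans h; rewrite le_eqVlt; apply/orP; left; apply/eqP;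
  apply: eq_integral => x _ /=; rewrite ger0_norm.
Qed.

End RealIntegral.

(** * Fubini for real-valued integrals *)

Section RealFubini.
Context d1 d2 (T1 : measurableType d1) (T2 : measurableType d2) (R : realType).
Variables (m1 : {sigma_finite_measure set T1 -> \bar R}).
Variables (m2 : {sigma_finite_measure set T2 -> \bar R}).

Lemma measurable_Rintegral (F : T1 * T2 -> R) : measurable_fun setT F ->
  measurable_fun setT (fun x => \int[m2]_y F (x, y)).
Proof.
move=> mF; apply: measurableT_comp => //.
have mF' : measurable_fun setT (EFin \o F) by exact/measurable_EFinP.
rewrite (_ : (fun _ => _) = fun x => (fubini_F m2 ((EFin \o F)^\+)%E x -
    fubini_F m2 ((EFin \o F)^\-)%E x)%E).
  apply: emeasurable_funB; apply: measurable_fun_fubini_tonelli_F => //.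
    exact: measurable_funepos.
  exact: measurable_funeneg.
apply/funext => x; rewrite integralE /fubini_F; congr (_ - _)%E.
  by apply: eq_integral => y _; rewrite !funeposE.
by apply: eq_integral => y _; rewrite !funenegE.
Qed.

(** Domination by a product of two integrable functions gives integrability on the product space;
    all later exchanges of integrals of signed functions have this form. *)
Lemma Rintegral_fubini (F : T1 * T2 -> R) (phi : T1 -> R) (psi : T2 -> R) :
  measurable_fun setT F -> (forall x y, `|F (x, y)| <= phi x * psi y) ->
  (forall x, 0 <= phi x) -> (forall y, 0 <= psi y) ->
  itg m1 phi -> itg m2 psi ->
  \int[m1]_x (\int[m2]_y F (x, y)) = \int[m2]_y (\int[m1]_x F (x, y)).
Proof.
move=> mF Fb phi0 psi0 iphi ipsi.
have i2 x : itg m2 (fun y => F (x, y)).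
  apply: (@itg_le _ _ _ _ _ (fun y => phi x * psi y)) => //; last exact: itgZ.
  exact: measurableT_comp.
have i1 y : itg m1 (fun x => F (x, y)).
  apply: (@itg_le _ _ _ _ _ (fun x => psi y * phi x)) => //; last exact: itgZ.
    exact: measurableT_comp.
  by move=> x; rewrite mulrC.
have iF : (m1 \x m2)%E.-integrable setT (EFin \o F).
  apply/integrable12ltyP; first exact/measurable_EFinP.
  apply: (@le_lt_trans _ _ (\int[m1]_x ((phi x)%:E * (\int[m2]_y psi y)%:E))%E).
    apply: ge0_le_integral => //.
    - by move=> x _; exact: integral_ge0.
    - apply: (measurable_fun_fubini_tonelli_F (abse \o (EFin \o F))) => [|z]; last by rewrite /= lee_fin.
      by apply: measurableT_comp => //; exact/measurable_EFinP.
    - suff: measurable_fun setT (EFin \o (fun x => phi x * (\int[m2]_y psi y))) by [].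
      apply/measurable_EFinP; apply: measurable_funM => //; exact: itg_measurable iphi.
    - move=> x _; rewrite EFin_Rintegral // -ge0_integralZl //.
      + apply: ge0_le_integral => //.
        * apply: (@measurableT_comp _ _ _ _ _ _ abse) => //.
          by apply/measurable_EFinP; exact: (itg_measurable (i2 x)).
        * suff: measurable_fun setT (EFin \o (fun y => phi x * psi y)) by [].
          by apply/measurable_EFinP; apply: measurable_funM => //; exact: itg_measurable ipsi.
        * by move=> y _; rewrite /= -EFinM lee_fin.
      + by apply/measurable_EFinP; exact: itg_measurable ipsi.
      + by move=> y _; rewrite lee_fin.
      + by rewrite lee_fin.
  rewrite ge0_integralZr //.
  - by rewrite -EFin_Rintegral // -EFinM ltry.
  - by apply/measurable_EFinP; exact: itg_measurable iphi.
  - by move=> x _; rewrite lee_fin.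
  - by rewrite lee_fin; apply: Rintegral_ge0.
change (fine (\int[m1]_x (\int[m2]_y F (x, y))%:E)%E =
        fine (\int[m2]_y (\int[m1]_x F (x, y))%:E)%E).
congr fine; transitivity (\int[m1]_x \int[m2]_y (EFin \o F) (x, y))%E.
  by apply: eq_integral => x _; rewrite EFin_Rintegral.
by rewrite (Fubini iF); apply: eq_integral => y _; rewrite EFin_Rintegral.
Qed.

End RealFubini.

(** * Products of Lorentzians as convergence factors and integrable majorants *)

Section Envelope.
Variable R : realType.
Local Notation mu := (@lebesgue_measure R).

(** The Lorentzian is integrable, comparable with its translates by at most 1, and dominates all its
    derivatives up to constants. These three properties let its products serve both as cutoffs and
    as majorants. *)
Definition lor (t : R) : R := (1 + t ^+ 2)^-1.

Lemma lor_den_gt0 (t : R) : 0 < 1 + t ^+ 2.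
Proof. by have := sqr_ge0 t; lra. Qed.

Lemma lor_gt0 t : 0 < lor t.
Proof. by rewrite invr_gt0 lor_den_gt0. Qed.

Lemma lor_ge0 t : 0 <= lor t.
Proof. exact: ltW (lor_gt0 t). Qed.

Lemma lor_le1 t : lor t <= 1.
Proof. by rewrite invf_le1 ?lor_den_gt0 // lerDl sqr_ge0. Qed.

Lemma lorN t : lor (- t) = lor t.
Proof. by rewrite /lor sqrrN. Qed.

Lemma continuous_lor : continuous lor.
Proof. exact: continuous_oneDsqrV. Qed.

Lemma measurable_lor : measurable_fun setT lor.
Proof. by apply: continuous_measurable_fun; exact: continuous_lor. Qed.

Lemma integral_lor : (\int[mu]_t (lor t)%:E = pi%:E)%E.
Proof.
rewrite ge0_symfun_integralT.
- rewrite -set_itvcy integral0y_oneDsqr -EFinM; congr (_%:E); lra.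
- by move=> t; exact: ltW (lor_gt0 t).
- exact: continuous_lor.
- by move=> t /=; rewrite lorN.
Qed.

Lemma integral_lor_shift c : (\int[mu]_t (lor (t + c))%:E = pi%:E)%E.
Proof.
rewrite (ge0_integral_shift1 (f := fun t => (lor t)%:E)) ?integral_lor //.
  by apply/measurable_EFinP; exact: measurable_lor.
by move=> t; rewrite lee_fin ltW // lor_gt0.
Qed.

Lemma lor_shift (t s : R) : `|s| <= 1 -> lor (t + s) <= 3 * lor t.
Proof.
move=> s1; rewrite /lor -[3]invrK -invfM lef_pV2 ?posrE ?mulr_gt0 ?lor_den_gt0 ?invr_gt0 //.
have : s ^+ 2 <= 1 by rewrite -real_normK ?num_real // expr_le1.
have := sqr_ge0 (t + 2 * s); nra.
Qed.

Lemma lor_scale (e t : R) : 0 < e -> e <= 1 -> lor (e * t) <= e ^- 2 * lor t.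
Proof.
move=> e0 e1; rewrite /lor -invfM lef_pV2 ?posrE ?mulr_gt0 ?exprn_gt0 ?lor_den_gt0 //.
rewrite exprMn mulrDr mulr1 lerD2r expr_le1 // ltW //.
Qed.

Variable n : nat.
Implicit Types x v : 'rV[R]_n.

(** For small [e] this is the convergence factor that tends to 1 as [e] tends to 0; for [e = 1] it
    is the standard majorant in estimates of decay. *)
Definition env (e : R) x : R := \prod_i lor (e * x ord0 i).

Lemma env_gt0 e x : 0 < env e x.
Proof. by apply: prodr_gt0 => i _; exact: lor_gt0. Qed.

Lemma env_le1 e x : env e x <= 1.
Proof.
by apply: prodr_ile1 => i _; rewrite lor_le1 ltW ?lor_gt0.
Qed.

Lemma env0 e : env e 0 = 1.
Proof. by rewrite /env big1 // => i _; rewrite mxE mulr0 /lor expr0n addr0 invr1. Qed.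

Lemma measurable_env e : measurable_fun setT (env e : Tn R n -> R).
Proof.
apply: (measurable_prodc (g := fun _ t => lor (e * t))) => i.
by apply: measurableT_comp; [exact: measurable_lor|exact: measurable_funM].
Qed.

Lemma integral_env1 v :
  (\int[lebn R n]_x (env 1 (x + v))%:E = (pi ^+ n)%:E)%E.
Proof.
under eq_integral do rewrite /env.
transitivity (\int[lebn R n]_x (\prod_i lor (x ord0 i + v ord0 i))%:E)%E.
  by apply: eq_integral => x _; congr _%:E; apply: eq_bigr => i _; rewrite mul1r mxE.
rewrite (integral_prod (g := fun i t => lor (t + v ord0 i)) (c := fun=> pi)).
- by rewrite prodr_const card_ord.
- by move=> i; apply: measurableT_comp; [exact: measurable_lor|exact: measurable_funD].
- by move=> i t; rewrite ltW // lor_gt0.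
- by move=> i; exact: integral_lor_shift.
Qed.

Lemma itg_env1 v : itg (lebn R n) (fun x => env 1 (x + v)).
Proof.
apply: itg_ltey; last by rewrite integral_env1 ltry.
  by apply: (measurableT_comp (measurable_env 1)); exact: measurable_shift.
by move=> x; rewrite ltW // env_gt0.
Qed.

Lemma Rintegral_env1 v : \int[lebn R n]_x env 1 (x + v) = pi ^+ n.
Proof. by rewrite /Rintegral integral_env1. Qed.

Lemma env_scale e x : 0 < e -> e <= 1 -> env e x <= e ^- (2 * n) * env 1 x.
Proof.
move=> e0 e1; rewrite /env exprM -exprVn -[n in _ ^+ n]card_ord -prodr_const -big_split /=.
apply: ler_prod => i _; rewrite ltW ?lor_gt0 //=.
by rewrite mul1r; exact: lor_scale.
Qed.

Lemma itg_env e : 0 < e -> e <= 1 -> itg (lebn R n) (env e).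
Proof.
move=> e0 e1; apply: (@itg_le _ (Tn R n) _ _ _ (fun x => e ^- (2 * n) * env 1 (x + 0))).
- exact: measurable_env.
- by move=> x; rewrite addr0 (gtr0_norm (env_gt0 _ _)); exact: env_scale.
- by apply: itgZ; exact: itg_env1.
Qed.

Lemma env_shift e x (i : 'I_n) (t : R) : 0 < e -> e <= 1 -> `|t| <= 1 ->
  env e (x + t *: ebasis R i) <= 3 * env e x.
Proof.
move=> e0 e1 t1; rewrite /env (bigD1 i) //= [in leRHS](bigD1 i) //= mulrA.
apply: ler_pM; [exact: lor_ge0|by apply: prodr_ge0 => j _; exact: lor_ge0| |].
- rewrite !mxE !eqxx /= mulr1 mulrDr; apply: lor_shift.
  by rewrite normrM (gtr0_norm e0) mulr_ile1 // ltW.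
- apply: ler_prod => j ji; rewrite lor_ge0 /= !mxE (negbTE ji) andbF.
  by rewrite mulr0 addr0.
Qed.

End Envelope.

(** * Directional derivatives reduced to one variable *)

Section DirectionalDerivatives.
Variables (R : realType) (V : normedModType R).
Implicit Types (f : V -> R) (a v : V).

Lemma is_derive_line f a v (t df : R) :
  is_derive (t *: v + a) v f df <->
  is_derive t (1 : R) (fun h : R => f (h *: v + a) : R) df.
Proof.
have E : (fun h : R => h^-1 *: ((f \o shift (t *: v + a)) (h *: v) - f (t *: v + a))) =
  (fun h : R => h^-1 *: (((fun h : R => f (h *: v + a)) \o shift t) (h *: (1 : R))
     - f (t *: v + a))).
  apply/funext => h /=; congr (_ *: (f _ - _)).
  by rewrite addrA -scalerDl [h *: 1]mulr1.
by split=> -[D1 D2]; split; move: D1 D2; rewrite /derivable /derive ?E // -?E.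
Qed.

Lemma is_derive_cvg f a v (df : R) : is_derive a v f df ->
  h^-1 *: (f (h *: v + a) - f a) @[h --> (0 : R)^'] --> df.
Proof. by move=> [D1 <-]; exact: D1. Qed.

Lemma MVT_line f (f' : V -> R) a v (h : R) : 0 < h ->
  (forall x, is_derive x v f (f' x)) ->
  exists2 c : R, 0 < c < h & f (h *: v + a) - f a = f' (c *: v + a) * h.
Proof.
move=> h0 D.
have D1 t : is_derive t (1 : R) (fun h : R => f (h *: v + a) : R) (f' (t *: v + a)).
  by apply/is_derive_line; exact: D.
have cg : {within `[0, h], continuous (fun h : R => f (h *: v + a))}.
  apply: continuous_subspaceT => x; apply: differentiable_continuous.
  by apply/derivable1_diffP; have [] := D1 x.
have [c ch] := @MVT R (fun h : R => f (h *: v + a)) (fun t => f' (t *: v + a)) 0 h h0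
  (fun x _ => D1 x) cg.
rewrite scale0r add0r subr0 => E; exists c => //; by move: ch; rewrite in_itv.
Qed.

End DirectionalDerivatives.

(** * Real oscillatory integrals and integration by parts *)

Section Osc.
Variables (R : realType) (n : nat).
Implicit Types (x z xi : 'rV[R]_n).
Local Notation lb := (lebn R n).

Lemma cvg_harmonic_dnbhs : (fun k : nat => k.+1%:R^-1 : R) @ \oo --> (0 : R)^'.
Proof.
move=> A hA.
have h : \forall k \near \oo, (k.+1%:R^-1 : R) != 0 -> A (k.+1%:R^-1) :=
  @cvg_harmonic R _ hA.
rewrite /nbhs /=; apply: filterS h => k; apply.
by rewrite invr_neq0 // pnatr_eq0.
Qed.

(** The difference quotients of [F] have integral 0 by translation invariance. By the mean value
    theorem and [env_shift] they are dominated by [3 * C * env e], so dominated convergence passes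
    to the derivative. *)
Lemma Rintegral_derive0 (i : 'I_n) (F F' : 'rV[R]_n -> R) (C e : R) :
  0 < e -> e <= 1 ->
  (forall x, is_derive x (ebasis R i) F (F' x)) ->
  measurable_fun setT (F : Tn R n -> R) -> measurable_fun setT (F' : Tn R n -> R) ->
  (forall x, `|F x| <= C * env e x) -> (forall x, `|F' x| <= C * env e x) ->
  \int[lb]_x F' x = 0.
Proof.
move=> e0 e1 D mF mF' Fb F'b; set v := ebasis R i.
have C0 : 0 <= C by have := F'b 0; rewrite env0 mulr1; apply: le_trans.
have iF : itg lb F by apply: (itg_le (T := Tn R n) mF Fb); apply: itgZ; exact: itg_env.
pose h k : R := k.+1%:R^-1.
have h0 k : 0 < h k by rewrite invr_gt0.
have h1 k : h k <= 1 by rewrite invf_le1 // ler1n.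
pose f_ k x := (h k)^-1 * (F (x + h k *: v) - F x).
have iFs k : itg lb (fun x => F (x + h k *: v)).
  apply: (@itg_le _ (Tn R n) _ _ _ (fun x => 3 * C * env e x)).
  - exact: (measurableT_comp mF (@measurable_shift _ _ _)).
  - move=> x; apply: le_trans (Fb _) _; rewrite -mulrA mulrCA ler_wpM2l //.
    by apply: env_shift => //; rewrite gtr0_norm.
  - by apply: itgZ; exact: itg_env.
have mf_ k : measurable_fun setT (f_ k : Tn R n -> R).
  apply: measurable_funM => //; apply: measurable_funB => //.
  exact: (itg_measurable (iFs k)).
have intf_ k : (\int[lb]_x (f_ k x)%:E = 0)%E.
  have iD : itg lb (fun x => F (x + h k *: v) - F x).
    by have := itgD (iFs k) (itgZ (-1) iF); apply: etrans; congr itg; apply/funext => x; rewrite mulN1r.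
  rewrite -EFin_Rintegral; last exact: itgZ.
  rewrite RintegralZl // RintegralB //; last exact: (iFs k).
  rewrite [X in _ * (X - _)](_ : _ = \int[lb]_x F x) ?subrr ?mulr0 //.
  by rewrite /Rintegral (integral_shift (f := EFin \o F)) //; apply/measurable_EFinP.
have bf_ k x : `|f_ k x| <= 3 * C * env e x.
  have [c /andP[c0 ch] E] := MVT_line x (h0 k) D.
  rewrite /f_ (addrC x) E.
  rewrite mulrC mulfK ?gt_eqF // (le_trans (F'b _)) //.
  rewrite -mulrA mulrCA ler_wpM2l // [_ *: _ + _]addrC.
  by apply: env_shift => //; rewrite gtr0_norm // (le_trans (ltW ch)).
have cf_ x : (f_ k x)%:E @[k --> \oo] --> (F' x)%:E.
  apply/cvg_EFin; first by exists 0%N.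
  have := cvg_comp (fun k : nat => k.+1%:R^-1 : R) _ cvg_harmonic_dnbhs (is_derive_cvg (D x)).
  apply: cvg_trans; apply: near_eq_cvg; apply: nearW => k /=.
  by rewrite /f_ /h (addrC x).
have [] := @dominated_convergence _ (Tn R n) R lb setT measurableT
  (fun k x => (f_ k x)%:E) (EFin \o F') (fun x => (3 * C * env e x)%:E).
- by move=> k; exact/measurable_EFinP.
- exact/measurable_EFinP.
- by apply: aeW => x _; exact: cf_.
- by apply: itgZ; exact: itg_env.
- by apply: aeW => x k _ /=; rewrite lee_fin.
move=> _ _ /=; under eq_fun do rewrite intf_.
move=> /cvg_lim; rewrite lim_cst // => /(_ (@ereal_hausdorff _)).
by rewrite /Rintegral => <-.
Qed.

Lemma dotRn_shift z x (i : 'I_n) (h : R) :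
  dotRn z (h *: ebasis R i + x) = h * z ord0 i + dotRn z x.
Proof.
rewrite /dotRn (bigD1 i) //= [in RHS](bigD1 i) //= addrA; congr (_ + _).
  rewrite /Defs.coord !mxE !eqxx /=; ring.
by apply: eq_bigr => j ji; rewrite /Defs.coord !mxE (negbTE ji) andbF mulr0 add0r.
Qed.

Lemma measurable_dotl z : measurable_fun setT (dotRn z : Tn R n -> R).
Proof.
apply: measurable_sum => i; apply: measurable_funM => //.
exact: measurable_coord.
Qed.

Lemma measurable_cos1 : measurable_fun setT (cos : R -> R).
Proof. by apply: continuous_measurable_fun; exact: continuous_cos. Qed.

Lemma measurable_phase th z :
  measurable_fun setT (fun xi : Tn R n => cos (dotRn z xi + th)).
Proof.
apply: (measurableT_comp measurable_cos1); apply: measurable_funD => //.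
exact: measurable_dotl.
Qed.

(** Phase 0 gives the cosine transform and phase -pi/2 the sine transform. Integration by parts only
    shifts the phase by pi/2, so this family of real integrals is closed under all operations
    below. *)
Definition osc (th : R) z (F : 'rV[R]_n -> R) : R :=
  \int[lb]_xi (cos (dotRn z xi + th) * F xi).

Lemma cos_abs_le1 (t : R) : `|cos t| <= 1.
Proof. by rewrite ler_norml cos_geN1 cos_le1. Qed.

Lemma cosM_le (t y : R) : `|cos t * y| <= `|y|.
Proof. by rewrite normrM ler_piMl ?cos_abs_le1. Qed.

Lemma measurable_oscint th z F : measurable_fun setT (F : Tn R n -> R) ->
  measurable_fun setT (fun xi : Tn R n => cos (dotRn z xi + th) * F xi).
Proof. by move=> mF; apply: measurable_funM => //; exact: measurable_phase. Qed.

Lemma itg_osc th z F : itg lb F ->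
  itg lb (fun xi => cos (dotRn z xi + th) * F xi).
Proof.
move=> iF; apply: (@itg_le _ (Tn R n) _ _ _ _ _ _ (itg_norm iF)); last by move=> x; exact: cosM_le.
by apply: measurable_oscint; exact: itg_measurable iF.
Qed.

(** [G'] is the derivative of cosine times [F] in direction [i]; its integral vanishes by
    [Rintegral_derive0]. *)
Lemma osc_derive (i : 'I_n) (F F' : 'rV[R]_n -> R) (C e th : R) z :
  0 < e -> e <= 1 ->
  (forall x, is_derive x (ebasis R i) F (F' x)) ->
  measurable_fun setT (F : Tn R n -> R) -> measurable_fun setT (F' : Tn R n -> R) ->
  (forall x, `|F x| <= C * env e x) -> (forall x, `|F' x| <= C * env e x) ->
  osc th z F' = - z ord0 i * osc (th + pi / 2) z F.
Proof.
move=> e0 e1 D mF mF' Fb F'b; set zi := z ord0 i.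
have C0 : 0 <= C by have := F'b 0; rewrite env0 mulr1; apply: le_trans.
have ie : itg lb (fun x => C * env e x) by apply: itgZ; exact: itg_env.
have iF : itg lb F := itg_le (T := Tn R n) mF Fb ie.
have iF' : itg lb F' := itg_le (T := Tn R n) mF' F'b ie.
pose G x := cos (dotRn z x + th) * F x.
pose G' x := zi * (cos (dotRn z x + (th + pi / 2)) * F x) + cos (dotRn z x + th) * F' x.
have mG : measurable_fun setT (G : Tn R n -> R) by exact: measurable_oscint.
have mG' : measurable_fun setT (G' : Tn R n -> R).
  apply: measurable_funD; last exact: measurable_oscint.
  by apply: measurable_funM => //; exact: measurable_oscint.
have DG x : is_derive x (ebasis R i) G (G' x).
  have Dl : is_derive x (ebasis R i) (fun x => cos (dotRn z x + th)) (- sin (dotRn z x + th) * zi).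
    rewrite -[x in is_derive x](add0r x) -(scale0r (ebasis R i)).
    apply/is_derive_line; under eq_fun do rewrite dotRn_shift.
    rewrite (_ : dotRn z x + th = 0 * zi + dotRn z x + th); last by rewrite mul0r add0r.
    apply: (@is_derive1_comp R cos (fun h => h * zi + dotRn z x + th)).
    by apply: is_derive_eq; rewrite /GRing.scale /=; ring.
  have DM := is_deriveM Dl (D x).
  suff -> : G' x = cos (dotRn z x + th) *: F' x + F x *: (- sin (dotRn z x + th) * zi) by exact: DM.
  rewrite /G' addrA cosDpihalf /GRing.scale /=; ring.
have := @Rintegral_derive0 i G G' ((`|zi| + 1) * C) e e0 e1 DG mG mG' _ _.
have -> : \int[lb]_x G' x = zi * osc (th + pi / 2) z F + osc th z F'.
  rewrite RintegralD //; last exact: itg_osc.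
    by rewrite RintegralZl //; exact: itg_osc.
  by apply: itgZ; exact: itg_osc.
have en x : 0 <= C * env e x by rewrite mulr_ge0 // ltW // env_gt0.
move=> h; rewrite mulNr; apply/eqP; rewrite -addr_eq0 addrC; apply/eqP; apply: h => x.
  apply: le_trans (cosM_le _ _) _; apply: le_trans (Fb x) _.
  by rewrite -mulrA ler_peMl // lerDr.
rewrite -mulrA mulrDl mul1r; apply: le_trans (ler_normD _ _) _; apply: lerD.
  rewrite normrM ler_wpM2l //; apply: le_trans (cosM_le _ _) (Fb x).
exact: le_trans (cosM_le _ _) (F'b x).
Qed.

Lemma osc_derive_iter (i : 'I_n) (m : nat) (F_ : nat -> 'rV[R]_n -> R) (C e th : R) z :
  0 < e -> e <= 1 ->
  (forall k x, (k < m)%N -> is_derive x (ebasis R i) (F_ k) (F_ k.+1 x)) ->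
  (forall k, (k <= m)%N -> measurable_fun setT (F_ k : Tn R n -> R)) ->
  (forall k x, (k <= m)%N -> `|F_ k x| <= C * env e x) ->
  osc th z (F_ m) = (- z ord0 i) ^+ m * osc (th + m%:R * (pi / 2)) z (F_ 0%N).
Proof.
move=> e0 e1; elim: m th => [|m ih] th D mF Fb.
  by rewrite expr0 mul1r mul0r addr0.
rewrite (@osc_derive i (F_ m) (F_ m.+1) C e th z e0 e1 (fun x => D m x (ltnSn m))
  (mF m (leqnSn m)) (mF m.+1 (leqnn _)) (fun x => Fb m x (leqnSn m))
  (fun x => Fb m.+1 x (leqnn _))).
rewrite (ih _ (fun k x km => D k x (leqW km)) (fun k km => mF k (leqW km))
  (fun k x km => Fb k x (leqW km))).
rewrite mulrA -exprS; congr (_ * osc _ z _).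
by rewrite -[in RHS]natr1; ring.
Qed.

Lemma cosD_natpi (x : R) (k : nat) : cos (x + k%:R * pi) = (-1) ^+ k * cos x.
Proof.
elim: k x => [|k ih] x; first by rewrite mul0r addr0 expr0 mul1r.
by rewrite -natr1 mulrDl mul1r addrA cosDpi ih exprS mulN1r mulNr.
Qed.

(** The gain from 2n integrations by parts in each coordinate. Its inverse decays like |z|^(-2n),
    against a growth |z|^n of volumes. *)
Definition hw z : R := 1 + \sum_(i < n) z ord0 i ^+ (2 * n).

Lemma hw_ge1 z : 1 <= hw z.
Proof.
rewrite /hw lerDl; apply: sumr_ge0 => i _.
by rewrite exprM exprn_ge0 // sqr_ge0.
Qed.

Lemma hw_gt0 z : 0 < hw z.
Proof. exact: lt_le_trans (hw_ge1 z). Qed.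

(** If m is the largest z_i^2, then the product of the 1 + z_i^2 is at most (1+m)^n <= 2^n (1 + m^n)
    <= 2^n [hw z]. *)
Lemma hwV_le_env z : (hw z)^-1 <= 2 ^+ n * env 1 z.
Proof.
rewrite /env /lor (eq_bigr (fun i => (1 + (z ord0 i) ^+ 2)^-1)); last by move=> i _; rewrite mul1r.
rewrite prodfV -[2 ^+ n]invrK -invfM lef_pV2 ?posrE ?hw_gt0 //; last first.
  by rewrite mulr_gt0 ?invr_gt0 ?exprn_gt0 // prodr_gt0 // => i _; exact: lor_den_gt0.
rewrite mulrC ler_pdivrMr ?exprn_gt0 //.
have [n0|n0] := posnP n.
  rewrite big1 => [|i _]; last by have := ltn_ord i; rewrite {2}n0.
  by rewrite n0 expr0 mulr1; exact: hw_ge1.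
pose i0 := Ordinal n0.
have [j _ jmax] := @arg_maxP _ _ _ i0 predT (fun i => (z ord0 i) ^+ 2) isT.
set m := (z ord0 j) ^+ 2 in jmax.
have m0 : 0 <= m by exact: sqr_ge0.
apply: (@le_trans _ _ ((1 + m) ^+ n)).
  rewrite -[n in leRHS]card_ord -prodr_const; apply: ler_prod => i _.
  by rewrite ltW ?lor_den_gt0 //= lerD2l; exact: jmax.
have hm : 1 + m ^+ n <= hw z.
  rewrite /hw lerD2l (bigD1 j) //= /Defs.coord -exprM lerDl sumr_ge0 // => i _.
  by rewrite exprM exprn_ge0 // sqr_ge0.
apply: le_trans (_ : 2 ^+ n * (1 + m ^+ n) <= _); last first.
  by rewrite [leRHS]mulrC ler_wpM2l // exprn_ge0.
have [m1|m1] := leP m 1.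
  apply: (@le_trans _ _ (2 ^+ n * 1)).
    rewrite mulr1 lerXn2r ?nnegrE //; lra.
  by rewrite ler_wpM2l ?exprn_ge0 // lerDl exprn_ge0.
apply: (@le_trans _ _ (2 ^+ n * m ^+ n)).
  rewrite -exprMn lerXn2r ?nnegrE //; lra.
by rewrite ler_wpM2l ?exprn_ge0 // lerDr.
Qed.

(** The differential operator 1 + (-1)^n sum of d_i^(2n), whose Fourier multiplier is [hw]; [F_ i k]
    stands for the k-th derivative of [F] in direction [i]. *)
Definition Lop (F : 'rV[R]_n -> R) (F_ : 'I_n -> nat -> 'rV[R]_n -> R) xi : R :=
  F xi + (-1) ^+ n * \sum_(i < n) F_ i (2 * n)%N xi.

(** The 2n integrations by parts in direction [i] shift the phase by n pi, so the cosine returns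
    with the sign (-1)^n, which is the sign built into [Lop]. *)
Lemma osc_hw (F : 'rV[R]_n -> R) (F_ : 'I_n -> nat -> 'rV[R]_n -> R) (C e th : R) z :
  0 < e -> e <= 1 -> (forall i, F_ i 0%N = F) ->
  (forall i k x, (k < 2 * n)%N -> is_derive x (ebasis R i) (F_ i k) (F_ i k.+1 x)) ->
  (forall i k, (k <= 2 * n)%N -> measurable_fun setT (F_ i k : Tn R n -> R)) ->
  (forall i k x, (k <= 2 * n)%N -> `|F_ i k x| <= C * env e x) ->
  itg lb F ->
  hw z * osc th z F = osc th z (Lop F F_).
Proof.
move=> e0 e1 F0 D mF Fb iF.
have iF_ i : itg lb (F_ i (2 * n)%N).
  apply: (@itg_le _ (Tn R n) _ _ _ (fun x => C * env e x)); first exact: mF.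
    by move=> x; exact: Fb.
  by apply: itgZ; exact: itg_env.
have E i : osc th z (F_ i (2 * n)%N) = (-1) ^+ n * (z ord0 i ^+ (2 * n) * osc th z F).
  rewrite (@osc_derive_iter i (2 * n) (F_ i) C e th z e0 e1 (D i) (mF i) (Fb i)).
  rewrite F0 exprM sqrrN -exprM [RHS]mulrCA; congr (_ * _).
  rewrite /osc -RintegralZl //; last exact: itg_osc.
  apply: eq_Rintegral => x _; rewrite [RHS]mulrA -cosD_natpi; congr (cos _ * _).
  by rewrite natrM; field.
have -> : osc th z (Lop F F_) = osc th z F + (-1) ^+ n * \sum_(i < n) osc th z (F_ i (2 * n)%N).
  rewrite /osc -Rintegral_sum; last by move=> i; exact: itg_osc.
  rewrite -RintegralZl //; last by apply: itg_sum => i; exact: itg_osc.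
  rewrite -RintegralD //.
  - apply: eq_Rintegral => x _; rewrite /Lop mulrDr; congr (_ + _).
    by rewrite mulrCA mulr_sumr.
  - exact: itg_osc.
  - by apply: itgZ; apply: itg_sum => i; exact: itg_osc.
rewrite (eq_bigr _ (fun i _ => E i)) -mulr_sumr mulrA -expr2 sqrr_sign mul1r.
by rewrite -mulr_suml /hw mulrDl mul1r.
Qed.

Lemma osc_le (F g : 'rV[R]_n -> R) (th : R) z :
  measurable_fun setT (F : Tn R n -> R) -> (forall x, `|F x| <= g x) -> itg lb g ->
  `|osc th z F| <= \int[lb]_x g x.
Proof.
move=> mF Fg ig; apply: Rintegral_norm_le => //; first exact: measurable_oscint.
by move=> x; exact: le_trans (cosM_le _ _) (Fg x).
Qed.

End Osc.

(** * Dyadic subdivision of cubes and local integrals *)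

Section Dyadic.
Variables (R : realType) (n : nat).
Implicit Types (c x : 'rV[R]_n) (l : R).
Local Notation lb := (lebn R n).

Definition child c l (b : {ffun 'I_n -> bool}) : 'rV[R]_n :=
  \row_i (c ord0 i + (b i)%:R * (l / 2)).

(** Recursion on generations replaces an explicit list of the 2^(kn) cells; additive functions of a
    cube are unchanged by it ([dsum_additive]). *)
Fixpoint dsum (k : nat) (Phi : 'rV[R]_n -> R -> R) c l : R :=
  if k is k'.+1 then \sum_b dsum k' Phi (child c l b) (l / 2) else Phi c l.

Lemma child_sub c l b : 0 < l -> hcube (child c l b) (l / 2) `<=` hcube c l.
Proof.
move=> l0 x xb i; have := xb i; rewrite mxE => /andP[].
by case: (b i); rewrite /= ?mul1r ?mul0r => *; apply/andP; split; lra.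
Qed.

Lemma half_gt0 l : 0 < l -> 0 < l / 2.
Proof. by move=> l0; lra. Qed.

Lemma dsum_le k Phi Psi c l : 0 < l ->
  (forall c', hcube c' (l / 2 ^+ k) `<=` hcube c l ->
     Phi c' (l / 2 ^+ k) <= Psi c' (l / 2 ^+ k)) ->
  dsum k Phi c l <= dsum k Psi c l.
Proof.
elim: k c l => [|k ih] c l l0 h /=.
  by have := h c; rewrite expr0 divr1; apply.
apply: ler_sum => b _; apply: ih => [|c' c's]; first exact: half_gt0.
have E : l / 2 / 2 ^+ k = l / 2 ^+ k.+1 by rewrite exprS invfM mulrA.
rewrite E; apply: h; rewrite -E; apply: subset_trans c's _; exact: child_sub.
Qed.

Lemma dsum_additive k Phi c l : 0 < l ->
  (forall c l, 0 < l -> Phi c l = \sum_b Phi (child c l b) (l / 2)) ->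
  dsum k Phi c l = Phi c l.
Proof.
move=> + h; elim: k c l => [//|k ih] c l l0 /=.
by rewrite (h c l l0); apply: eq_bigr => b _; rewrite ih ?half_gt0.
Qed.

Lemma dsumD k Phi Psi c l :
  dsum k (fun c l => Phi c l + Psi c l) c l = dsum k Phi c l + dsum k Psi c l.
Proof.
elim: k c l => [//|k ih] c l /=.
by rewrite -big_split; apply: eq_bigr => b _; rewrite ih.
Qed.

Lemma dsumZ k a Phi c l :
  dsum k (fun c l => a * Phi c l) c l = a * dsum k Phi c l.
Proof.
elim: k c l => [//|k ih] c l /=.
by rewrite mulr_sumr; apply: eq_bigr => b _; rewrite ih.
Qed.

Lemma vol_additive l : l ^+ n = \sum_(b : {ffun 'I_n -> bool}) (l / 2) ^+ n.
Proof.
rewrite sumr_const card_ffun card_bool card_ord -[RHS]mulr_natl natrX expr_div_n.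
by rewrite mulrC divfK // expf_neq0.
Qed.

Definition lintg (g : 'rV[R]_n -> R) :=
  forall c l, 0 < l -> lb.-integrable (hcube c l) (EFin \o g).

Definition cI (g : 'rV[R]_n -> R) c l : R := \int[lb]_(x in hcube c l) g x.

Lemma restrict_children (g : 'rV[R]_n -> R) c l x : 0 < l ->
  (g \_ (hcube c l)) x = \sum_b (g \_ (hcube (child c l b) (l / 2))) x.
Proof.
(* [bx] selects, coordinate by coordinate, the half in which [x] lies, hence the only child that can
   contain [x]. *)
move=> l0; pose bx : {ffun 'I_n -> bool} := [ffun i => c ord0 i + l / 2 <= x ord0 i].
have [xQ|xQ] := pselect (hcube c l x); last first.
  rewrite patchE memNset // big1 // => b _; rewrite patchE memNset //.
  by move=> /(child_sub l0).
rewrite patchE mem_set // (bigD1 bx) //= patchE mem_set ?big1 ?addr0 //.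
  move=> b bbx; rewrite patchE memNset // => xb; move/eqP: bbx; apply.
  apply/ffunP => i; rewrite ffunE; have := xb i; rewrite mxE => /andP[h1 h2].
  case: (b i) h1 h2; rewrite /= ?mul1r ?mul0r ?addr0 => h1 h2.
    by apply/esym; exact: h1.
  by apply/esym/negbTE; rewrite -ltNge; exact: h2.
move=> i; rewrite mxE ffunE; have /andP[h1 h2] := xQ i.
by have [h|h] := leP (c ord0 i + l / 2) (x ord0 i); rewrite /= ?mul1r ?mul0r; apply/andP; split; lra.
Qed.

Lemma cI_additive g c l : lintg g -> 0 < l ->
  cI g c l = \sum_b cI g (child c l b) (l / 2).
Proof.
move=> ig l0; rewrite /cI Rintegral_mkcond.
under eq_Rintegral do rewrite restrict_children //.
rewrite Rintegral_sum => [|b].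
  by apply: eq_bigr => b _; rewrite -Rintegral_mkcond.
have := ig (child c l b) (l / 2) (half_gt0 l0).
rewrite (integrable_mkcond _ (measurable_hcube _ _)) /itg.
by apply: etrans; congr integrable; apply/funext => x; rewrite /= !patchE; case: ifP.
Qed.

Lemma cI_le g h c l : lintg g -> lintg h -> 0 < l ->
  (forall x, hcube c l x -> g x <= h x) -> cI g c l <= cI h c l.
Proof.
move=> ig ih l0 gh; apply: le_Rintegral => //.
- exact: measurable_hcube.
- exact: ig.
- exact: ih.
Qed.

Lemma lintgD g h : lintg g -> lintg h -> lintg (fun x => g x + h x).
Proof.
move=> ig ih c l l0; have := integrableD (measurable_hcube c l) (ig c l l0) (ih c l l0).
by [].
Qed.

Lemma lintgZ k g : lintg g -> lintg (fun x => k * g x).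
Proof.
move=> ig c l l0; exact: (integrableZl (measurable_hcube c l) k (ig c l l0)).
Qed.

Lemma cIZ k g c l : lintg g -> 0 < l -> cI (fun x => k * g x) c l = k * cI g c l.
Proof.
by move=> ig l0; rewrite /cI RintegralZl //; [exact: measurable_hcube|exact: ig].
Qed.

Lemma cID g h c l : lintg g -> lintg h -> 0 < l ->
  cI (fun x => g x + h x) c l = cI g c l + cI h c l.
Proof.
by move=> ig ih l0; rewrite /cI RintegralD //; [exact: measurable_hcube|exact: ig|exact: ih].
Qed.

Lemma cI_ge0 g c l : (forall x, 0 <= g x) -> 0 <= cI g c l.
Proof. by move=> g0; apply: Rintegral_ge0. Qed.

Lemma lintg_cst k : lintg (fun=> k).
Proof.
move=> c l l0; apply/integrableP; split; first exact: measurable_cst.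
rewrite /= integral_cst; last exact: measurable_hcube.
by rewrite [X in (_ * X)%E](_ : _ = (l ^+ n)%:E) -?EFinM ?ltry //; exact: lebn_hcube.
Qed.

Lemma cI_cst k c l : 0 < l -> cI (fun=> k) c l = k * l ^+ n.
Proof.
move=> l0; rewrite /cI /Rintegral integral_cst; last exact: measurable_hcube.
by rewrite [X in (_ * X)%E](_ : _ = (l ^+ n)%:E) //; exact: lebn_hcube.
Qed.

Lemma lintg_le g h : measurable_fun setT (g : Tn R n -> R) ->
  (forall x, `|g x| <= h x) -> lintg h -> lintg g.
Proof.
move=> mg gh ih c l l0; apply: le_integrable (ih c l l0); first exact: measurable_hcube.
  by apply/measurable_EFinP; apply: measurable_funS mg => //; exact: measurable_hcube.
by move=> x _ /=; rewrite lee_fin (le_trans (gh x)) // ler_norm.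
Qed.

Lemma lintg_bounded g k : measurable_fun setT (g : Tn R n -> R) ->
  (forall x, `|g x| <= k) -> lintg g.
Proof. by move=> mg gk; apply: lintg_le mg gk _; exact: lintg_cst. Qed.

End Dyadic.

(** * Scalar inequalities behind the Bellman function *)

Section PowR.
Variable R : realType.

(** With u = e ln t, this comes from exp(v) >= 1 + v at v = u/e - u and at v = -u. *)
Lemma powR_bernoulli (t e : R) : 1 <= t -> 0 < e -> e <= 1 ->
  t `^ e <= 1 + e * (t - 1).
Proof.
move=> t1 e0 e1.
have t0 : 0 < t by lra.
rewrite /powR gt_eqF //; set u := e * ln t.
have -> : t = expR (u / e) by rewrite /u mulrAC divff ?gt_eqF // mul1r lnK // posrE.
have E : expR (u / e) = expR u * expR (u / e - u) by rewrite -expRD; congr expR; ring.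
have h1 := expR_ge1Dx (u / e - u).
have h2 := expR_ge1Dx (- u).
have h3 : expR u * expR (- u) = 1 by rewrite -expRD subrr expR0.
have p0 := expR_gt0 u.
have h4 : e * (expR u * (1 + (u / e - u))) <= e * expR (u / e).
  by rewrite E ler_wpM2l ?(ltW e0) // ler_wpM2l ?(ltW p0).
have h5 : e * (expR u * (1 + (u / e - u))) = e * expR u + expR u * u - e * (expR u * u).
  by field; rewrite gt_eqF.
have h6 : expR u * (1 - u) <= 1 by rewrite -h3 ler_wpM2l ?(ltW p0) //; lra.
nra.
Qed.

(** The derivative of 2 x y^e - y^(1+e) in y is y^(e-1) (2 e x - (1+e) y), which is not positive
    once 2 e x <= y; the condition [x <= D * y] with 2 D e = 1 ensures this from [y] on. The proof
    writes s = t y and uses Bernoulli in place of the derivative. *)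
Lemma bellman_antitone (x y s e D : R) : 0 <= y -> y <= s -> x <= D * y ->
  0 < e -> e <= 1 -> 2 * D * e = 1 ->
  2 * x * s `^ e - s * s `^ e <= 2 * x * y `^ e - y * y `^ e.
Proof.
move=> y0 ys xDy e0 e1 De.
move: y0; rewrite le_eqVlt => /orP[/eqP y0|y0].
  subst y; rewrite mulr0 in xDy; rewrite powR0 ?gt_eqF // !mulr0 subr0.
  have := powR_ge0 s e; nra.
set t := s / y; have t1 : 1 <= t by rewrite ler_pdivlMr // mul1r.
have st : s = t * y by rewrite divfK ?gt_eqF.
have h1 := powR_bernoulli t1 e0 e1.
have h2 : 1 <= t `^ e by rewrite -(powRr0 t) ler_powR // ltW.
rewrite {1 2}st powRM ?(ltW y0) ?(le_trans ler01 t1) //.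
have q0 := powR_ge0 y e.
suff : 2 * x * (t `^ e - 1) <= y * (t * t `^ e - 1).
  move=> h; rewrite st powRM ?(ltW y0) ?(le_trans ler01 t1) //.
  have := ler_wpM2l q0 h; lra.
apply: (@le_trans _ _ (2 * (D * y) * (e * (t - 1)))).
  have h3 : 2 * x * (t `^ e - 1) <= 2 * (D * y) * (t `^ e - 1).
    by apply: ler_wpM2r; lra.
  have D0 : 0 < D by rewrite -(pmulr_lgt0 _ e0); lra.
  apply: le_trans h3 _; apply: ler_wpM2l; last lra.
  by rewrite !mulr_ge0 ?(ltW D0) ?(ltW y0).
have -> : 2 * (D * y) * (e * (t - 1)) = (2 * D * e) * (y * (t - 1)) by ring.
rewrite De mul1r; apply: ler_wpM2l; first exact: ltW.
nra.
Qed.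

End PowR.

(** * Reverse Hoelder inequality for A_1 weights and its use on a cell *)

Section ReverseHolder.
Variables (R : realType) (n : nat).
Implicit Types (c x : 'rV[R]_n) (l : R).
Local Notation lb := (lebn R n).
Variables (w : 'rV[R]_n -> R) (A : R).
Hypothesis w0 : forall x, 0 <= w x.
Hypothesis iw : lintg w.
Hypothesis mw : measurable_fun setT (w : Tn R n -> R).
Hypothesis A1 : 1 <= A.

Definition avg c l : R := cI w c l / l ^+ n.

Hypothesis A1w : forall c l c' l', 0 < l -> 0 < l' -> hcube c' l' `<=` hcube c l ->
  avg c l <= A * avg c' l'.

(** Small enough for [bellman_antitone] with D = 2^n A: a child has average at most 2^n times that
    of its parent, which is at most A times the parent's [low]. *)
Let e : R := (2 * (2 ^+ n * A))^-1.

Lemma A1_gt0 : 0 < A.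
Proof. by apply: lt_le_trans A1; exact: ltr01. Qed.

Lemma rh_exp_gt0 : 0 < e.
Proof.
have A0 := A1_gt0.
by rewrite invr_gt0 !mulr_gt0 ?exprn_gt0.
Qed.

Lemma rh_exp_le1 : e <= 1.
Proof.
rewrite invf_le1; last by rewrite -invr_gt0 rh_exp_gt0.
have h : 1 <= 2 ^+ n :> R by apply: exprn_ege1; lra.
have A1' := A1; nra.
Qed.

Lemma avg_ge0 c l : 0 < l -> 0 <= avg c l.
Proof. by move=> l0; rewrite divr_ge0 ?exprn_ge0 ?(ltW l0) // cI_ge0. Qed.

(** Plays the part of the essential infimum of [w] on the cube: it increases when the cube shrinks,
    and the A_1 condition makes it comparable with the average. *)
Definition low c l : R := inf [set v | exists c' l', 0 < l' /\
  hcube c' l' `<=` hcube c l /\ v = avg c' l'].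

Lemma low_has_inf c l : 0 < l -> has_inf [set v | exists c' l', 0 < l' /\
  hcube c' l' `<=` hcube c l /\ v = avg c' l'].
Proof.
move=> l0; split; first by exists (avg c l), c, l; split=> //; split.
by exists 0 => _ [c' [l' [l'0 [_ ->]]]]; exact: avg_ge0.
Qed.

Lemma low_ge0 c l : 0 < l -> 0 <= low c l.
Proof.
move=> l0; apply: lb_le_inf; first by have [] := low_has_inf c l0.
by move=> _ [c' [l' [l'0 [_ ->]]]]; exact: avg_ge0.
Qed.

Lemma low_le_avg c l : 0 < l -> low c l <= avg c l.
Proof.
by move=> l0; apply: ge_inf; [have [] := low_has_inf c l0|exists c, l; split=> //; split].
Qed.

Lemma low_antitone c l c' l' : 0 < l -> 0 < l' -> hcube c' l' `<=` hcube c l ->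
  low c l <= low c' l'.
Proof.
move=> l0 l'0 s; apply: lb_le_inf; first by have [] := low_has_inf c' l'0.
move=> _ [c2 [l2 [l20 [s2 ->]]]]; apply: ge_inf; first by have [] := low_has_inf c l0.
by exists c2, l2; split=> //; split => //; exact: subset_trans s2 s.
Qed.

Lemma avg_le_low c l : 0 < l -> avg c l <= A * low c l.
Proof.
move=> l0; have A0 := A1_gt0.
rewrite -ler_pdivrMl //; apply: lb_le_inf; first by have [] := low_has_inf c l0.
move=> _ [c' [l' [l'0 [s ->]]]]; rewrite ler_pdivrMl //; exact: A1w.
Qed.

Lemma avg_children c l : 0 < l ->
  \sum_b avg (child c l b) (l / 2) * (l / 2) ^+ n = avg c l * l ^+ n.
Proof.
move=> l0; rewrite /avg divfK ?expf_neq0 ?gt_eqF // (cI_additive _ iw l0).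
by apply: eq_bigr => b _; rewrite divfK // expf_neq0 // gt_eqF // half_gt0.
Qed.

Lemma avg_child_le c l b : 0 < l -> avg (child c l b) (l / 2) <= 2 ^+ n * avg c l.
Proof.
move=> l0; have h := avg_children c l0; have l20 := half_gt0 l0.
rewrite (bigD1 b) //= in h.
have h2 : avg (child c l b) (l / 2) * (l / 2) ^+ n <= avg c l * l ^+ n.
  rewrite -h lerDl sumr_ge0 // => b' _.
  by rewrite mulr_ge0 ?avg_ge0 // exprn_ge0 // ltW.
rewrite -(ler_pM2r (exprn_gt0 n l20)) (le_trans h2) //.
rewrite [leRHS](_ : _ = avg c l * (2 * (l / 2)) ^+ n).
  by have -> : 2 * (l / 2) = l by field.
by move: (l / 2) => t; rewrite exprMn; ring.
Qed.

(* Bellman function [B(x, y) = 2 x y^e - y^(1+e)], linear in the average [x]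
   and antitone in the lower bound [y] of the averages over subcubes. *)
Lemma reverse_holder_bellman k c l : 0 < l ->
  dsum k (fun c l => l ^+ n * (avg c l * avg c l `^ e)) c l <=
  A `^ e * (l ^+ n * (2 * avg c l * low c l `^ e - low c l * low c l `^ e)).
Proof.
elim: k c l => [|k ih] c l l0 /=.
  rewrite [leRHS]mulrCA ler_wpM2l ?exprn_ge0 ?(ltW l0) //.
  have y0 := low_ge0 c l0; have yx := low_le_avg c l0; have xA := avg_le_low c l0.
  have A0 := A1_gt0.
  have q0 := powR_ge0 (low c l) e.
  apply: (@le_trans _ _ (A `^ e * (avg c l * low c l `^ e))); last first.
    by rewrite ler_wpM2l ?powR_ge0 //; nra.
  rewrite [leRHS]mulrCA ler_wpM2l ?avg_ge0 // -powRM ?low_ge0 ?(ltW A0) //.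
  by rewrite ge0_ler_powR ?nnegrE ?(ltW rh_exp_gt0) ?avg_ge0 // mulr_ge0 //; lra.
have l20 := half_gt0 l0.
(* In every child [low] is lowered to the value of the parent. The Bellman function is then affine
   in the average, and averages and volumes of the children add up to the parent. *)
apply: (@le_trans _ _ (\sum_b A `^ e * ((l / 2) ^+ n *
   (2 * avg (child c l b) (l / 2) * low c l `^ e - low c l * low c l `^ e)))).
  apply: ler_sum => b _; apply: le_trans (ih _ _ l20) _.
  rewrite ler_wpM2l ?powR_ge0 // ler_wpM2l ?exprn_ge0 ?(ltW l20) //.
  apply: (@bellman_antitone _ _ _ _ _ (2 ^+ n * A)).
  - exact: low_ge0.
  - by apply: low_antitone => //; exact: child_sub.
  - apply: le_trans (avg_child_le c b l0) _; rewrite -mulrA ler_wpM2l ?exprn_ge0 //.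
    exact: avg_le_low.
  - exact: rh_exp_gt0.
  - exact: rh_exp_le1.
  - by rewrite divff // gt_eqF // -invr_gt0 rh_exp_gt0.
rewrite -mulr_sumr ler_wpM2l ?powR_ge0 // le_eqVlt; apply/orP; left; apply/eqP.
rewrite (eq_bigr (fun b => (2 * low c l `^ e) * (avg (child c l b) (l / 2) * (l / 2) ^+ n)
   - (low c l * low c l `^ e) * (l / 2) ^+ n)); last by move=> b _; ring.
rewrite big_split /= sumrN -!mulr_sumr avg_children // -vol_additive.
by rewrite mulrBr; ring.
Qed.

(** The left side is the integral of the (1+e)-th power of the dyadic averages of [w] at generation
    k. The bound does not depend on k; it follows from the Bellman estimate because [low] is at most
    the average. *)
Lemma reverse_holder k c l : 0 < l ->
  dsum k (fun c l => l ^+ n * (avg c l * avg c l `^ e)) c l <=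
  2 * A `^ e * (l ^+ n * (avg c l * avg c l `^ e)).
Proof.
move=> l0; apply: le_trans (reverse_holder_bellman k c l0) _.
have y0 := low_ge0 c l0; have yx := low_le_avg c l0.
have h1 : low c l `^ e <= avg c l `^ e.
  by rewrite ge0_ler_powR ?nnegrE ?(ltW rh_exp_gt0) ?avg_ge0.
have q0 := powR_ge0 (low c l) e; have a0 := avg_ge0 c l0.
rewrite [leRHS](_ : _ = A `^ e * (l ^+ n * (2 * (avg c l * avg c l `^ e)))); last by ring.
rewrite ler_wpM2l ?powR_ge0 // ler_wpM2l ?exprn_ge0 ?(ltW l0) //.
apply: (@le_trans _ _ (2 * avg c l * low c l `^ e)); first nra.
by rewrite -mulrA ler_wpM2l // ler_wpM2l.
Qed.

(** A threshold at T times the average X of [w]. The cube is cut into cells on which [F] is almost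
    constant. Where the average of [w] is at most T X, the weight is replaced by T X and [F] by s +
    F^2/s. On the other cells [F] is replaced by [C1], and the total weight of these cells is
    controlled by reverse Hoelder. Refining the cells removes the oscillation of [F]. *)
Lemma cell_bound (F : 'rV[R]_n -> R) (C1 Lam s T : R) c l :
  measurable_fun setT (F : Tn R n -> R) ->
  (forall x, 0 <= F x) -> (forall x, F x <= C1) ->
  0 <= Lam -> (forall c' l' x, 0 < l' -> hcube c' l' x -> `|F x - F c'| <= Lam * l') ->
  0 < l -> 0 < s -> 0 < T ->
  cI (fun x => F x * w x) c l <=
  cI w c l * (T * (s + s^-1 * (cI (fun x => F x ^+ 2) c l / l ^+ n)) +
              2 * C1 * (A `^ e / T `^ e)).
Proof.
move=> mF F0 FC Lam0 FL l0 s0 T0.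
have C10 : 0 <= C1 by apply: le_trans (F0 0) (FC 0).
have iFw : lintg (fun x => F x * w x).
  apply: (@lintg_le _ _ _ (fun x => C1 * w x)); last exact: lintgZ.
    exact: measurable_funM.
  by move=> x; rewrite ger0_norm ?mulr_ge0 // ler_wpM2r.
have iF2 : lintg (fun x => F x ^+ 2).
  apply: (@lintg_bounded _ _ _ (C1 ^+ 2)); first exact: measurable_funX.
  by move=> x; rewrite ger0_norm ?exprn_ge0 // lerXn2r ?nnegrE.
set X := avg c l.
have Xw : X * l ^+ n = cI w c l by rewrite /X /avg divfK // gt_eqF // exprn_gt0.
set I := cI (fun x => F x * w x) c l; set J := cI (fun x => F x ^+ 2) c l.
have J0 : 0 <= J by apply: cI_ge0 => x; exact: sqr_ge0.
have X0 : 0 <= X by exact: avg_ge0.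
have W0 : 0 <= cI w c l by exact: cI_ge0.
have ln0 : 0 < l ^+ n by exact: exprn_gt0.
have [XE|XN] := eqVneq X 0.
  have wE : cI w c l = 0 by rewrite -Xw XE mul0r.
  rewrite wE mul0r; apply: (@le_trans _ _ (cI (fun x => C1 * w x) c l)).
    by apply: cI_le => //; [exact: lintgZ|move=> x _; rewrite ler_wpM2r].
  by rewrite cIZ // wE mulr0.
have {XN}X1 : 0 < X by rewrite lt_neqAle eq_sym XN.
(* The coefficient of [eta] in [step]. *)
pose K := cI w c l + T * X / s * (2 * C1 * l ^+ n).
have K0 : 0 <= K by rewrite addr_ge0 // !mulr_ge0 ?invr_ge0 ?(ltW s0) ?(ltW T0) ?(ltW ln0).
have step k : let eta := Lam * (l / 2 ^+ k) in
  I <= eta * cI w c l + T * X * s * l ^+ n + T * X / s * (J + 2 * C1 * eta * l ^+ n)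
    + C1 / (T * X) `^ e * (2 * A `^ e * (l ^+ n * (X * X `^ e))).
  move=> eta; have lk0 : 0 < l / 2 ^+ k by rewrite divr_gt0 // exprn_gt0.
  have eta0 : 0 <= eta by rewrite mulr_ge0 // ltW.
  have TX0 : 0 < T * X by rewrite mulr_gt0.
  have q0 : 0 < (T * X) `^ e by rewrite powR_gt0.
  pose Phi c l := eta * cI w c l + T * X * s * l ^+ n
     + T * X / s * (cI (fun x => F x ^+ 2) c l + 2 * C1 * eta * l ^+ n)
     + C1 / (T * X) `^ e * (l ^+ n * (avg c l * avg c l `^ e)).
  have -> : I = dsum k (fun c l => cI (fun x => F x * w x) c l) c l.
    by rewrite dsum_additive // => c' l' l'0; exact: cI_additive.
  apply: (@le_trans _ _ (dsum k Phi c l)).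
    apply: dsum_le => // c' s'; pose l' := l / 2 ^+ k; rewrite -/l' in s' *.
    have FL' x : hcube c' l' x -> `|F x - F c'| <= eta by exact: FL.
    have l'n : 0 < l' ^+ n by rewrite exprn_gt0.
    have wE : cI w c' l' = avg c' l' * l' ^+ n by rewrite divfK // gt_eqF.
    have a0 : 0 <= avg c' l' by exact: avg_ge0.
    have h1 : cI (fun x => F x * w x) c' l' <= (F c' + eta) * cI w c' l'.
      rewrite -cIZ //; apply: cI_le => //; first exact: lintgZ.
      move=> x xQ; apply: ler_wpM2r => //.
      have := FL' x xQ; rewrite ler_norml => /andP[_ ?]; lra.
    have h2 : l' ^+ n * F c' ^+ 2 <= cI (fun x => F x ^+ 2) c' l' + 2 * C1 * eta * l' ^+ n.
      rewrite -(cI_cst (2 * C1 * eta) c') // -cID //; last exact: lintg_cst.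
      rewrite [leLHS]mulrC -(cI_cst (F c' ^+ 2) c') //; apply: cI_le => //.
      - exact: lintg_cst.
      - by apply: lintgD => //; exact: lintg_cst.
      move=> x xQ; have := FL' x xQ; rewrite ler_norml => /andP[g1 g2].
      have := F0 x; have := F0 c'; have := FC x; have := FC c'; nra.
    apply: le_trans h1 _; rewrite mulrDl addrC /Phi -!addrA lerD2l !addrA.
    have r0 : 0 <= C1 / (T * X) `^ e * (l' ^+ n * (avg c' l' * avg c' l' `^ e)).
      apply: mulr_ge0; first by rewrite divr_ge0 // ltW.
      by apply: mulr_ge0; [exact: ltW|apply: mulr_ge0 => //; exact: powR_ge0].
    (* Cells of moderate weight: F <= s + F^2/s follows from the square of F - s. *)
    have [xT|xT] := leP (avg c' l') (T * X).
      apply: le_trans (_ : T * X * s * l' ^+ n + T * X / s * (l' ^+ n * F c' ^+ 2) <= _); last first.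
        apply: (@le_trans _ _ (T * X * s * l' ^+ n + T * X / s * (cI (fun x => F x ^+ 2) c' l' + 2 * C1 * eta * l' ^+ n))).
          by rewrite lerD2l ler_wpM2l // divr_ge0 ?(ltW TX0) ?(ltW s0).
        by rewrite lerDl.
      apply: (@le_trans _ _ (T * X * (F c' * l' ^+ n))).
        by rewrite wE mulrCA ler_wpM2r // mulr_ge0 // ltW.
      have -> : T * X * s * l' ^+ n + T * X / s * (l' ^+ n * F c' ^+ 2) =
         T * X * (l' ^+ n * (s + F c' ^+ 2 / s)) by ring.
      rewrite ler_wpM2l ?(ltW TX0) // mulrC ler_wpM2l ?(ltW l'n) //.
      rewrite -(ler_pM2r s0) mulrDl divfK ?gt_eqF //.
      have := sqr_ge0 (F c' - s); have := F0 c'; nra.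
    (* Heavy cells: the factor (avg/(T X))^e is at least 1 and turns the weight into a term of the
       reverse Hoelder sum. *)
    have x0 : 0 < avg c' l' by exact: lt_trans xT.
    apply: le_trans (_ : C1 / (T * X) `^ e * (l' ^+ n * (avg c' l' * avg c' l' `^ e)) <= _); last first.
      rewrite lerDr addr_ge0 //; first by rewrite mulr_ge0 ?(ltW l'n) // mulr_ge0 ?(ltW s0) // ltW.
      apply: mulr_ge0; first by rewrite divr_ge0 ?(ltW TX0) ?(ltW s0).
      rewrite addr_ge0 //; first by apply: cI_ge0 => x; exact: sqr_ge0.
      by rewrite mulr_ge0 ?(ltW l'n) // mulr_ge0 // mulr_ge0.
    have h3 : 1 <= avg c' l' `^ e / (T * X) `^ e.
      rewrite ler_pdivlMr // mul1r ge0_ler_powR ?nnegrE ?(ltW rh_exp_gt0) ?(ltW TX0) //.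
      exact: ltW.
    have -> : C1 / (T * X) `^ e * (l' ^+ n * (avg c' l' * avg c' l' `^ e)) =
       (C1 * cI w c' l') * (avg c' l' `^ e / (T * X) `^ e) by rewrite wE; ring.
    apply: (@le_trans _ _ (C1 * cI w c' l')).
      by apply: ler_wpM2r => //; exact: cI_ge0.
    by rewrite ler_peMr // mulr_ge0 // cI_ge0.
  rewrite /Phi dsumD dsumD dsumD !dsumZ dsumD dsumZ.
  have -> : dsum k (fun c l => cI w c l) c l = cI w c l.
    by rewrite dsum_additive // => c' s' s'0; exact: cI_additive.
  have -> : dsum k (fun c l => l ^+ n) c l = l ^+ n.
    by rewrite dsum_additive // => c' s' s'0; exact: vol_additive.
  have -> : dsum k (fun c l => cI (fun x => F x ^+ 2) c l) c l = J.
    by rewrite dsum_additive // => c' s' s'0; exact: cI_additive.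
  by rewrite lerD2l ler_wpM2l ?divr_ge0 ?(ltW q0) //; exact: reverse_holder.
(* Only [eta] depends on k in [step], and it tends to 0. *)
have lim : I <= T * X * s * l ^+ n + T * X / s * J
    + C1 / (T * X) `^ e * (2 * A `^ e * (l ^+ n * (X * X `^ e))).
  apply/ler_addgt0Pr => eps eps0.
  have [k hk] : exists k : nat, (Lam * l * K) < eps * 2 ^+ k.
    have [k hk] : exists k : nat, Lam * l * K / eps < 2 ^+ k.
      exists (Num.bound (Lam * l * K / eps)).
      apply: lt_le_trans (archi_boundP _) _.
        by rewrite divr_ge0 ?(ltW eps0) // !mulr_ge0 // ltW.
      by rewrite -natrX ler_nat ltnW // ltn_expl.
    by exists k; rewrite -ltr_pdivrMl // mulrC.
  have h := step k; cbv zeta in h; apply: le_trans h _.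
  have h2 : Lam * (l / 2 ^+ k) * K <= eps.
    have -> : Lam * (l / 2 ^+ k) * K = Lam * l * K / 2 ^+ k by ring.
    by rewrite ler_pdivrMr ?exprn_gt0 // ltW.
  rewrite /K in h2; lra.
apply: le_trans lim _; rewrite le_eqVlt; apply/orP; left; apply/eqP.
rewrite -Xw powRM ?(ltW T0) //.
have n1 : T `^ e != 0 by rewrite gt_eqF // powR_gt0.
have n2 : X `^ e != 0 by rewrite gt_eqF // powR_gt0.
by field; rewrite n1 n2 !gt_eqF.
Qed.

End ReverseHolder.

(** * Derivatives of the Lorentzian *)

Section LorDerivatives.
Variable R : realType.

(** Numerators: the k-th derivative of [lor] is [lorq k] over (1 + t^2)^(k+1). *)
Fixpoint lorq (k : nat) : {poly R} :=
  if k is j.+1 then (lorq j)^`() * (1 + 'X^2) - (2 * j.+1%:R) *: ('X * lorq j) else 1.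

Definition lord (k : nat) (t : R) : R := (lorq k).[t] * lor t ^+ k.+1.

Lemma lord0 t : lord 0 t = lor t.
Proof. by rewrite /lord /= hornerC mul1r expr1. Qed.

Lemma lor_den (t : R) : lor t * (1 + t ^+ 2) = 1.
Proof. by rewrite mulVf // gt_eqF // lor_den_gt0. Qed.

Lemma is_derive_lor (t : R) : is_derive t (1 : R) (@lor R) (- 2 * t * lor t ^+ 2).
Proof.
have D : is_derive t (1 : R) (fun t : R => 1 + t ^+ 2) (2 * t).
  apply: is_derive_eq; rewrite /GRing.scale /=; ring.
have DV := is_deriveV (f := fun t : R => 1 + t ^+ 2) (lt0r_neq0 (lor_den_gt0 t)) D.
apply: (is_derive_eq DV); rewrite /lor /GRing.scale /= -exprVn; ring.
Qed.

Lemma is_derive_lord k (t : R) : is_derive t (1 : R) (lord k) (lord k.+1 t).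
Proof.
have D := is_deriveM (is_derive_poly (lorq k) t) (is_deriveX k.+1 (is_derive_lor t)).
have -> : lord k = horner (lorq k) * (@lor R) ^+ k.+1.
  by apply/funext => u; rewrite /lord fctE exprfctE.
apply: (is_derive_eq D); rewrite /lord exprfctE -![_ *: _]/(_ * _) [k.+1.-1]/=.
rewrite (_ : lorq k.+1 = (lorq k)^`() * (1 + 'X^2) - (2 * k.+1%:R) *: ('X * lorq k)) //.
have := lor_den t; move: (lor t) => y E.
rewrite (_ : (_ - _).[t] = (lorq k)^`().[t] * (1 + t ^+ 2) - 2 * k.+1%:R * (t * (lorq k).[t])); last first.
  by rewrite !(hornerE, hornerXn) /=; ring.
have E2 : y ^+ k.+1 = y ^+ k.+2 * (1 + t ^+ 2) by rewrite [in RHS]exprSr -mulrA E mulr1.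
rewrite [in X in _ + X]E2 !exprS; ring.
Qed.

(** The degree of [lorq k] is at most k and |t| <= 1 + t^2, so [lorq k] times [lor ^+ k] is bounded
    by the sum of the absolute values of the coefficients; one factor [lor] is left. *)
Lemma lord_bound k : exists2 C : R, 0 <= C & forall t, `|lord k t| <= C * lor t.
Proof.
have szq : (size (lorq k) <= k.+1)%N.
  elim: k => [|k ih] /=; first by rewrite size_poly1.
  rewrite (leq_trans (size_polyD _ _)) // geq_max size_polyN; apply/andP; split.
    apply: leq_trans (size_polyMleq _ _) _.
    have s1 : (size (1 + 'X^2 : {poly R})%R <= 3)%N.
      by rewrite (leq_trans (size_polyD _ _)) // geq_max size_poly1 size_polyXn.
    have s2 : (size (lorq k)^`() <= k)%N.
      by rewrite (leq_trans (size_poly _ _)) // -subn1 leq_subLR add1n.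
    by rewrite -subn1 leq_subLR add1n (leq_trans (leq_add s2 s1)) // addn3.
  apply: leq_trans (size_scale_leq _ _) _.
  apply: leq_trans (size_polyMleq _ _) _; rewrite size_polyX.
  by case: (size _) ih => //.
exists (\sum_(i < size (lorq k)) `|(lorq k)`_i|); first exact: sumr_ge0.
move=> t; rewrite /lord exprS mulrCA [lor t * _]mulrC normrM (ger0_norm (lor_ge0 t)).
rewrite ler_wpM2r ?lor_ge0 // normrM (ger0_norm (exprn_ge0 _ (lor_ge0 t))).
rewrite horner_coef; apply: (@le_trans _ _ (\sum_(i < size (lorq k)) `|(lorq k)`_i| * (1 + t ^+ 2) ^+ k * lor t ^+ k)).
  rewrite -mulr_suml ler_wpM2r ?exprn_ge0 ?lor_ge0 //.
  apply: le_trans (ler_norm_sum _ _ _) _; apply: ler_sum => i _.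
  rewrite normrM ler_wpM2l // normrX.
  have ik : (i <= k)%N by rewrite -ltnS (leq_trans (ltn_ord i)).
  have h1 : `|t| <= 1 + t ^+ 2 by rewrite ler_norml; have := sqr_ge0 (t - 1); have := sqr_ge0 (t + 1); nra.
  apply: (@le_trans _ _ ((1 + t ^+ 2) ^+ i)).
    by rewrite lerXn2r ?nnegrE // ltW // lor_den_gt0.
  by rewrite ler_weXn2l // lerDl sqr_ge0.
apply: ler_sum => i _; rewrite -mulrA -exprMn [_ * lor t]mulrC lor_den expr1n mulr1 //.
Qed.

Lemma measurable_lord k : measurable_fun setT (lord k).
Proof.
apply: continuous_measurable_fun => t; apply: differentiable_continuous.
by apply/derivable1_diffP; have [] := is_derive_lord k t.
Qed.

End LorDerivatives.

(** * Derivatives of the envelope, Leibniz expansion, and decay of its Fourier transform *)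

Section Cutoff.
Variables (R : realType) (n : nat).
Implicit Types (x z xi : 'rV[R]_n).
Local Notation lb := (lebn R n).

Definition envd (e : R) (i : 'I_n) (k : nat) (xi : 'rV[R]_n) : R :=
  e ^+ k * lord k (e * xi ord0 i) * \prod_(j | j != i) lor (e * xi ord0 j).

Lemma envd0 e i : envd e i 0 = env e.
Proof.
by apply/funext => xi; rewrite /envd /env expr0 mul1r lord0 [RHS](bigD1 i).
Qed.

Lemma is_derive_envd e i k xi :
  is_derive xi (ebasis R i) (envd e i k) (envd e i k.+1 xi).
Proof.
rewrite -[xi in is_derive xi](add0r xi) -(scale0r (ebasis R i)).
apply/is_derive_line; rewrite /envd.
set P := \prod_(j | j != i) lor (e * xi ord0 j).
have -> : (fun h : R => e ^+ k * lord k (e * (h *: ebasis R i + xi) ord0 i) *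
      \prod_(j | j != i) lor (e * (h *: ebasis R i + xi) ord0 j)) =
   (fun h : R => (e ^+ k * P) *: lord k (e * h + e * xi ord0 i)).
  apply/funext => h; rewrite !mxE !eqxx /= mulr1 mulrDr.
  rewrite (eq_bigr (fun j => lor (e * xi ord0 j))) -/P /GRing.scale /=; first by ring.
  by move=> j ji; rewrite !mxE (negbTE ji) andbF mulr0 add0r.
have D0 : is_derive (0 : R) (1 : R) (fun h : R => e * h + e * xi ord0 i) e.
  by apply: is_derive_eq; rewrite /GRing.scale /=; ring.
have D1 : is_derive (e * 0 + e * xi ord0 i) (1 : R) (lord k) (lord k.+1 (e * xi ord0 i)).
  by rewrite mulr0 add0r; exact: is_derive_lord.
have D2 := is_derive1_comp (g := fun h : R => e * h + e * xi ord0 i) D1 D0.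
apply: (is_derive_eq (is_deriveZ (e ^+ k * P) D2)).
by rewrite /GRing.scale /= exprS; ring.
Qed.

Lemma measurable_envd e i k : measurable_fun setT (envd e i k : Tn R n -> R).
Proof.
apply: measurable_funM; first apply: measurable_funM => //.
  apply: (measurableT_comp (@measurable_lord R k)); apply: measurable_funM => //.
  exact: measurable_coord.
under eq_fun do rewrite big_mkcond.
apply: measurable_prod => j _; case: (j != i); last exact: measurable_cst.
apply: (measurableT_comp (@measurable_lor R)); apply: measurable_funM => //.
exact: measurable_coord.
Qed.

(** The constants do not depend on [e], because each derivative brings a factor e <= 1. *)
Lemma envd_bound : exists2 c : nat -> R, forall k, 0 <= c k &
  forall e i k xi, 0 < e -> e <= 1 -> `|envd e i k xi| <= c k * env e xi.
Proof.
have /choice[c hc] : forall k, exists C : R, 0 <= C /\ forall t, `|lord k t| <= C * lor t.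
  by move=> k; have [C] := @lord_bound R k; exists C.
exists c => [k|e i k xi e0 e1]; first by have [] := hc k.
have [ck hk] := hc k.
have P0 : 0 <= \prod_(j | j != i) lor (e * xi ord0 j).
  by apply: prodr_ge0 => j _; exact: lor_ge0.
have -> : env e xi = lor (e * xi ord0 i) * \prod_(j | j != i) lor (e * xi ord0 j).
  by rewrite /env (bigD1 i).
rewrite /envd [leRHS]mulrA normrM (ger0_norm P0) ler_wpM2r //.
rewrite normrM ger0_norm ?exprn_ge0 ?(ltW e0) //; apply: le_trans (hk _).
by rewrite ler_piMl // exprn_ile1 // ltW.
Qed.

(** The k-th derivative of X_l f_m when the sequences consist of successive derivatives. The binary
    recursion, with 2^k terms in place of binomial coefficients, makes differentiation, bounds and
    differences immediate by induction. *)
Fixpoint leib (X f : nat -> 'rV[R]_n -> R) (k l m : nat) (xi : 'rV[R]_n) : R :=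
  if k is j.+1 then leib X f j l.+1 m xi + leib X f j l m.+1 xi
  else X l xi * f m xi.

Lemma is_derive_leib (i : 'I_n) X f k l m xi :
  (forall j xi, is_derive xi (ebasis R i) (X j) (X j.+1 xi)) ->
  (forall j xi, is_derive xi (ebasis R i) (f j) (f j.+1 xi)) ->
  is_derive xi (ebasis R i) (leib X f k l m) (leib X f k.+1 l m xi).
Proof.
move=> DX Df; elim: k l m => [|k ih] l m.
  have DM := is_deriveM (DX l xi) (Df m xi).
  suff -> : leib X f 1 l m xi = X l xi *: f m.+1 xi + f m xi *: X l.+1 xi by exact: DM.
  by rewrite /= /GRing.scale /=; ring.
exact: (is_deriveD (ih l.+1 m) (ih l m.+1)).
Qed.

Lemma leib_bound X f k l m xi (a b : R) :
  (forall j, (j <= k + l)%N -> `|X j xi| <= a) ->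
  (forall j, (j <= k + m)%N -> `|f j xi| <= b) ->
  `|leib X f k l m xi| <= 2 ^+ k * (a * b).
Proof.
elim: k l m => [|k ih] l m hX hf /=.
  rewrite expr0 mul1r normrM ler_pM //; [exact: hX|exact: hf].
rewrite exprS -mulrA; apply: le_trans (ler_normD _ _) _.
have h1 : `|leib X f k l.+1 m xi| <= 2 ^+ k * (a * b).
  by apply: ih => j jk; [apply: hX; rewrite addSnnS|apply: hf; rewrite (leq_trans jk)].
have h2 : `|leib X f k l m.+1 xi| <= 2 ^+ k * (a * b).
  by apply: ih => j jk; [apply: hX; rewrite (leq_trans jk)|apply: hf; rewrite addSnnS].
lra.
Qed.

Lemma leibB X f g k l m xi :
  leib X f k l m xi - leib X g k l m xi = leib X (fun j xi => f j xi - g j xi) k l m xi.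
Proof.
elim: k l m => [|k ih] l m /=; first by ring.
by rewrite -!ih; ring.
Qed.

Lemma measurable_leib X f k l m :
  (forall j, measurable_fun setT (X j : Tn R n -> R)) ->
  (forall j, measurable_fun setT (f j : Tn R n -> R)) ->
  measurable_fun setT (leib X f k l m : Tn R n -> R).
Proof.
move=> mX mf; elim: k l m => [|k ih] l m /=; first exact: measurable_funM.
exact: measurable_funD.
Qed.

(** The Fourier transform of the envelope decays like the envelope itself: [osc_hw] gains 1/[hw],
    and [hwV_le_env] compares that with [env 1]. *)
Lemma osc_env1_bound : exists2 C : R, 0 <= C &
  forall th z, `|osc th z (env 1)| <= C * env 1 z.
Proof.
have [c c0 hc] := envd_bound.
pose B := \sum_(k < (2 * n).+1) c k.
have B0 : 0 <= B by exact: sumr_ge0.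
have cB k : (k <= 2 * n)%N -> c k <= B.
  by move=> kn; rewrite /B (bigD1 (Ordinal (kn : (k < (2 * n).+1)%N))) //= lerDl sumr_ge0.
have ie : itg lb (env 1) by exact: itg_env.
pose L := Lop (env 1) (fun i k => envd 1 i k).
have mL : measurable_fun setT (L : Tn R n -> R).
  apply: measurable_funD; first exact: measurable_env.
  by apply: measurable_funM => //; apply: measurable_sum => i; exact: measurable_envd.
have eb i k xi : (k <= 2 * n)%N -> `|envd 1 i k xi| <= B * env 1 xi.
  move=> kn; apply: le_trans (hc _ _ _ _ ltr01 (lexx _)) _.
  by rewrite ler_wpM2r ?(ltW (env_gt0 _ _)) //; exact: cB.
have Lb xi : `|L xi| <= (1 + n%:R * B) * env 1 xi.
  rewrite /L /Lop mulrDl mul1r; apply: le_trans (ler_normD _ _) _; apply: lerD.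
    by rewrite gtr0_norm // env_gt0.
  rewrite normrM normrX normrN1 expr1n mul1r; apply: le_trans (ler_norm_sum _ _ _) _.
  apply: (@le_trans _ _ (\sum_(i < n) B * env 1 xi)); first by apply: ler_sum => i _; exact: eb.
  by rewrite sumr_const card_ord -[leLHS]mulr_natl mulrA.
exists (2 ^+ n * ((1 + n%:R * B) * \int[lb]_x env 1 x)).
  rewrite mulr_ge0 ?exprn_ge0 // mulr_ge0 ?addr_ge0 ?mulr_ge0 //.
  by apply: Rintegral_ge0 => x _; exact: ltW (env_gt0 _ _).
move=> th z.
have E : hw z * osc th z (env 1) = osc th z L.
  apply: (@osc_hw _ _ _ _ B 1) => //.
  - by move=> i; exact: envd0.
  - by move=> i k x _; exact: is_derive_envd.
  - by move=> i k _; exact: measurable_envd.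
have := osc_le th z mL Lb (itgZ _ ie); rewrite -E normrM (gtr0_norm (hw_gt0 z)) RintegralZl // => h.
have I0 : 0 <= (1 + n%:R * B) * \int[lb]_x env 1 x.
  rewrite mulr_ge0 ?addr_ge0 ?mulr_ge0 //.
  by apply: Rintegral_ge0 => x _; exact: ltW (env_gt0 _ _).
rewrite mulrAC; apply: (@le_trans _ _ ((hw z)^-1 * ((1 + n%:R * B) * \int[lb]_x env 1 x))).
  by rewrite ler_pdivlMl ?hw_gt0.
by rewrite ler_wpM2r // hwV_le_env.
Qed.

Lemma osc_env1_shift_bound : exists2 C : R, 0 <= C &
  forall th z v, `|osc th z (fun x => env 1 (x - v))| <= C * env 1 z.
Proof.
have [C C0 hC] := osc_env1_bound; exists C => // th z v.
have -> : osc th z (fun x => env 1 (x - v)) = osc (dotRn z v + th) z (env 1).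
  rewrite /osc /Rintegral; congr fine.
  rewrite -(integral_shift (f := fun x : Tn R n => (cos (dotRn z x + th) * env 1 (x - v))%:E) v).
    apply: eq_integral => x _; rewrite addrK; congr (cos _ * _)%:E.
    rewrite addrA; congr (_ + _); rewrite /dotRn -big_split; apply: eq_bigr => i _ /=.
    by rewrite /Defs.coord mxE mulrDr.
  apply/measurable_EFinP; apply: measurable_funM; first exact: measurable_phase.
  exact: (measurableT_comp (measurable_env 1) (@measurable_shift _ _ _)).
exact: hC.
Qed.

End Cutoff.

(** * A local Plancherel inequality *)

Section TTstar.
Variables (R : realType) (n : nat).
Implicit Types (x y xi eta v : 'rV[R]_n).
Local Notation lb := (lebn R n).
Lemma measurable_dot2 d (X : measurableType d) (g h : X -> Tn R n) :
  measurable_fun setT g -> measurable_fun setT h ->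
  measurable_fun setT (fun z : X => dotRn (g z) (h z)).
Proof.
move=> mg mh; apply: measurable_sum => i; apply: measurable_funM.
  exact: (measurableT_comp (measurable_coord i) mg).
exact: (measurableT_comp (measurable_coord i) mh).
Qed.

Lemma measurable_phase2 d (X : measurableType d) (g h : X -> Tn R n) th :
  measurable_fun setT g -> measurable_fun setT h ->
  measurable_fun setT (fun z : X => cos (dotRn (g z) (h z) + th)).
Proof.
move=> mg mh; apply: (measurableT_comp (@measurable_cos1 R)).
by apply: measurable_funD => //; exact: measurable_dot2.
Qed.

Lemma measurable_sub_fst y :
  measurable_fun setT ((fun z : Tn R n * Tn R n => z.1 - y) : _ -> Tn R n).
Proof. exact: (measurableT_comp (@measurable_shift _ _ (- y)) measurable_fst). Qed.

Lemma measurable_osc2 th y (b : 'rV[R]_n * 'rV[R]_n -> R) :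
  measurable_fun setT (b : Tn R n * Tn R n -> R) ->
  measurable_fun setT (fun x : Tn R n => osc th (x - y) (fun xi => b (x, xi))).
Proof.
move=> mb; rewrite /osc.
apply: (@measurable_Rintegral _ _ (Tn R n) (Tn R n) R lb
  (fun z => cos (dotRn (z.1 - y) z.2 + th) * b z)).
apply: measurable_funM => //.
by apply: measurable_phase2; [exact: measurable_sub_fst|exact: measurable_snd].
Qed.

Lemma measurable_osc1 th y (b : 'rV[R]_n -> R) : measurable_fun setT (b : Tn R n -> R) ->
  measurable_fun setT (fun x : Tn R n => osc th (x - y) b).
Proof.
move=> mb; apply: (@measurable_osc2 th y (fun z => b z.2)).
exact: (measurableT_comp mb measurable_snd).
Qed.

Lemma envN e x : env e (- x) = env e x.
Proof. by apply: eq_bigr => i _; rewrite mxE mulrN lorN. Qed.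

Lemma cosM_cos (a b : R) : cos a * cos b = (cos (a - b) + cos (a + b)) / 2.
Proof. by rewrite cosB cosD; field. Qed.

Lemma dotRnBl (z xi eta : 'rV[R]_n) : dotRn z (xi - eta) = dotRn z xi - dotRn z eta.
Proof.
rewrite /dotRn -sumrB; apply: eq_bigr => i _; rewrite /Defs.coord !mxE; ring.
Qed.

Lemma dotRnDr (z xi eta : 'rV[R]_n) : dotRn z (xi + eta) = dotRn z xi + dotRn z eta.
Proof.
rewrite /dotRn -big_split; apply: eq_bigr => i _; rewrite /Defs.coord !mxE /=; ring.
Qed.

Lemma dotRnC (z xi : 'rV[R]_n) : dotRn z xi = dotRn xi z.
Proof. by apply: eq_bigr => i _; rewrite mulrC. Qed.

(** The product formula for cosines turns the Gram kernel of the waves, with weight [env 1 (x - c)],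
    into Fourier transforms of a translated envelope at xi - eta and at xi + eta; a translation only
    changes the phase. *)
Lemma gram_bound : exists2 C : R, 0 <= C & forall th c y xi eta,
  `|\int[lb]_x (env 1 (x - c) * (cos (dotRn (x - y) xi + th) * cos (dotRn (x - y) eta + th)))|
  <= C * (env 1 (xi - eta) + env 1 (xi + eta)).
Proof.
have [C C0 hC] := osc_env1_shift_bound R n; exists C => // th c y xi eta.
set t1 := - dotRn y (xi - eta); set t2 := - dotRn y (xi + eta) + (th + th).
have ie : itg lb (fun x => env 1 (x - c)) by exact: itg_env1.
have -> : \int[lb]_x (env 1 (x - c) * (cos (dotRn (x - y) xi + th) * cos (dotRn (x - y) eta + th))) =
  2^-1 * (osc t1 (xi - eta) (fun x => env 1 (x - c)) + osc t2 (xi + eta) (fun x => env 1 (x - c))).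
  rewrite /osc -RintegralD //; [|exact: itg_osc|exact: itg_osc].
  rewrite -RintegralZl //; last by apply: itgD; exact: itg_osc.
  apply: eq_Rintegral => x _; rewrite cosM_cos.
  have Ea : dotRn (x - y) xi + th - (dotRn (x - y) eta + th) = dotRn (xi - eta) x + t1.
    rewrite /t1 [dotRn (x - y) xi]dotRnC [dotRn (x - y) eta]dotRnC [dotRn (xi - eta) x]dotRnC !dotRnBl.
    rewrite [dotRn xi x]dotRnC [dotRn eta x]dotRnC [dotRn xi y]dotRnC [dotRn eta y]dotRnC; ring.
  have Eb : dotRn (x - y) xi + th + (dotRn (x - y) eta + th) = dotRn (xi + eta) x + t2.
    rewrite /t2 [dotRn (x - y) xi]dotRnC [dotRn (x - y) eta]dotRnC [dotRn (xi + eta) x]dotRnC !dotRnBl !dotRnDr.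
    rewrite [dotRn xi x]dotRnC [dotRn eta x]dotRnC [dotRn xi y]dotRnC [dotRn eta y]dotRnC; ring.
  by rewrite Ea Eb; ring.
rewrite normrM ger0_norm ?invr_ge0 //.
have h1 := hC t1 (xi - eta) c; have h2 := hC t2 (xi + eta) c.
have := ler_normD (osc t1 (xi - eta) (fun x => env 1 (x - c))) (osc t2 (xi + eta) (fun x => env 1 (x - c))).
have e1 := env_gt0 1 (xi - eta); have e2 := env_gt0 1 (xi + eta).
have := normr_ge0 (osc t1 (xi - eta) (fun x => env 1 (x - c)) + osc t2 (xi + eta) (fun x => env 1 (x - c))).
lra.
Qed.

Lemma env1_ge_hcube c l x : 0 < l -> l <= 1 -> hcube c l x -> 1 <= 2 ^+ n * env 1 (x - c).
Proof.
move=> l0 l1 xQ; rewrite /env -[n in 2 ^+ n]card_ord -prodr_const -big_split /=.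
apply: (@le_trans _ _ (\prod_(i < n) 1)); first by rewrite big1.
apply: ler_prod => i _; rewrite ler01 /= mul1r !mxE /lor ler_pdivlMr ?lor_den_gt0 // mul1r.
have /andP[h1 h2] := xQ i; nra.
Qed.

(** Schur's test: |beta(xi) beta(eta)| is at most the mean of the two squares, and the kernel has
    integral 2 C pi^n in each variable. *)
Lemma schur_double (C : R) (beta : 'rV[R]_n -> R) : 0 <= C ->
  measurable_fun setT (beta : Tn R n -> R) ->
  (\int[lb]_xi \int[lb]_eta
     (`|beta xi| * (`|beta eta| * (C * (env 1 (xi - eta) + env 1 (xi + eta)))))%:E <=
   (2 * C * pi ^+ n)%:E * \int[lb]_xi (beta xi ^+ 2)%:E)%E.
Proof.
move=> C0 mb.
pose P (z : Tn R n * Tn R n) := C * (env 1 (z.1 - z.2) + env 1 (z.1 + z.2)).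
have P0 z : 0 <= P z by rewrite mulr_ge0 // addr_ge0 // ltW // env_gt0.
have mD (s : R) : measurable_fun setT ((fun z : Tn R n * Tn R n => z.1 + s *: z.2) : _ -> Tn R n).
  apply: measurable_Tn => i; under eq_fun do rewrite !mxE.
  apply: measurable_funD; first exact: (measurableT_comp (measurable_coord i) measurable_fst).
  apply: measurable_funM => //; exact: (measurableT_comp (measurable_coord i) measurable_snd).
have mP : measurable_fun setT P.
  apply: measurable_funM => //; apply: measurable_funD.
    have -> : (fun z : Tn R n * Tn R n => env 1 (z.1 - z.2)) = env 1 \o (fun z => z.1 + (-1) *: z.2).
      by apply/funext => z /=; rewrite scaleN1r.
    exact: (measurableT_comp (measurable_env 1) (mD (-1))).
  have -> : (fun z : Tn R n * Tn R n => env 1 (z.1 + z.2)) = env 1 \o (fun z => z.1 + 1 *: z.2).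
    by apply/funext => z /=; rewrite scale1r.
  exact: (measurableT_comp (measurable_env 1) (mD 1)).
have mP1 xi : measurable_fun setT (fun eta : Tn R n => P (xi, eta)).
  by apply: (measurableT_comp mP); exact: pair1_measurable.
have mP2 eta : measurable_fun setT (fun xi : Tn R n => P (xi, eta)).
  by apply: (measurableT_comp mP); exact: pair2_measurable.
have PE1 xi : (\int[lb]_eta (P (xi, eta))%:E = (2 * C * pi ^+ n)%:E)%E.
  have ien (v : 'rV[R]_n) : itg lb (fun x => env 1 (x + v)) by exact: itg_env1.
  rewrite -EFin_Rintegral.
    congr EFin; rewrite (_ : Rintegral _ _ _ = \int[lb]_eta (C * (env 1 (eta - xi) + env 1 (eta + xi)))).
      rewrite RintegralZl //; last by apply: itgD; exact: ien.
      rewrite RintegralD //; [|exact: ien|exact: ien].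
      by rewrite !Rintegral_env1; ring.
    apply: eq_Rintegral => eta _; rewrite /P /= -(envN 1 (xi - eta)) opprB.
    by rewrite [eta + xi]addrC.
  apply: (@itg_le _ (Tn R n) _ _ _ (fun eta => C * (env 1 (eta - xi) + env 1 (eta + xi)))) => //.
    move=> eta; rewrite ger0_norm // /P /= -(envN 1 (xi - eta)) opprB.
    by rewrite [eta + xi]addrC.
  by apply: itgZ; apply: itgD; exact: ien.
have PE2 eta : (\int[lb]_xi (P (xi, eta))%:E = (2 * C * pi ^+ n)%:E)%E.
  rewrite -(PE1 eta); apply: eq_integral => xi _; congr EFin.
  by rewrite /P /= -(envN 1 (xi - eta)) opprB [eta + xi]addrC.
have mb2 : measurable_fun setT (fun x : Tn R n => beta x ^+ 2) by exact: measurable_funX.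
have E1 : (\int[lb]_xi \int[lb]_eta (beta xi ^+ 2 * P (xi, eta))%:E =
   (2 * C * pi ^+ n)%:E * \int[lb]_xi (beta xi ^+ 2)%:E)%E.
  rewrite -ge0_integralZl //; last 3 first.
  - exact/measurable_EFinP.
  - by move=> x _; rewrite lee_fin sqr_ge0.
  - by rewrite lee_fin !mulr_ge0 // exprn_ge0 // pi_ge0.
  apply: eq_integral => xi _; rewrite -(PE1 xi) muleC -ge0_integralZl //.
  - exact/measurable_EFinP.
  - by move=> x _; rewrite lee_fin.
  - by rewrite lee_fin sqr_ge0.
have mF2 : measurable_fun setT (fun z : Tn R n * Tn R n => (beta z.2 ^+ 2 * P z)%:E).
  apply/measurable_EFinP; apply: measurable_funM => //.
  exact: (measurableT_comp mb2 measurable_snd).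
have mF1 : measurable_fun setT (fun z : Tn R n * Tn R n => (beta z.1 ^+ 2 * P z)%:E).
  apply/measurable_EFinP; apply: measurable_funM => //.
  exact: (measurableT_comp mb2 measurable_fst).
have G2 (z : Tn R n * Tn R n) : (0 <= (beta z.2 ^+ 2 * P z)%:E)%E.
  by rewrite lee_fin; apply: mulr_ge0; [exact: sqr_ge0|exact: P0].
have E2 : (\int[lb]_xi \int[lb]_eta (beta eta ^+ 2 * P (xi, eta))%:E =
   (2 * C * pi ^+ n)%:E * \int[lb]_xi (beta xi ^+ 2)%:E)%E.
  transitivity (\int[lb]_eta \int[lb]_xi (beta eta ^+ 2 * P (xi, eta))%:E)%E.
    exact: (fubini_tonelli (fun z : Tn R n * Tn R n => (beta z.2 ^+ 2 * P z)%:E) mF2 G2).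
  rewrite -ge0_integralZl //; last 3 first.
  - exact/measurable_EFinP.
  - by move=> x _; rewrite lee_fin sqr_ge0.
  - by rewrite lee_fin !mulr_ge0 // exprn_ge0 // pi_ge0.
  apply: eq_integral => xi _; rewrite -(PE2 xi) muleC -ge0_integralZl //.
  - exact/measurable_EFinP.
  - by move=> x _; rewrite lee_fin.
  - by rewrite lee_fin sqr_ge0.
have G1 z : (0 <= (beta z.1 ^+ 2 * P z)%:E)%E by rewrite lee_fin mulr_ge0 // sqr_ge0.
pose F z := (2^-1%:E * ((beta z.1 ^+ 2 * P z)%:E + (beta z.2 ^+ 2 * P z)%:E))%E.
apply: (@le_trans _ _ (\int[lb]_xi \int[lb]_eta F (xi, eta))%E).
  have mF : measurable_fun setT (F : Tn R n * Tn R n -> _).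
    by apply: emeasurable_funM => //; exact: emeasurable_funD.
  have mH : measurable_fun setT (fun z : Tn R n * Tn R n => (`|beta z.1| * (`|beta z.2| * P z))%:E).
    apply/measurable_EFinP; apply: measurable_funM.
      by apply: measurableT_comp => //; exact: (measurableT_comp mb measurable_fst).
    apply: measurable_funM => //.
    by apply: measurableT_comp => //; exact: (measurableT_comp mb measurable_snd).
  have H0 z : (0 <= (`|beta z.1| * (`|beta z.2| * P z))%:E)%E.
    by rewrite lee_fin; apply: mulr_ge0 => //; exact: mulr_ge0.
  have F0 z : (0 <= F z)%E.
    by apply: mule_ge0; [rewrite lee_fin invr_ge0|apply: adde_ge0; [exact: G1|exact: G2]].
  apply: ge0_le_integral => //.
  - by move=> xi _; apply: integral_ge0 => eta _; exact: (H0 (xi, eta)).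
  - exact: (measurable_fun_fubini_tonelli_F _ mH H0).
  - exact: (measurable_fun_fubini_tonelli_F _ mF F0).
  move=> xi _; apply: ge0_le_integral => //.
  - by move=> eta _; exact: (H0 (xi, eta)).
  - exact: (measurableT_comp mH (pair1_measurable xi)).
  - exact: (measurableT_comp mF (pair1_measurable xi)).
  move=> eta _; rewrite /F -EFinD -EFinM lee_fin /=.
  rewrite (_ : C * (env 1 (xi - eta) + env 1 (xi + eta)) = P (xi, eta)) //.
  have := P0 (xi, eta); move: (P _) => p p0.
  have := sqr_ge0 (`|beta xi| - `|beta eta|).
  have := real_normK (num_real (beta xi)); have := real_normK (num_real (beta eta)).
  move: (`|beta xi|) (`|beta eta|) => a b <- <- h.
  have := mulr_ge0 h p0; nra.
have -> : (\int[lb]_xi \int[lb]_eta F (xi, eta) =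
  2^-1%:E * (\int[lb]_xi \int[lb]_eta (beta xi ^+ 2 * P (xi, eta))%:E +
    \int[lb]_xi \int[lb]_eta (beta eta ^+ 2 * P (xi, eta))%:E))%E.
  have mI1 := measurable_fun_fubini_tonelli_F (m2 := lb) _ mF1 G1.
  have mI2 := measurable_fun_fubini_tonelli_F (m2 := lb) _ mF2 G2.
  have I10 xi : (0 <= \int[lb]_eta (beta xi ^+ 2 * P (xi, eta))%:E)%E.
    by apply: integral_ge0 => eta _; exact: (G1 (xi, eta)).
  have I20 xi : (0 <= \int[lb]_eta (beta eta ^+ 2 * P (xi, eta))%:E)%E.
    by apply: integral_ge0 => eta _; exact: (G2 (xi, eta)).
  have half0 : (0 <= 2^-1%:E :> \bar R)%E by rewrite lee_fin invr_ge0.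
  have mf1 xi : measurable_fun setT (fun eta : Tn R n => (beta xi ^+ 2 * P (xi, eta))%:E).
    by apply/measurable_EFinP; apply: measurable_funM => //; exact: mP1.
  have mf2 xi : measurable_fun setT (fun eta : Tn R n => (beta eta ^+ 2 * P (xi, eta))%:E).
    by apply/measurable_EFinP; apply: measurable_funM => //; exact: mP1.
  have inner xi : (\int[lb]_eta F (xi, eta) = 2^-1%:E *
      (\int[lb]_eta (beta xi ^+ 2 * P (xi, eta))%:E +
       \int[lb]_eta (beta eta ^+ 2 * P (xi, eta))%:E))%E.
    rewrite -(@ge0_integralD _ (Tn R n) R lb setT measurableT _ _
      (fun eta _ => G1 (xi, eta)) (mf1 xi) (fun eta _ => G2 (xi, eta)) (mf2 xi)).
    rewrite -(@ge0_integralZl _ (Tn R n) R lb setT measurableT _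
      (emeasurable_funD (mf1 xi) (mf2 xi)) _ _ half0) //.
    by move=> eta _; apply: adde_ge0; [exact: (G1 (xi, eta))|exact: (G2 (xi, eta))].
  under eq_integral do rewrite inner.
  rewrite (@ge0_integralZl _ (Tn R n) R lb setT measurableT _
      (emeasurable_funD mI1 mI2) _ _ half0); last by move=> xi _; apply: adde_ge0; [exact: I10|exact: I20].
  congr (_ * _)%E.
  exact: (@ge0_integralD _ (Tn R n) R lb setT measurableT _ _
      (fun xi _ => I10 xi) mI1 (fun xi _ => I20 xi) mI2).
rewrite E1 E2; set J := ((2 * C * pi ^+ n)%:E * _)%E.
have J0 : (0 <= J)%E.
  apply: mule_ge0; first by rewrite lee_fin !mulr_ge0 // exprn_ge0 // pi_ge0.
  by apply: integral_ge0 => xi _; rewrite lee_fin sqr_ge0.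
rewrite -mule2n -[(J *+ 2)%E]mule_natl muleA -EFinM mulVf ?mul1e ?pnatr_eq0 //.
Qed.

(** The indicator of a cube of side at most 1 is dominated by 2^n [env 1 (x - c)]. Expanding the
    square of the oscillatory integral against this smooth weight gives the Gram kernel, which
    decays off xi = eta and xi = -eta, and Schur's test applies. *)
Lemma ttstar : exists2 C : R, 0 <= C & forall th c l y (beta : 'rV[R]_n -> R),
  0 < l -> l <= 1 -> itg lb beta -> itg lb (fun xi => beta xi ^+ 2) ->
  cI (fun x => osc th (x - y) beta ^+ 2) c l <= C * \int[lb]_xi beta xi ^+ 2.
Proof.
have [C C0 hC] := gram_bound.
exists (2 ^+ n * (2 * C * pi ^+ n)); first by rewrite !mulr_ge0 ?exprn_ge0 // pi_ge0.
move=> th c l y beta l0 l1 ib ib2; have mb := itg_measurable ib.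
pose G x := osc th (x - y) beta; pose phi x := env 1 (x - c).
pose N1 := \int[lb]_xi `|beta xi|.
have N10 : 0 <= N1 by exact: Rintegral_ge0.
have mG : measurable_fun setT (G : Tn R n -> R) by exact: measurable_osc1.
have GN x : `|G x| <= N1 by apply: osc_le => //; exact: itg_norm.
have iphi : itg lb phi by exact: itg_env1.
have mphi : measurable_fun setT (phi : Tn R n -> R) by exact: itg_measurable iphi.
have phi0 x : 0 <= phi x by rewrite ltW // env_gt0.
have iphiG : itg lb (fun x => phi x * G x).
  apply: (@itg_le _ (Tn R n) _ _ _ (fun x => N1 * phi x)); last exact: itgZ.
    exact: measurable_funM.
  by move=> x; rewrite normrM (ger0_norm (phi0 x)) mulrC ler_wpM2r.
have iphiG2 : itg lb (fun x => phi x * G x ^+ 2).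
  apply: (@itg_le _ (Tn R n) _ _ _ (fun x => N1 ^+ 2 * phi x)); last exact: itgZ.
    by apply: measurable_funM => //; exact: measurable_funX.
  move=> x; rewrite normrM (ger0_norm (phi0 x)) mulrC ler_wpM2r // normrX.
  by rewrite lerXn2r ?nnegrE.
have mph : measurable_fun setT (fun z : Tn R n * Tn R n => cos (dotRn (z.1 - y) z.2 + th)).
  by apply: measurable_phase2; [exact: measurable_sub_fst|exact: measurable_snd].
have mphx xi : measurable_fun setT (fun x : Tn R n => cos (dotRn (x - y) xi + th)).
  by apply: measurable_phase2; [exact: (@measurable_shift _ _ (- y))|exact: measurable_cst].
have step1 : cI (fun x => G x ^+ 2) c l <= 2 ^+ n * \int[lb]_x (phi x * G x ^+ 2).
  rewrite -RintegralZl // /cI Rintegral_mkcond; apply: le_Rintegral => //; last 2 first.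
  - exact: itgZ.
  - move=> x _; rewrite patchE; case: ifPn => [|_].
      rewrite inE => xQ; have h := env1_ge_hcube l0 l1 xQ.
      by rewrite mulrA; apply: ler_peMl => //; exact: sqr_ge0.
    by apply: mulr_ge0; [exact: exprn_ge0|apply: mulr_ge0 => //; exact: sqr_ge0].
  have lG : lintg (fun x => G x ^+ 2).
    apply: (@lintg_bounded _ _ _ (N1 ^+ 2)); first exact: measurable_funX.
    by move=> x; rewrite normrX lerXn2r ?nnegrE.
  have := lG c l l0; rewrite (integrable_mkcond _ (measurable_hcube _ _)).
  by apply: etrans; congr integrable; apply/funext => x; rewrite /= !patchE; case: ifP.
apply: le_trans step1 _; rewrite -!mulrA ler_wpM2l ?exprn_ge0 // !mulrA.
set M := fun xi eta => \int[lb]_x (phi x * (cos (dotRn (x - y) xi + th) * cos (dotRn (x - y) eta + th))).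
pose Rf xi := \int[lb]_x (phi x * G x * cos (dotRn (x - y) xi + th)).
(* One factor [G] of the square is expanded into its integral over xi; [step3] expands the other. *)
have step2 : \int[lb]_x (phi x * G x ^+ 2) = \int[lb]_xi (beta xi * Rf xi).
  transitivity (\int[lb]_x \int[lb]_xi (phi x * G x * (cos (dotRn (x - y) xi + th) * beta xi))).
    apply: eq_Rintegral => x _; rewrite RintegralZl //; last exact: itg_osc.
    by rewrite expr2 mulrA.
  rewrite (@Rintegral_fubini _ _ (Tn R n) (Tn R n) R lb lb
    (fun z => phi z.1 * G z.1 * (cos (dotRn (z.1 - y) z.2 + th) * beta z.2))
    (fun x => `|phi x * G x|) (fun xi => `|beta xi|)) //; first last.
  - exact: itg_norm.
  - exact: itg_norm.
  - by move=> x xi /=; rewrite normrM ler_wpM2l // cosM_le.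
  - apply: measurable_funM; last apply: measurable_funM => //.
      apply: (measurableT_comp (f := fun x : Tn R n => phi x * G x)) => //.
      exact: measurable_funM.
    exact: (measurableT_comp mb measurable_snd).
  apply: eq_Rintegral => xi _; rewrite -RintegralZl //.
    by apply: eq_Rintegral => x _ /=; ring.
  apply: (@itg_le _ (Tn R n) _ _ _ (fun x => `|phi x * G x|)); last exact: itg_norm.
    by apply: measurable_funM; [exact: measurable_funM|exact: mphx].
  by move=> x; rewrite mulrC; exact: cosM_le.
have step3 xi : Rf xi = \int[lb]_eta (beta eta * M xi eta).
  rewrite /Rf; transitivity (\int[lb]_x \int[lb]_eta
     (phi x * cos (dotRn (x - y) xi + th) * (cos (dotRn (x - y) eta + th) * beta eta))).
    apply: eq_Rintegral => x _; rewrite RintegralZl //; last exact: itg_osc.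
    by rewrite -/(osc th (x - y) beta) -/(G x); ring.
  rewrite (@Rintegral_fubini _ _ (Tn R n) (Tn R n) R lb lb
    (fun z => phi z.1 * cos (dotRn (z.1 - y) xi + th) * (cos (dotRn (z.1 - y) z.2 + th) * beta z.2))
    phi (fun xi => `|beta xi|)) //; first last.
  - exact: itg_norm.
  - move=> x eta /=; rewrite normrM; apply: ler_pM => //; last exact: cosM_le.
    by rewrite mulrC; apply: le_trans (cosM_le _ _) _; rewrite ger0_norm.
  - apply: measurable_funM; last apply: measurable_funM => //.
      apply: measurable_funM; first exact: (measurableT_comp mphi measurable_fst).
      apply: measurable_phase2; [exact: measurable_sub_fst|exact: measurable_cst].
    exact: (measurableT_comp mb measurable_snd).
  apply: eq_Rintegral => eta _; rewrite /M -RintegralZl //.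
    by apply: eq_Rintegral => x _ /=; ring.
  apply: (@itg_le _ (Tn R n) _ _ _ phi) => //.
    by apply: measurable_funM => //; apply: measurable_funM; exact: mphx.
  move=> x; rewrite normrM (ger0_norm (phi0 x)) ler_piMr // normrM.
  by rewrite mulr_ile1 // cos_abs_le1.
have Mb xi eta : `|beta eta * M xi eta| <=
    `|beta eta| * (C * (env 1 (xi - eta) + env 1 (xi + eta))).
  by rewrite normrM ler_wpM2l //; exact: hC.
pose Phi xi eta := C * (env 1 (xi - eta) + env 1 (xi + eta)).
have Phi0 xi eta : 0 <= Phi xi eta.
  by apply: mulr_ge0 => //; apply: addr_ge0; exact: ltW (env_gt0 _ _).
have PhiC xi eta : Phi xi eta <= 2 * C.
  by have := env_le1 1 (xi - eta); have := env_le1 1 (xi + eta); rewrite /Phi; nra.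
have mPhi : measurable_fun setT (fun z : Tn R n * Tn R n => Phi z.1 z.2).
  have mD (s : R) : measurable_fun setT ((fun z : Tn R n * Tn R n => z.1 + s *: z.2) : _ -> Tn R n).
    apply: measurable_Tn => i; under eq_fun do rewrite !mxE.
    apply: measurable_funD; first exact: (measurableT_comp (measurable_coord i) measurable_fst).
    apply: measurable_funM => //; exact: (measurableT_comp (measurable_coord i) measurable_snd).
  apply: measurable_funM => //; apply: measurable_funD.
    have -> : (fun z : Tn R n * Tn R n => env 1 (z.1 - z.2)) = env 1 \o (fun z => z.1 + (-1) *: z.2).
      by apply/funext => z /=; rewrite scaleN1r.
    exact: (measurableT_comp (measurable_env 1) (mD (-1))).
  have -> : (fun z : Tn R n * Tn R n => env 1 (z.1 + z.2)) = env 1 \o (fun z => z.1 + 1 *: z.2).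
    by apply/funext => z /=; rewrite scale1r.
  exact: (measurableT_comp (measurable_env 1) (mD 1)).
have mPhi1 xi : measurable_fun setT (fun eta : Tn R n => `|beta eta| * Phi xi eta).
  apply: measurable_funM; first exact: measurableT_comp.
  apply: measurable_funM => //; apply: measurable_funD.
    apply: (measurableT_comp (measurable_env 1)); apply: measurable_Tn => i.
    under eq_fun do rewrite !mxE.
    by apply: measurable_funB => //; exact: measurable_coord.
  apply: (measurableT_comp (measurable_env 1)); apply: measurable_Tn => i.
  under eq_fun do rewrite !mxE.
  by apply: measurable_funD => //; exact: measurable_coord.
have iPhi1 xi : itg lb (fun eta => `|beta eta| * Phi xi eta).
  apply: (@itg_le _ (Tn R n) _ _ _ (fun eta => 2 * C * `|beta eta|)) => //.
    move=> eta; rewrite ger0_norm; last exact: mulr_ge0.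
    by rewrite mulrC; apply: ler_wpM2r.
  by apply: itgZ; exact: itg_norm.
have mM xi : measurable_fun setT (fun eta : Tn R n => beta eta * M xi eta).
  apply: measurable_funM => //.
  apply: (@measurable_Rintegral _ _ (Tn R n) (Tn R n) R lb (fun z : Tn R n * Tn R n =>
    phi z.2 * (cos (dotRn (z.2 - y) xi + th) * cos (dotRn (z.2 - y) z.1 + th)))).
  have ms : measurable_fun setT ((fun z : Tn R n * Tn R n => z.2 - y) : _ -> Tn R n).
    exact: (measurableT_comp (@measurable_shift _ _ (- y)) measurable_snd).
  apply: measurable_funM; first exact: (measurableT_comp mphi measurable_snd).
  apply: measurable_funM; apply: measurable_phase2 => //; exact: measurable_cst.
have mRf : measurable_fun setT (Rf : Tn R n -> R).
  apply: (@measurable_Rintegral _ _ (Tn R n) (Tn R n) R lb (fun z : Tn R n * Tn R n =>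
    phi z.2 * G z.2 * cos (dotRn (z.2 - y) z.1 + th))).
  have ms : measurable_fun setT ((fun z : Tn R n * Tn R n => z.2 - y) : _ -> Tn R n).
    exact: (measurableT_comp (@measurable_shift _ _ (- y)) measurable_snd).
  apply: measurable_funM; last exact: measurable_phase2.
  apply: measurable_funM; first exact: (measurableT_comp mphi measurable_snd).
  exact: (measurableT_comp mG measurable_snd).
have Rfb xi : `|Rf xi| <= \int[lb]_eta (`|beta eta| * Phi xi eta).
  by rewrite step3; apply: Rintegral_norm_le.
have ibR : itg lb (fun xi => beta xi * Rf xi).
  pose N2 := \int[lb]_x `|phi x * G x|.
  apply: (@itg_le _ (Tn R n) _ _ _ (fun xi => N2 * `|beta xi|)).
  - exact: measurable_funM.
  - move=> xi; rewrite normrM mulrC ler_wpM2r //; apply: Rintegral_norm_le.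
    + by apply: measurable_funM; [exact: measurable_funM|exact: mphx].
    + by move=> x; rewrite mulrC; exact: cosM_le.
    + exact: itg_norm.
  - by apply: itgZ; exact: itg_norm.
rewrite step2 -lee_fin.
apply: (@le_trans _ _ ((\int[lb]_xi `|beta xi * Rf xi|)%:E)).
  by rewrite lee_fin (le_trans (ler_norm _)) // le_normr_Rintegral.
rewrite EFin_Rintegral; last exact: itg_norm.
have mH : measurable_fun setT (fun z : Tn R n * Tn R n =>
   (`|beta z.1| * (`|beta z.2| * Phi z.1 z.2))%:E).
  apply/measurable_EFinP; apply: measurable_funM.
    by apply: measurableT_comp => //; exact: (measurableT_comp mb measurable_fst).
  apply: measurable_funM => //.
  by apply: measurableT_comp => //; exact: (measurableT_comp mb measurable_snd).
have H0 (z : Tn R n * Tn R n) : (0 <= (`|beta z.1| * (`|beta z.2| * Phi z.1 z.2))%:E)%E.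
  by rewrite lee_fin; apply: mulr_ge0 => //; exact: mulr_ge0.
apply: (@le_trans _ _ (\int[lb]_xi \int[lb]_eta (`|beta xi| * (`|beta eta| * Phi xi eta))%:E)%E).
  apply: ge0_le_integral => //.
  - by apply/measurable_EFinP; apply: measurableT_comp => //; exact: measurable_funM.
  - exact: (measurable_fun_fubini_tonelli_F _ mH H0).
  move=> xi _.
  have i1 : itg lb (fun eta => `|beta xi| * (`|beta eta| * Phi xi eta)) := itgZ _ (iPhi1 xi).
  have E : (\int[lb]_eta (`|beta xi| * (`|beta eta| * Phi xi eta))%:E = (`|beta xi| * \int[lb]_eta (`|beta eta| * Phi xi eta))%:E)%E.
    rewrite -(EFin_Rintegral i1).
    rewrite (@RintegralZl _ (Tn R n) R lb setT _ (`|beta xi|) measurableT (iPhi1 xi)).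
    by [].
  rewrite E.
  rewrite lee_fin normrM.
  exact: (ler_wpM2l (normr_ge0 _) (Rfb xi)).
apply: le_trans (schur_double C0 mb) _.
by rewrite -EFin_Rintegral // -EFinM lee_fin !mulrA.
Qed.

End TTstar.

(** * Freezing the symbol on a small cell *)

Section FrozenCell.
Variables (R : realType) (n : nat).
Implicit Types (c x y xi : 'rV[R]_n) (l : R).
Local Notation lb := (lebn R n).

(** A_1 stated with averages over nested cubes only, for a Borel weight: no pointwise value and no
    essential infimum occurs. *)
Definition A1hyp (w : 'rV[R]_n -> R) (A : R) :=
  [/\ forall x, 0 <= w x, lintg w, measurable_fun setT (w : Tn R n -> R) &
      forall c l c' l', 0 < l -> 0 < l' -> hcube c' l' `<=` hcube c l ->
        avg w c l <= A * avg w c' l'].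

Lemma cos_lip (u v : R) : `|cos u - cos v| <= `|u - v|.
Proof.
wlog uv : u v / u <= v.
  by move=> h; case: (leP u v) => [/h//|/ltW/h h2]; rewrite distrC [leRHS]distrC.
have D (t : R) : is_derive t (1 : R) cos (- sin t) by exact: is_derive_cos.
have cg : {within `[u, v], continuous (cos : R -> R)}.
  by apply: continuous_subspaceT => t; exact: continuous_cos.
have [t _ E] := MVT_segment uv (fun t _ => D t) cg.
rewrite distrC E normrM [`|u - v|]distrC ler_piMl // normrN ler_norml.
by rewrite sin_geN1 sin_le1.
Qed.

(** Frequencies bounded by [r] make the integral Lipschitz in [z]. The value of the constant
    disappears in [cell_bound], where cells are refined indefinitely. *)
Lemma osc_lip (th : R) (z z' : 'rV[R]_n) (beta : 'rV[R]_n -> R) (r d : R) :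
  itg lb beta -> 0 <= r -> 0 <= d -> (forall i, `|z ord0 i - z' ord0 i| <= d) ->
  (forall xi, beta xi != 0 -> forall i, `|xi ord0 i| <= r) ->
  `|osc th z beta - osc th z' beta| <= n%:R * r * (\int[lb]_xi `|beta xi|) * d.
Proof.
move=> ib r0 d0 zd sup.
rewrite /osc -RintegralB //; [|exact: itg_osc|exact: itg_osc].
have -> : n%:R * r * (\int[lb]_xi `|beta xi|) * d = \int[lb]_xi (n%:R * r * d * `|beta xi|).
  by rewrite RintegralZl //; [ring|exact: itg_norm].
have mb := itg_measurable ib.
apply: Rintegral_norm_le; last by apply: itgZ; exact: itg_norm.
  by apply: measurable_funB; exact: measurable_oscint.
move=> xi; rewrite -mulrBl normrM.
have [->|bn] := eqVneq (beta xi) 0; first by rewrite normr0 !mulr0.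
rewrite ler_wpM2r //; apply: le_trans (cos_lip _ _) _.
rewrite opprD addrACA subrr addr0 /dotRn -sumrB; apply: le_trans (ler_norm_sum _ _ _) _.
apply: (@le_trans _ _ (\sum_(i < n) r * d)).
  apply: ler_sum => i _; rewrite -mulrBl normrM mulrC.
  by apply: ler_pM => //; [exact: sup|exact: zd].
by rewrite sumr_const card_ord -[leLHS]mulr_natl mulrA.
Qed.

Lemma hcube_dist c l x i : hcube c l x -> `|x ord0 i - c ord0 i| <= l.
Proof. by move=> /(_ i) /andP[h1 h2]; rewrite ler_norml; apply/andP; split; lra. Qed.

Lemma frozen_cell (C2 : R) (w : 'rV[R]_n -> R) (A : R)
    (beta : 'rV[R]_n * 'rV[R]_n -> R) (g : 'rV[R]_n -> R) (th r N1 N2 N3 s T : R) y c l :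
  0 <= C2 ->
  (forall th c l y (beta : 'rV[R]_n -> R),
    0 < l -> l <= 1 -> itg lb beta -> itg lb (fun xi => beta xi ^+ 2) ->
    cI (fun x => osc th (x - y) beta ^+ 2) c l <= C2 * \int[lb]_xi beta xi ^+ 2) ->
  1 <= A -> A1hyp w A ->
  measurable_fun setT (beta : Tn R n * Tn R n -> R) ->
  (forall x xi, `|beta (x, xi)| <= g xi) -> itg lb g -> itg lb (fun xi => g xi ^+ 2) ->
  0 <= r -> (forall x xi, beta (x, xi) != 0 -> forall i, `|xi ord0 i| <= r) ->
  \int[lb]_xi g xi <= N1 -> \int[lb]_xi (g xi ^+ 2) <= N2 ->
  (forall x, hcube c l x -> \int[lb]_xi `|beta (x, xi) - beta (c, xi)| <= N3) ->
  0 < l -> l <= 1 -> 0 < s -> 0 < T ->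
  cI (fun x => `|osc th (x - y) (fun xi => beta (x, xi))| * w x) c l <=
  cI w c l * (N3 + (T * (s + s^-1 * (C2 * N2 / l ^+ n)) +
      2 * N1 * (A `^ ((2 * (2 ^+ n * A))^-1) / T `^ ((2 * (2 ^+ n * A))^-1)))).
Proof.
move=> C20 hC2 A1 [w0 iw mw A1w] mb bg ig ig2 r0 sup gN1 gN2 bN3 l0 l1 s0 T0.
have mbx x : measurable_fun setT (fun xi : Tn R n => beta (x, xi)).
  exact: (measurableT_comp mb (@pair1_measurable _ _ (Tn R n) (Tn R n) x)).
have ib x : itg lb (fun xi => beta (x, xi)) := itg_le (mbx x) (bg x) ig.
have g0 xi : 0 <= g xi by apply: le_trans (bg 0 xi).
have ib2 x : itg lb (fun xi => beta (x, xi) ^+ 2).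
  apply: (@itg_le _ (Tn R n) _ _ _ _ _ _ ig2); first exact: measurable_funX.
  by move=> xi; rewrite normrX lerXn2r ?nnegrE.
pose F : 'rV[R]_n -> R := fun x => `|osc th (x - y) (fun xi => beta (c, xi))|.
have mF : measurable_fun setT (F : Tn R n -> R).
  by apply: measurableT_comp => //; exact: measurable_osc1.
have F0 x : 0 <= F x by exact: normr_ge0.
have oscN1 x x' : `|osc th x (fun xi => beta (x', xi))| <= N1.
  by apply: le_trans gN1; apply: osc_le.
have FN1 x : F x <= N1 by exact: oscN1.
have N10 : 0 <= N1 by apply: le_trans (F0 0) (FN1 0).
have normN1 : \int[lb]_xi `|beta (c, xi)| <= N1.
  by apply: le_trans gN1; apply: le_Rintegral => //; exact: itg_norm.
pose Lam := n%:R * r * N1.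
have Lam0 : 0 <= Lam by rewrite !mulr_ge0.
have FL c' l' x : 0 < l' -> hcube c' l' x -> `|F x - F c'| <= Lam * l'.
  move=> l'0 xQ; apply: le_trans (ler_dist_dist _ _) _.
  have zd i : `|(x - y) ord0 i - (c' - y) ord0 i| <= l'.
    by rewrite !mxE opprD addrACA subrr addr0; exact: hcube_dist.
  apply: le_trans (@osc_lip th _ _ _ r l' (ib c) r0 (ltW l'0) zd (sup c)) _.
  by rewrite ler_wpM2r ?(ltW l'0) // ler_wpM2l // mulr_ge0.
have mO : measurable_fun setT (fun x : Tn R n => osc th (x - y) (fun xi => beta (x, xi))).
  exact: measurable_osc2.
have iO : lintg (fun x => `|osc th (x - y) (fun xi => beta (x, xi))| * w x).
  apply: (@lintg_le _ _ _ (fun x => N1 * w x)); last exact: lintgZ.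
    by apply: measurable_funM => //; exact: measurableT_comp.
  by move=> x; rewrite normrM normr_id (ger0_norm (w0 x)) ler_wpM2r.
have iFw : lintg (fun x => F x * w x).
  apply: (@lintg_le _ _ _ (fun x => N1 * w x)); last exact: lintgZ.
    exact: measurable_funM.
  by move=> x; rewrite normrM normr_id (ger0_norm (w0 x)) ler_wpM2r.
apply: (@le_trans _ _ (cI (fun x => N3 * w x + F x * w x) c l)).
  apply: cI_le => //; first by apply: lintgD => //; exact: lintgZ.
  move=> x xQ; rewrite -mulrDl ler_wpM2r //.
  rewrite -lerBlDr; apply: le_trans (lerB_dist _ _) _; apply: le_trans (bN3 x xQ).
  rewrite /osc -RintegralB //; [|exact: itg_osc|exact: itg_osc].
  have mB : measurable_fun setT (fun xi : Tn R n => beta (x, xi) - beta (c, xi)).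
    exact: measurable_funB.
  have iB : itg lb (fun xi => beta (x, xi) - beta (c, xi)).
    apply: (@itg_le _ (Tn R n) _ _ _ (fun xi => 2 * g xi)) => //; last exact: itgZ.
    move=> xi; apply: le_trans (ler_normB _ _) _.
    by rewrite mulrDl mul1r lerD.
  apply: Rintegral_norm_le; last exact: itg_norm.
    by apply: measurable_funB; exact: measurable_oscint.
  by move=> xi; rewrite -mulrBr; exact: cosM_le.
rewrite cID // ?cIZ //; last exact: lintgZ.
rewrite mulrDr mulrC lerD2l.
have cb := @cell_bound _ _ w A w0 iw mw A1 A1w F N1 Lam s T c l mF F0 FN1 Lam0 FL l0 s0 T0.
cbv zeta in cb; apply: le_trans cb _.
rewrite ler_wpM2l ?cI_ge0 // lerD2r ler_wpM2l ?(ltW T0) // lerD2l ler_wpM2l ?invr_ge0 ?(ltW s0) //.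
rewrite ler_wpM2r ?invr_ge0 ?exprn_ge0 ?(ltW l0) //.
have -> : cI (fun x => F x ^+ 2) c l = cI (fun x => osc th (x - y) (fun xi => beta (c, xi)) ^+ 2) c l.
  by apply: eq_Rintegral => x _; rewrite real_normK // num_real.
apply: le_trans (hC2 th c l y _ l0 l1 (ib c) (ib2 c)) _.
rewrite ler_wpM2l //; apply: le_trans gN2; apply: le_Rintegral => //; first exact: (ib2 c).
move=> x _; by rewrite -real_normK ?num_real // lerXn2r ?nnegrE.
Qed.

Lemma cI_subdivide (f w : 'rV[R]_n -> R) (K : R) k c l : lintg f -> lintg w -> 0 < l ->
  (forall c', cI f c' (l / 2 ^+ k) <= cI w c' (l / 2 ^+ k) * K) ->
  cI f c l <= cI w c l * K.
Proof.
move=> jf jw l0 h.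
have <- : dsum k (cI f) c l = cI f c l.
  by apply: dsum_additive => // c' l' l'0; exact: cI_additive.
have <- : dsum k (fun c l => K * cI w c l) c l = cI w c l * K.
  rewrite dsumZ mulrC; congr (_ * _).
  by apply: dsum_additive => // c' l' l'0; exact: cI_additive.
by apply: dsum_le => // c' _; rewrite [leRHS]mulrC.
Qed.

End FrozenCell.

(** * Dyadic annuli in frequency and the estimate of one piece *)

Section Annuli.
Variables (R : realType) (n : nat).
Implicit Types (c x y xi : 'rV[R]_n) (l : R).
Local Notation lb := (lebn R n).

Definition obox (r : R) : set 'rV[R]_n := [set x | forall i, `]- r, r[%classic (x ord0 i)].

Definition bx (r : R) xi : R := \1_(obox r) xi.

Lemma bx_ge0 r xi : 0 <= bx r xi.
Proof. by rewrite /bx indicE. Qed.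

Lemma bx_le1 r xi : bx r xi <= 1.
Proof. by rewrite /bx indicE; case: (_ \in _). Qed.

Lemma oboxP r xi : obox r xi <-> forall i, `|xi ord0 i| < r.
Proof.
by split=> h i; have := h i; rewrite /= in_itv /= ltr_norml.
Qed.

Lemma bx_in r xi : (forall i, `|xi ord0 i| < r) -> bx r xi = 1.
Proof. by move=> /oboxP h; rewrite /bx indicE mem_set. Qed.

Lemma bx_neq0 r xi : bx r xi != 0 -> forall i, `|xi ord0 i| < r.
Proof.
rewrite /bx indicE; have [h _|h] := boolP (xi \in obox r); last by rewrite eqxx.
by apply/oboxP; rewrite inE in h.
Qed.

Lemma measurable_bx r : measurable_fun setT (bx r : Tn R n -> R).
Proof.
apply: measurable_indic; apply: (measurable_box (P := fun=> `]- r, r[%classic)) => i.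
exact: measurable_itv.
Qed.

Lemma integral_bx r : 0 < r -> (\int[lb]_xi (bx r xi)%:E = ((2 * r) ^+ n)%:E)%E.
Proof.
move=> r0; rewrite integral_indic ?setIT //; last first.
  by apply: (measurable_box (P := fun=> `]- r, r[%classic)) => i; exact: measurable_itv.
apply: (lebn_box (P := fun=> `]- r, r[%classic)) => i; first exact: measurable_itv.
rewrite lebesgue_measure_itv /= lte_fin gtrN // -EFinB; congr EFin; ring.
Qed.

Lemma itg_bx r : 0 < r -> itg lb (bx r).
Proof.
move=> r0; apply: itg_ltey; first exact: measurable_bx.
  by move=> x; exact: bx_ge0.
by rewrite integral_bx // ltry.
Qed.

Lemma Rintegral_bx r : 0 < r -> \int[lb]_xi bx r xi = (2 * r) ^+ n.
Proof. by move=> r0; rewrite /Rintegral integral_bx. Qed.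

(** Sharp cutoffs in the sup norm: the integrations by parts in xi precede this decomposition, so
    only sizes on the annuli enter. *)
Definition ann (j : nat) xi : R :=
  if j is k.+1 then bx (2 ^+ k.+1) xi - bx (2 ^+ k) xi else bx 1 xi.

Lemma bx_mono r s xi : r <= s -> bx r xi <= bx s xi.
Proof.
move=> rs; have [h|h] := eqVneq (bx r xi) 0; first by rewrite h bx_ge0.
rewrite (bx_in (r := s)) ?bx_le1 // => i.
exact: lt_le_trans (bx_neq0 h i) rs.
Qed.

Lemma ann_bounds j xi : 0 <= ann j xi <= bx (2 ^+ j) xi.
Proof.
case: j => [|j] /=; first by rewrite expr0 bx_ge0 lexx.
have h : bx (2 ^+ j) xi <= bx (2 ^+ j.+1) xi.
  by apply: bx_mono; rewrite ler_weXn2l // ler1n.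
have := bx_ge0 (2 ^+ j) xi; rewrite subr_ge0 h /= => h2; lra.
Qed.

Lemma ann_ge0 j xi : 0 <= ann j xi.
Proof. by have /andP[] := ann_bounds j xi. Qed.

Lemma ann_le j xi : ann j xi <= bx (2 ^+ j) xi.
Proof. by have /andP[] := ann_bounds j xi. Qed.

Lemma ann_le1 j xi : ann j xi <= 1.
Proof. exact: le_trans (ann_le j xi) (bx_le1 _ _). Qed.

Lemma sum_ann J xi : \sum_(j < J.+1) ann j xi = bx (2 ^+ J) xi.
Proof.
elim: J => [|J ih]; first by rewrite big_ord1 /= expr0.
by rewrite big_ord_recr /= ih addrC subrK.
Qed.

Lemma measurable_ann j : measurable_fun setT (ann j : Tn R n -> R).
Proof.
case: j => [|j]; first exact: measurable_bx.
by apply: measurable_funB; exact: measurable_bx.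
Qed.

Lemma ann_neq0_ge k xi : ann k.+1 xi != 0 -> exists i, 2 ^+ k <= `|xi ord0 i|.
Proof.
move=> h; apply: contrapT => /forallNP hN; move/eqP: h; apply.
have h i : `|xi ord0 i| < 2 ^+ k by rewrite ltNge; apply/negP; exact: hN.
rewrite /= !bx_in ?subrr // => i; apply: lt_le_trans (h i) _.
by rewrite ler_weXn2l // ler1n.
Qed.

Lemma tail_env (e eps : R) : 0 < e -> e <= 1 -> 0 < eps ->
  exists J : nat, \int[lb]_xi (env e xi * (1 - bx (2 ^+ J) xi)) < eps.
Proof.
move=> e0 e1 eps0; pose f (J : nat) xi := env e xi * (1 - bx (2 ^+ J) xi).
have mf J : measurable_fun setT (f J : Tn R n -> R).
  apply: measurable_funM; first exact: measurable_env.
  by apply: measurable_funB => //; exact: measurable_bx.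
have fb J xi : `|f J xi| <= env e xi.
  have := bx_ge0 (2 ^+ J) xi; have := bx_le1 (2 ^+ J) xi; have := env_gt0 e xi => h1 h2 h3.
  rewrite /f ger0_norm; first by rewrite ler_piMr ?(ltW h1) //; lra.
  by rewrite mulr_ge0 ?(ltW h1) //; lra.
have cf xi : (f J xi)%:E @[J --> \oo] --> (0 : \bar R).
  apply: cvg_near_cst; near=> J.
  have hJ : \sum_i `|xi ord0 i| < 2 ^+ J.
    near: J; exists (Num.bound (\sum_i `|xi ord0 i|)) => // J /= hJ.
    apply: lt_le_trans (archi_boundP _) _; first exact: sumr_ge0.
    by rewrite -natrX ler_nat (leq_trans hJ) // ltnW // ltn_expl.
  rewrite /f bx_in ?subrr ?mulr0 // => i; apply: le_lt_trans hJ.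
  by rewrite (bigD1 i) //= lerDl sumr_ge0.
have [] := @dominated_convergence _ (Tn R n) R lb setT measurableT
  (fun J xi => (f J xi)%:E) (cst 0%E) (fun xi => (env e xi)%:E).
- by move=> k; exact/measurable_EFinP.
- exact: measurable_cst.
- by apply: aeW => x _; exact: cf.
- exact: itg_env.
- by apply: aeW => x k _ /=; rewrite lee_fin.
move=> _ _ /=; rewrite integral0 => /fine_cvg /=.
move=> /cvgrPdist_lt /(_ eps eps0) [J _ hJ]; exists J.
have := hJ J (leqnn J); rewrite /= sub0r normrN => h.
by apply: le_lt_trans h; exact: ler_norm.
Unshelve. all: by end_near. Qed.

(** Rounds sg^j to a power of 2, so that cells of side about sg^(-j) are dyadic. *)
Lemma dyadic_scale (sg : R) j : 1 <= sg -> sg <= 2 ->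
  exists m : nat, sg ^+ j <= 2 ^+ m /\ 2 ^+ m <= 2 * sg ^+ j.
Proof.
move=> s1 s2; elim: j => [|j [m [h1 h2]]].
  by exists 0%N; rewrite !expr0; split; lra.
have sj : 0 < sg ^+ j by rewrite exprn_gt0 //; lra.
have [h|h] := leP (sg ^+ j.+1) (2 ^+ m).
  by exists m; split => //; rewrite exprS; nra.
exists m.+1; rewrite [2 ^+ m.+1]exprS; split; last by lra.
by rewrite exprS; nra.
Qed.

(** What is kept of the symbol: size 2^(-jn) on the j-th annulus, and a Lipschitz constant in x
    larger by q^j, where q will be 2^delta. The bound by [env e] serves only to make integrals
    converge; [B] is meant to be uniform in [e]. *)
Definition symhyp (b : 'rV[R]_n * 'rV[R]_n -> R) (B e q : R) :=
  [/\ measurable_fun setT (b : Tn R n * Tn R n -> R),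
      forall x xi, `|b (x, xi)| <= B * env e xi,
      forall j x xi, ann j xi != 0 -> `|b (x, xi)| <= B * (2^-1) ^+ (j * n) &
      forall j x x' d xi, ann j xi != 0 -> 0 <= d ->
        (forall i, `|x ord0 i - x' ord0 i| <= d) ->
        `|b (x, xi) - b (x', xi)| <= B * (2^-1) ^+ (j * n) * q ^+ j * d].

(** With sigma = 2 tau^4 and cells of side l ~ sigma^(-j), freezing costs q^j l <= tau^(4j), and the
    mean square on a cell is O(tau^(4j)). All terms then decay at least like tau^(pj), with p the
    reverse Hoelder exponent. [K] is fixed before the weight, the symbol, [e] and the cube. *)
Lemma kernel_piece (A B tau q : R) : (0 < n)%N -> 1 <= A -> 0 <= B ->
  0 < tau -> tau < 1 -> 1 <= 2 * tau ^+ 4 -> 0 <= q -> q <= 2 * tau ^+ 8 ->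
  exists2 K : R, 0 <= K & forall w b e th y c (r j : nat), A1hyp w A ->
    0 < e -> e <= 1 -> symhyp b B e q ->
    cI (fun x => `|osc th (x - y) (fun xi => b (x, xi) * ann j xi)| * w x) c (2 ^+ r) <=
    cI w c (2 ^+ r) * (K * (tau `^ ((2 * (2 ^+ n * A))^-1)) ^+ j).
Proof.
move=> n0 A1 B0 tau0 tau1 st q0 qt.
have [C2 C20 hC2] := ttstar R n.
set p := (2 * (2 ^+ n * A))^-1.
have A0 : 0 < A by lra.
have p0 : 0 < p by rewrite invr_gt0 !mulr_gt0 ?exprn_gt0.
have p1 : p <= 1.
  rewrite invf_le1 ?mulr_gt0 ?exprn_gt0 //.
  have h : 1 <= 2 ^+ n :> R by apply: exprn_ege1; lra.
  nra.
have Ap0 : 0 <= A `^ p by exact: powR_ge0.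
have two0 : 0 <= 2 ^+ n :> R by exact: exprn_ge0.
have four0 : 0 <= 4 ^+ n :> R by exact: exprn_ge0.
exists (B * 2 ^+ n + 1 + C2 * (B ^+ 2 * 4 ^+ n) + 2 * (B * 2 ^+ n) * A `^ p).
  by rewrite !addr_ge0 ?mulr_ge0 // sqr_ge0.
move=> w b e th y c r j hw e0 e1 [mb be bj bd].
have [_ iw mw _] := hw.
have sg2 : 2 * tau ^+ 4 <= 2.
  have h : tau ^+ 4 <= 1 by rewrite exprn_ile1 ?(ltW tau0) ?(ltW tau1).
  by lra.
have [m [m1 m2]] := dyadic_scale j st sg2.
set l := (2 ^+ m)^-1 : R.
have m0 : 0 < 2 ^+ m :> R by exact: exprn_gt0.
have l0 : 0 < l by rewrite invr_gt0.
have l1 : l <= 1 by rewrite invf_le1 // exprn_ege1 // ler1n.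
have j0 : 0 < 2 ^+ j :> R by exact: exprn_gt0.
pose D := (2^-1 : R) ^+ (j * n).
have D0 : 0 < D by rewrite exprn_gt0.
have DE : D * (2 * 2 ^+ j) ^+ n = 2 ^+ n.
  by rewrite exprMn mulrCA /D exprM -exprMn exprVn mulVf ?gt_eqF // expr1n mulr1.
(* Majorant of the j-th piece for all x; its integral is O(1) and that of its square is O(2^(-jn)),
   by [DE]. *)
pose g xi := B * D * bx (2 ^+ j) xi.
have ig : itg lb g by apply: itgZ; exact: itg_bx.
have g2E : (fun xi => g xi ^+ 2) = (fun xi => (B * D) ^+ 2 * bx (2 ^+ j) xi).
  apply/funext => xi; rewrite /g exprMn; congr (_ * _).
  by rewrite /bx indicE; case: (_ \in _); rewrite ?expr1n ?expr0n.
have ig2 : itg lb (fun xi => g xi ^+ 2) by rewrite g2E; apply: itgZ; exact: itg_bx.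
pose bt (z : 'rV[R]_n * 'rV[R]_n) := b z * ann j z.2.
have mbt : measurable_fun setT (bt : Tn R n * Tn R n -> R).
  apply: measurable_funM => //; exact: (measurableT_comp (measurable_ann j) measurable_snd).
have btg x xi : `|bt (x, xi)| <= g xi.
  rewrite /bt /g normrM (ger0_norm (ann_ge0 _ _)) /=.
  have [->|h] := eqVneq (ann j xi) 0.
    by rewrite mulr0 !mulr_ge0 ?(ltW D0) ?bx_ge0.
  by apply: ler_pM => //; [exact: ann_ge0|exact: bj|exact: ann_le].
have sup x xi : bt (x, xi) != 0 -> forall i, `|xi ord0 i| <= 2 ^+ j.
  move=> h i; apply: ltW; apply: bx_neq0.
  apply: contraNneq h => h0; rewrite /bt /=.
  have -> : ann j xi = 0 by apply/eqP; rewrite eq_le ann_ge0 -h0 ann_le.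
  by rewrite mulr0.
have gN1 : \int[lb]_xi g xi <= B * 2 ^+ n.
  by rewrite /g RintegralZl ?Rintegral_bx //; [rewrite -mulrA DE|exact: itg_bx].
have gN2 : \int[lb]_xi (g xi ^+ 2) <= B ^+ 2 * 2 ^+ n * D.
  rewrite g2E RintegralZl ?Rintegral_bx //; last exact: itg_bx.
  by rewrite -DE le_eqVlt; apply/orP; left; apply/eqP; ring.
pose N3 := B * 2 ^+ n * (tau ^+ 4) ^+ j.
have bN3 c' x : hcube c' l x -> \int[lb]_xi `|bt (x, xi) - bt (c', xi)| <= N3.
  move=> xQ; apply: (@le_trans _ _ (\int[lb]_xi (B * D * q ^+ j * l * bx (2 ^+ j) xi))).
    apply: le_Rintegral => //.
    - apply: itg_norm; apply: (@itg_le _ (Tn R n) _ _ _ (fun xi => 2 * g xi)); last exact: itgZ.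
        by apply: measurable_funB; exact: (measurableT_comp mbt (@pair1_measurable _ _ (Tn R n) (Tn R n) _)).
      move=> xi; apply: le_trans (ler_normB _ _) _.
      by rewrite mulrDl mul1r lerD.
    - by apply: itgZ; exact: itg_bx.
    move=> xi _; rewrite /bt /= -mulrBl normrM (ger0_norm (ann_ge0 _ _)).
    have [->|h] := eqVneq (ann j xi) 0.
      by rewrite mulr0 !mulr_ge0 ?(ltW D0) ?bx_ge0 ?exprn_ge0 ?(ltW l0).
    apply: ler_pM => //; [exact: ann_ge0| |exact: ann_le].
    by apply: bd => //; [exact: ltW|move=> i; exact: hcube_dist].
  rewrite RintegralZl ?Rintegral_bx //; last exact: itg_bx.
  have -> : B * D * q ^+ j * l * (2 * 2 ^+ j) ^+ n = B * 2 ^+ n * (q ^+ j * l) by rewrite -DE; ring.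
  rewrite ler_wpM2l ?mulr_ge0 //.
  rewrite ler_pdivrMr // -exprM.
  apply: (@le_trans _ _ ((2 * tau ^+ 8) ^+ j)); first by rewrite lerXn2r ?nnegrE ?mulr_ge0 ?exprn_ge0 ?(ltW tau0).
  have -> : (2 * tau ^+ 8) ^+ j = tau ^+ (4 * j) * (2 * tau ^+ 4) ^+ j.
    by rewrite exprM -exprMn; congr (_ ^+ _); ring.
  by rewrite ler_wpM2l // exprn_ge0 // ltW.
have tj0 : 0 < tau ^+ j by exact: exprn_gt0.
(* With t = tau^j, this choice gives T s = t and (T/s) t^4 = t, while T^(-p) = tau^(pj). *)
set s := (tau ^+ j) ^+ 2; set T := (tau ^+ j)^-1.
have s0 : 0 < s by rewrite exprn_gt0.
have T0 : 0 < T by rewrite invr_gt0.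
(* r + m halvings lead from side 2^r to side l = 2^(-m). *)
apply: (@cI_subdivide _ _ _ _ _ (r + m)) => //.
  apply: (@lintg_le _ _ _ (fun x => B * 2 ^+ n * w x)); last exact: lintgZ.
    apply: measurable_funM => //; apply: measurableT_comp => //.
    exact: (measurable_osc2 th y mbt).
  have [w0 _ _ _] := hw.
  move=> x; rewrite normrM normr_id (ger0_norm (w0 x)) ler_wpM2r //.
  apply: le_trans gN1; apply: osc_le => //; last by move=> xi; exact: btg.
  exact: (measurableT_comp mbt (@pair1_measurable _ _ (Tn R n) (Tn R n) _)).
move=> c'; have -> : 2 ^+ r / 2 ^+ (r + m) = l.
  by rewrite exprD invfM mulrA mulfV ?mul1r // gt_eqF // exprn_gt0.
have := @frozen_cell R n C2 w A bt g th (2 ^+ j) (B * 2 ^+ n) (B ^+ 2 * 2 ^+ n * D) N3 s T y c' l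
  C20 hC2 A1 hw mbt btg ig ig2 (ltW j0) sup gN1 gN2 (bN3 c') l0 l1 s0 T0.
move/le_trans; apply; have [w0 _ _ _] := hw.
rewrite ler_wpM2l ?cI_ge0 // -/p.
have up : tau <= tau `^ p.
  rewrite -[leLHS](powRr1 (ltW tau0)); apply: ger_powR => //.
  by rewrite tau0 ltW.
set t := tau ^+ j in tj0 s T s0 T0 *.
set u := (tau `^ p) ^+ j.
have tE : t = tau ^+ j by [].
have tu : t <= u by rewrite /t /u lerXn2r ?nnegrE ?(ltW tau0) ?powR_ge0.
have t1 : t <= 1 by rewrite /t exprn_ile1 ?(ltW tau0) ?(ltW tau1).
have Tp : A `^ p / T `^ p = A `^ p * u.
  have h k : (tau ^+ k) `^ p = (tau `^ p) ^+ k.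
    elim: k => [|k ih]; first by rewrite !expr0 powR1.
    by rewrite !exprS powRM ?(ltW tau0) ?exprn_ge0 ?(ltW tau0) // ih.
  have Tt : T `^ p * u = 1.
    rewrite /u -h -/t -powRM ?(ltW T0) ?(ltW tj0) //.
    by rewrite mulVf ?gt_eqF // powR1.
  have Tn : T `^ p != 0 by rewrite gt_eqF // powR_gt0.
  by congr (_ * _); apply: (mulfI Tn); rewrite mulfV.
(* Here 2^(-j) 2^m <= 2 tau^(4j) is raised to the n-th power; n >= 1 and t <= 1 allow t^(4n) to be
   replaced by t^4. *)
have hD : D / l ^+ n <= 2 ^+ n * t ^+ 4.
  have -> : (l ^+ n)^-1 = (2 ^+ m) ^+ n by rewrite /l exprVn invrK.
  rewrite /D exprM -exprMn.
  apply: (@le_trans _ _ ((2 * t ^+ 4) ^+ n)).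
    rewrite lerXn2r ?nnegrE ?mulr_ge0 ?exprn_ge0 ?(ltW m0) ?(ltW tau0) //.
    have -> : 2 * t ^+ 4 = (2^-1) ^+ j * (2 * (2 * tau ^+ 4) ^+ j).
      rewrite [RHS]mulrCA; congr (_ * _); rewrite -exprMn mulrA mulVf ?mul1r //.
      by rewrite /t -!exprM mulnC.
    by rewrite ler_wpM2l // exprn_ge0.
  rewrite exprMn ler_wpM2l //.
  have h4 : t ^+ 4 <= 1 by rewrite exprn_ile1 // (ltW tj0).
  have h40 : 0 <= t ^+ 4 by apply: exprn_ge0; exact: ltW tj0.
  by rewrite -[leRHS]expr1 ler_wiXn2l.
have -> : 2 * (B * 2 ^+ n) * (A `^ p / T `^ p) = 2 * (B * 2 ^+ n) * A `^ p * u.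
  by rewrite Tp; ring.
have N3u : N3 <= B * 2 ^+ n * u.
  rewrite /N3 ler_wpM2l ?mulr_ge0 //; apply: le_trans tu.
  rewrite -exprM mulnC exprM -/t -[leRHS]expr1 ler_wiXn2l // ltW //.
have Tsu : T * (s + s^-1 * (C2 * (B ^+ 2 * 2 ^+ n * D) / l ^+ n)) <= u + C2 * (B ^+ 2 * 4 ^+ n) * u.
  have -> : T * (s + s^-1 * (C2 * (B ^+ 2 * 2 ^+ n * D) / l ^+ n)) =
     t + T * s^-1 * (C2 * B ^+ 2 * 2 ^+ n) * (D / l ^+ n).
    rewrite /T /s; field; apply/andP; split; first by rewrite gt_eqF // exprn_gt0.
    by rewrite gt_eqF.
  apply: lerD => //.
  apply: (@le_trans _ _ (T / s * (C2 * B ^+ 2 * 2 ^+ n) * (2 ^+ n * t ^+ 4))).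
    apply: ler_wpM2l => //; apply: mulr_ge0; first by rewrite divr_ge0 ?(ltW T0) ?(ltW s0).
    by rewrite mulr_ge0 // mulr_ge0 // sqr_ge0.
  have -> : T / s * (C2 * B ^+ 2 * 2 ^+ n) * (2 ^+ n * t ^+ 4) = C2 * (B ^+ 2 * 4 ^+ n) * t.
    have -> : 4 ^+ n = 2 ^+ n * 2 ^+ n :> R by rewrite -exprMn; congr (_ ^+ _); ring.
    by rewrite /T /s; field; rewrite gt_eqF.
  by rewrite ler_wpM2l // mulr_ge0 // mulr_ge0 // sqr_ge0.
rewrite !mulrDl mul1r; lra.
Qed.

End Annuli.

(** * Summation over the annuli *)

Section KernelSum.
Variables (R : realType) (n : nat).
Implicit Types (c x y xi : 'rV[R]_n) (l : R).
Local Notation lb := (lebn R n).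

Lemma lintg_sum m (f : nat -> 'rV[R]_n -> R) : (forall j, lintg (f j)) ->
  lintg (fun x => \sum_(j < m) f j x).
Proof.
move=> h; elim: m => [|m ih].
  by rewrite (_ : (fun _ => _) = fun=> 0); [exact: lintg_cst|apply/funext => x; rewrite big_ord0].
rewrite (_ : (fun _ => _) = fun x => \sum_(j < m) f j x + f m x); first exact: lintgD.
by apply/funext => x; rewrite big_ord_recr.
Qed.

Lemma cI_sum m (f : nat -> 'rV[R]_n -> R) c l : (forall j, lintg (f j)) -> 0 < l ->
  cI (fun x => \sum_(j < m) f j x) c l = \sum_(j < m) cI (f j) c l.
Proof.
move=> h l0; elim: m => [|m ih].
  rewrite big_ord0 -[RHS](mul0r (l ^+ n)) -(cI_cst 0 c) //.
  by congr cI; apply/funext => x; rewrite big_ord0.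
rewrite big_ord_recr /= -ih -cID //; last exact: lintg_sum.
by congr cI; apply/funext => x; rewrite big_ord_recr.
Qed.

Lemma geometric_le (u : R) J : 0 <= u -> u < 1 -> \sum_(j < J) u ^+ j <= (1 - u)^-1.
Proof.
move=> u0 u1; have h : 0 < 1 - u by lra.
rewrite -(ler_pM2l h) mulfV ?gt_eqF //.
suff -> : (1 - u) * \sum_(j < J) u ^+ j = 1 - u ^+ J by rewrite gerBl exprn_ge0.
elim: J => [|J ih]; first by rewrite big_ord0 expr0; ring.
by rewrite big_ord_recr /= mulrDr ih exprS; ring.
Qed.

(** The pieces form a geometric series of ratio tau^p < 1. The frequencies beyond a large box
    contribute at most 1 pointwise, which costs one more w(Q). *)
Lemma kernel_cube (A B tau q : R) : (0 < n)%N -> 1 <= A -> 0 <= B ->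
  0 < tau -> tau < 1 -> 1 <= 2 * tau ^+ 4 -> 0 <= q -> q <= 2 * tau ^+ 8 ->
  exists2 C : R, 0 <= C & forall w b e th y c (r : nat), A1hyp w A ->
    0 < e -> e <= 1 -> symhyp b B e q ->
    cI (fun x => `|osc th (x - y) (fun xi => b (x, xi))| * w x) c (2 ^+ r) <=
    C * cI w c (2 ^+ r).
Proof.
move=> n0 A1 B0 tau0 tau1 st q0 qt.
have [K K0 hK] := kernel_piece n0 A1 B0 tau0 tau1 st q0 qt.
set p := (2 * (2 ^+ n * A))^-1 in hK.
have A0 : 0 < A by lra.
have p0 : 0 < p by rewrite invr_gt0 !mulr_gt0 ?exprn_gt0.
set u := tau `^ p in hK.
have u0 : 0 <= u by exact: powR_ge0.
have u1 : u < 1.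
  rewrite /u (lt_le_trans (gt0_ltr_powR p0 _ _ tau1)) ?powR1 // nnegrE ?ler01 //.
  exact: ltW.
have iu0 : 0 <= (1 - u)^-1 by rewrite invr_ge0; lra.
exists (K * (1 - u)^-1 + 1); first by rewrite addr_ge0 // mulr_ge0.
move=> w b e th y c r hw e0 e1 hb; have [w0 iw mw _] := hw; have [mb be _ _] := hb.
have B10 : 0 < (B + 1)^-1 by rewrite invr_gt0; lra.
(* [J] depends on [e], but the constant does not: the series is bounded for every [J], and the tail
   by B/(B+1) <= 1. *)
have [J hJ] := @tail_env R n e _ e0 e1 B10.
have ienv : itg lb (env e) by exact: itg_env.
have mbx x : measurable_fun setT (fun xi : Tn R n => b (x, xi)).
  exact: (measurableT_comp mb (@pair1_measurable _ _ (Tn R n) (Tn R n) x)).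
have ib x : itg lb (fun xi => b (x, xi)).
  apply: (@itg_le _ (Tn R n) _ _ _ (fun xi => B * env e xi)) => //; exact: itgZ.
pose f j x := `|osc th (x - y) (fun xi => b (x, xi) * ann j xi)|.
have iba j x : itg lb (fun xi => b (x, xi) * ann j xi).
  apply: (@itg_le _ (Tn R n) _ _ _ (fun xi => B * env e xi)); last exact: itgZ.
    by apply: measurable_funM => //; exact: measurable_ann.
  move=> xi; rewrite normrM (ger0_norm (ann_ge0 _ _)); apply: le_trans (be x xi).
  by rewrite ler_piMr // ann_le1.
pose t xi := 1 - bx (2 ^+ J) xi.
have t0 xi : 0 <= t xi by have := bx_le1 (2 ^+ J) xi; rewrite /t; lra.
have mt : measurable_fun setT (t : Tn R n -> R) by apply: measurable_funB => //; exact: measurable_bx.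
have t1 xi : t xi <= 1 by have := bx_ge0 (2 ^+ J) xi; rewrite /t; lra.
have iet : itg lb (fun xi => env e xi * t xi).
  apply: (@itg_le _ (Tn R n) _ _ _ (env e)) => //.
    by apply: measurable_funM => //; exact: measurable_env.
  by move=> xi; rewrite ger0_norm ?mulr_ge0 ?(ltW (env_gt0 _ _)) // ler_piMr // ltW // env_gt0.
have ibt x : itg lb (fun xi => b (x, xi) * t xi).
  apply: (@itg_le _ (Tn R n) _ _ _ (fun xi => B * (env e xi * t xi))); last exact: itgZ.
    exact: measurable_funM.
  by move=> xi; rewrite normrM (ger0_norm (t0 xi)) mulrA ler_wpM2r.
have pw x : `|osc th (x - y) (fun xi => b (x, xi))| <= \sum_(j < J.+1) f j x + 1.
  have -> : osc th (x - y) (fun xi => b (x, xi)) =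
     \sum_(j < J.+1) osc th (x - y) (fun xi => b (x, xi) * ann j xi) +
     osc th (x - y) (fun xi => b (x, xi) * t xi).
    rewrite /osc -Rintegral_sum; last by move=> j; exact: itg_osc.
    rewrite -RintegralD //; [|by apply: itg_sum => j; exact: itg_osc|exact: itg_osc].
    apply: eq_Rintegral => xi _; rewrite -mulr_sumr -mulr_sumr sum_ann /t; ring.
  apply: le_trans (ler_normD _ _) _; apply: lerD; first exact: ler_norm_sum.
  apply: (@le_trans _ _ (\int[lb]_xi (B * (env e xi * t xi)))).
    apply: osc_le; [exact: measurable_funM| |exact: itgZ].
    by move=> xi; rewrite normrM (ger0_norm (t0 xi)) mulrA ler_wpM2r.
  rewrite RintegralZl //; apply: (@le_trans _ _ (B * (B + 1)^-1)).
    by rewrite ler_wpM2l // ltW.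
  by rewrite ler_pdivrMr; lra.
have r0 : 0 < 2 ^+ r :> R by exact: exprn_gt0.
pose Bt := \int[lb]_xi (B * env e xi).
have lf j : lintg (fun x => f j x * w x).
  apply: (@lintg_le _ _ _ (fun x => Bt * w x)); last exact: lintgZ.
    apply: measurable_funM => //; apply: measurableT_comp => //.
    apply: (@measurable_osc2 _ _ th y (fun z => b z * ann j z.2)); apply: measurable_funM => //.
    exact: (measurableT_comp (measurable_ann j) measurable_snd).
  move=> x; rewrite normrM normr_id (ger0_norm (w0 x)) ler_wpM2r //.
  apply: osc_le; [exact: itg_measurable (iba j x)| |exact: itgZ].
  move=> xi; rewrite normrM (ger0_norm (ann_ge0 _ _)); apply: le_trans (be x xi).
  by rewrite ler_piMr // ann_le1.
have lo : lintg (fun x => `|osc th (x - y) (fun xi => b (x, xi))| * w x).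
  apply: (@lintg_le _ _ _ (fun x => Bt * w x)); last exact: lintgZ.
    by apply: measurable_funM => //; apply: measurableT_comp => //; exact: measurable_osc2.
  move=> x; rewrite normrM normr_id (ger0_norm (w0 x)) ler_wpM2r //.
  by apply: osc_le => //; exact: itgZ.
have lsum : lintg (fun x => \sum_(j < J.+1) (f j x * w x)) by exact: (lintg_sum _ lf).
apply: (@le_trans _ _ (cI (fun x => \sum_(j < J.+1) (f j x * w x) + w x) c (2 ^+ r))).
  apply: cI_le => //; first exact: lintgD.
  move=> x _; rewrite -mulr_suml -[X in _ <= _ + X]mul1r -mulrDl ler_wpM2r //; exact: pw.
rewrite cID // (cI_sum _ _ lf) // mulrDl mul1r lerD2r.
apply: (@le_trans _ _ (\sum_(j < J.+1) (cI w c (2 ^+ r) * K) * u ^+ j)).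
  by apply: ler_sum => j _; rewrite -mulrA; exact: (hK w b e th y c r j hw e0 e1 hb).
rewrite -mulr_sumr [leRHS]mulrC [leRHS]mulrA ler_wpM2l //.
  apply: mulr_ge0 => //; exact: cI_ge0.
exact: geometric_le.
Qed.

End KernelSum.

(** * Summation over dyadic cubes centred at y *)

Section KernelWeight.
Variables (R : realType) (n : nat).
Implicit Types (c x y xi : 'rV[R]_n) (l : R).
Local Notation lb := (lebn R n).

(** A full cube of half-side 2^r centred at [y]; the annular effect comes from taking the smallest
    one that contains a point. *)
Definition shell y (r : nat) : set 'rV[R]_n :=
  hcube (\row_i (y ord0 i - 2 ^+ r)) (2 ^+ r.+1).

Lemma hwV_shell y x : exists r : nat, shell y r x /\
  (hw (x - y))^-1 <= 4 ^+ n * (4^-1) ^+ (n * r).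
Proof.
have [m hm] : exists m : nat, `[< shell y m x >].
  exists (Num.bound (\sum_i `|x ord0 i - y ord0 i|)); apply/asboolP => i; rewrite mxE.
  set m := Num.bound _.
  have h : `|x ord0 i - y ord0 i| < 2 ^+ m.
    apply: (@le_lt_trans _ _ (\sum_i `|x ord0 i - y ord0 i|)).
      by rewrite (bigD1 i) //= lerDl sumr_ge0.
    apply: lt_le_trans (archi_boundP _) _; first exact: sumr_ge0.
    by rewrite -natrX ler_nat ltnW // ltn_expl.
  move: h; rewrite ltr_norml exprS => /andP[h1 h2]; apply/andP; split; lra.
(* If the smallest index is r+1, some coordinate of x - y has size at least 2^r, so [hw] is at least
   4^(nr); the factor 4^n makes up for the shift of index. *)
have [r /asboolP hr rmin] := ex_minnP (ex_intro (fun k : nat => `[< shell y k x >]) m hm).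
exists r; split => //.
have h1 : (hw (x - y))^-1 <= 1 by rewrite invf_le1 ?hw_gt0 // hw_ge1.
case: r hr rmin => [|r] hr rmin.
  rewrite muln0 expr0 mulr1; apply: le_trans h1 _.
  by rewrite exprn_ege1 // ler1n.
have /asboolPn : ~~ `[< shell y r x >].
  by apply/negP => /rmin; rewrite ltnn.
move=> /existsNP[i hi].
have h2 : 2 ^+ r <= `|x ord0 i - y ord0 i|.
  rewrite leNgt; apply/negP => h; apply: hi.
  by move: h; rewrite mxE ltr_norml exprS => /andP[h3 h4]; apply/andP; split; lra.
have -> : 4 ^+ n * 4^-1 ^+ (n * r.+1) = (4 ^+ (n * r))^-1 :> R.
  rewrite mulnS exprD exprVn exprVn mulrA mulfV ?mul1r // expf_neq0 //.
rewrite lef_pV2 ?posrE ?hw_gt0 ?exprn_gt0 //.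
apply: (@le_trans _ _ ((x - y) ord0 i ^+ (2 * n))).
  have -> : 4 ^+ (n * r) = ((2 ^+ r) ^+ 2) ^+ n :> R.
    by rewrite mulnC exprM; congr (_ ^+ _); rewrite -exprM mulnC exprM; congr (_ ^+ _); ring.
  rewrite !mxE exprM -(real_normK (num_real (x ord0 i - y ord0 i))).
  by rewrite lerXn2r ?nnegrE ?sqr_ge0 // lerXn2r ?nnegrE ?exprn_ge0.
rewrite /hw (bigD1 i) //= addrCA lerDl addr_ge0 // sumr_ge0 // => j _.
by rewrite exprM exprn_ge0 // sqr_ge0.
Qed.

(** The decay 4^(-nr) beats the volume 2^(n(r+1)), and A_1 at the point [y] bounds the average of
    [w] over every cube centred at [y]. *)
Lemma kernel_weight (A C : R) (f w : 'rV[R]_n -> R) y :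
  (0 < n)%N -> 0 <= A -> 0 <= C ->
  (forall x, 0 <= f x) -> (forall x, 0 <= w x) ->
  lintg f -> lintg w -> measurable_fun setT (f : Tn R n -> R) ->
  (forall c (r : nat), cI f c (2 ^+ r) <= C * cI w c (2 ^+ r)) ->
  (forall c l, 0 < l -> hcube c l y -> avg w c l <= A * w y) ->
  (\int[lb]_x ((hw (x - y))^-1 * f x)%:E <= (2 * 8 ^+ n * C * A * w y)%:E)%E.
Proof.
move=> n0 A0 C0 f0 w0 jf jw mf hC hA.
pose F (r : nat) x : R := 4 ^+ n * (4^-1) ^+ (n * r) * (f \_ (shell y r)) x.
have F0 r x : 0 <= F r x.
  by rewrite mulr_ge0 ?mulr_ge0 ?exprn_ge0 ?invr_ge0 // patchE; case: ifP.
have mshell r : measurable (shell y r : set (Tn R n)) by exact: measurable_hcube.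
have mF r : measurable_fun setT (F r : Tn R n -> R).
  apply: measurable_funM => //; apply/(measurable_restrictT _ (mshell r)).
  exact: measurable_funS mf.
have mh : measurable_fun setT (fun x : Tn R n => hw (x - y)).
  apply: measurable_funD => //; apply: measurable_sum => i; apply: measurable_funX.
  rewrite /Defs.coord; under eq_fun do rewrite !mxE.
  by apply: measurable_funB => //; exact: measurable_coord.
have mhV : measurable_fun setT (fun x : Tn R n => (hw (x - y))^-1).
  rewrite (_ : (fun _ => _) = (fun x : Tn R n => hw (x - y) `^ (-1))).
    exact: (measurableT_comp (measurable_powR _)).
  by apply/funext => x; rewrite powR_inv1 // ltW // hw_gt0.
apply: (@le_trans _ _ (\int[lb]_x (\sum_(r <oo) (F r x)%:E))%E).
  apply: ge0_le_integral => //.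
  - by move=> x _; rewrite lee_fin mulr_ge0 // invr_ge0 ltW // hw_gt0.
  - by apply/measurable_EFinP; exact: measurable_funM.
  - apply: ge0_emeasurable_sum => [r x _ _|r _]; first by rewrite lee_fin.
    by apply/measurable_EFinP.
  move=> x _; have [r [rx hr]] := hwV_shell y x.
  apply: (@le_trans _ _ (F r x)%:E).
    by rewrite lee_fin /F patchE mem_set // ler_wpM2r.
  have Fe k : true -> (0 <= (F k x)%:E)%E by rewrite lee_fin.
  apply: le_trans (nneseries_lim_ge r.+1 (fun k _ => Fe k)).
  rewrite big_nat_recr //= leeDr // sume_ge0 // => k _; exact: Fe.
rewrite integral_nneseries //; [|by move=> r; apply: measurableT_comp|by move=> r x _; rewrite lee_fin].
apply: lime_le; first by apply: is_cvg_nneseries => k _ _; apply: integral_ge0 => x _; rewrite lee_fin.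
apply: nearW => m; rewrite big_mkord.
have term r : (\int[lb]_x (F r x)%:E <= (8 ^+ n * C * A * w y * (2^-1) ^+ r)%:E)%E.
  have r0 : 0 < 2 ^+ r.+1 :> R by exact: exprn_gt0.
  have irs : itg lb (f \_ (shell y r)).
    have := jf (\row_i (y ord0 i - 2 ^+ r)) (2 ^+ r.+1) r0.
    rewrite (integrable_mkcond _ (measurable_hcube _ _)).
    by apply: etrans; congr integrable; apply/funext => x; rewrite /= !patchE; case: ifP.
  rewrite -EFin_Rintegral; last exact: itgZ.
  rewrite lee_fin RintegralZl // -Rintegral_mkcond -/(cI f _ _).
  have h1 := hC (\row_i (y ord0 i - 2 ^+ r)) r.+1.
  have h2 : cI w (\row_i (y ord0 i - 2 ^+ r)) (2 ^+ r.+1) <= A * w y * (2 ^+ r.+1) ^+ n.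
    rewrite -ler_pdivrMr ?exprn_gt0 //; apply: hA => // i; rewrite mxE.
    by have : 0 < 2 ^+ r :> R := exprn_gt0 _ (ltr0Sn _ 1); rewrite exprS; move=> h; apply/andP; split; lra.
  set k := 4 ^+ n * 4^-1 ^+ (n * r).
  have k0 : 0 <= k by rewrite mulr_ge0 ?exprn_ge0 // invr_ge0.
  apply: (@le_trans _ _ (k * (C * (A * w y * (2 ^+ r.+1) ^+ n)))).
    by rewrite ler_wpM2l // (le_trans h1) // ler_wpM2l.
  (* 8^n collects 4^n from [hwV_shell] and 2^n from the side 2^(r+1). What is left is 2^(-nr), at
     most 2^(-r) because n > 0. *)
  have -> : k * (C * (A * w y * (2 ^+ r.+1) ^+ n)) = 8 ^+ n * C * A * w y * (2^-1) ^+ (n * r).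
    have E8 : 8 ^+ n = 4 ^+ n * 2 ^+ n :> R by rewrite -exprMn; congr (_ ^+ _); ring.
    have E4 : 4^-1 ^+ (n * r) = (2^-1) ^+ (n * r) * (2^-1) ^+ (n * r) :> R.
      by rewrite -exprMn; congr (_ ^+ _); lra.
    have E2 : (2 ^+ r.+1) ^+ n = 2 ^+ n * 2 ^+ (n * r) :> R.
      by rewrite exprS exprMn -exprM mulnC.
    have Ei : (2^-1) ^+ (n * r) * 2 ^+ (n * r) = 1 :> R.
      by rewrite -exprMn mulVf // expr1n.
    rewrite /k E8 E4 E2 -[RHS]mulr1 -[X in _ = _ * X]Ei; set p1 := 2^-1 ^+ _; set p2 := 2 ^+ (n * r); ring.
  rewrite ler_wpM2l ?mulr_ge0 ?exprn_ge0 //.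
  rewrite exprM; apply: lerXn2r; rewrite ?nnegrE ?exprn_ge0 ?invr_ge0 //.
  rewrite -[leRHS]expr1 ler_wiXn2l ?invr_ge0 // invf_le1 //; lra.
apply: (@le_trans _ _ (\sum_(r < m) (8 ^+ n * C * A * w y * (2^-1) ^+ r)%:E)%E).
  by apply: lee_sum => r _; exact: term.
rewrite sumEFin lee_fin -mulr_sumr.
have hg := @geometric_le R (2^-1) m; rewrite [leRHS](_ : _ = 8 ^+ n * C * A * w y * 2); last by ring.
rewrite ler_wpM2l ?mulr_ge0 ?exprn_ge0 //; apply: le_trans (hg _ _) _; first by rewrite invr_ge0.
  by rewrite invf_lt1 //; lra.
rewrite le_eqVlt; apply/orP; left; by apply/eqP; field.
Qed.

End KernelWeight.

(** * The symbol after the integrations by parts *)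

Section CutoffSymbol.
Variables (R : realType) (n : nat).
Implicit Types (x y z xi : 'rV[R]_n).
Local Notation lb := (lebn R n).

Lemma jbr_ge1 xi : 1 <= jbr xi.
Proof.
rewrite /jbr -[leLHS]sqrtr1 ler_sqrt; last first.
  by rewrite addr_ge0 // sumr_ge0 // => i _; rewrite -expr2 sqr_ge0.
by rewrite lerDl sumr_ge0 // => i _; rewrite -expr2 sqr_ge0.
Qed.

Lemma jbr_ann j xi : ann j xi != 0 -> 2 ^+ j <= 2 * jbr xi.
Proof.
have j1 := jbr_ge1 xi.
case: j => [|j] h; first by rewrite expr0; lra.
have [i hi] := ann_neq0_ge h; rewrite exprS ler_wpM2l //.
apply: le_trans hi _; rewrite -sqrtr_sqr /jbr ler_sqrt; last first.
  by rewrite addr_ge0 // sumr_ge0 // => k _; rewrite -expr2 sqr_ge0.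
rewrite /dotRn (bigD1 i) //= -expr2 addrCA lerDl addr_ge0 // sumr_ge0 // => k _.
by rewrite -expr2 sqr_ge0.
Qed.

Lemma jbr_powR_ann j xi (s : R) : ann j xi != 0 -> 0 <= s -> s <= n%:R ->
  jbr xi `^ (- n%:R + s) <= 2 ^+ n * (2^-1) ^+ (j * n) * (2 `^ s) ^+ j.
Proof.
move=> /jbr_ann h s0 sn; have j1 := jbr_ge1 xi.
have p2 : 0 < 2 ^+ j :> R by exact: exprn_gt0.
set t : R := 2 ^+ j / 2; have t0 : 0 < t by rewrite divr_gt0.
have tj : t <= jbr xi by rewrite ler_pdivrMr // mulrC.
have -> : - n%:R + s = - (n%:R - s) by ring.
rewrite powRN; apply: (@le_trans _ _ ((t `^ (n%:R - s))^-1)).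
  rewrite lef_pV2 ?posrE ?powR_gt0 //; last by lra.
  by apply: ge0_ler_powR; rewrite ?nnegrE ?subr_ge0 ?(ltW t0) //; lra.
rewrite -powRN opprB powRD ?(gt_eqF t0) ?implybT //.
rewrite powRN powR_mulrn ?(ltW t0) // mulrC.
have -> : (t ^+ n)^-1 = 2 ^+ n * 2^-1 ^+ (j * n) :> R.
  by rewrite /t expr_div_n invfM invrK mulrC exprM !exprVn.
rewrite ler_wpM2l //.
apply: (@le_trans _ _ ((2 ^+ j) `^ s)).
  apply: ge0_ler_powR; rewrite ?nnegrE ?(ltW t0) ?(ltW p2) // /t.
  by rewrite ler_pdivrMr //; lra.
by rewrite -[2 ^+ j]powR_mulrn // -[leRHS]powR_mulrn ?powR_ge0 // -!powRrM mulrC.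
Qed.

Lemma jbr_powR_le1 xi : jbr xi `^ (- n%:R) <= 1.
Proof.
have j1 := jbr_ge1 xi.
rewrite powRN invf_le1 ?powR_gt0 //; last by lra.
by rewrite powR_mulrn ?exprn_ege1 //; lra.
Qed.

(** The operator [Lop] in xi applied to [env e] times [f], the derivatives of the product being
    written with [leib]; [f_ i k] stands for the k-th derivative of [f] in xi_i. *)
Definition cutsym (e : R) (f : 'rV[R]_n * 'rV[R]_n -> R)
    (f_ : 'I_n -> nat -> 'rV[R]_n * 'rV[R]_n -> R) (z : 'rV[R]_n * 'rV[R]_n) : R :=
  Lop (fun xi => env e xi * f (z.1, xi))
      (fun i k => leib (envd e i) (fun m xi => f_ i m (z.1, xi)) k 0 0) z.2.

Lemma Lop_bound : exists2 D : R, 1 <= D & forall e (f : 'rV[R]_n -> R)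
    (f_ : 'I_n -> nat -> 'rV[R]_n -> R) xi (g : R), 0 < e -> e <= 1 ->
  `|f xi| <= g -> (forall i k, (k <= 2 * n)%N -> `|f_ i k xi| <= g) ->
  (forall i k, (k <= 2 * n)%N -> `|leib (envd e i) (f_ i) k 0 0 xi| <= D * (env e xi * g)) /\
  `|Lop (fun xi => env e xi * f xi) (fun i k => leib (envd e i) (f_ i) k 0 0) xi|
    <= D * (env e xi * g).
Proof.
have [c c0 hc] := @envd_bound R n.
pose M := \sum_(k < (2 * n).+1) c k.
have M0 : 0 <= M by apply: sumr_ge0 => k _; exact: c0.
have cM k : (k <= 2 * n)%N -> c k <= M.
  move=> kn; rewrite /M (bigD1 (Ordinal (kn : (k < (2 * n).+1)%N))) //= lerDl.
  by apply: sumr_ge0 => j _; exact: c0.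
pose D1 := 2 ^+ (2 * n) * M.
have D10 : 0 <= D1 by rewrite mulr_ge0 // exprn_ge0.
have nD : 0 <= n%:R * D1 by rewrite mulr_ge0.
exists (1 + D1 + n%:R * D1) => [|e f f_ xi g e0 e1 fg f_g]; first lra.
have g0 : 0 <= g by exact: le_trans (normr_ge0 _) fg.
have E0 : 0 <= env e xi by rewrite ltW // env_gt0.
have Eg : 0 <= env e xi * g by rewrite mulr_ge0.
have hl i k : (k <= 2 * n)%N -> `|leib (envd e i) (f_ i) k 0 0 xi| <= D1 * (env e xi * g).
  move=> kn; apply: (@le_trans _ _ (2 ^+ k * (M * env e xi * g))).
    apply: leib_bound => j; rewrite addn0 => jk; last by apply: f_g; exact: leq_trans kn.
    apply: le_trans (hc e i j xi e0 e1) _; rewrite ler_wpM2r //; apply: cM.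
    exact: leq_trans kn.
  rewrite -[M * _ * g]mulrA /D1 -[2 ^+ (2 * n) * M * _]mulrA ler_wpM2r ?mulr_ge0 //.
  by rewrite ler_weXn2l // ler1n.
split=> [i k kn|].
  by apply: le_trans (hl i k kn) _; rewrite ler_wpM2r //; lra.
rewrite /Lop; apply: le_trans (ler_normD _ _) _.
rewrite !mulrDl mul1r; have -> : n%:R * D1 * (env e xi * g) = \sum_(i < n) D1 * (env e xi * g).
  by rewrite sumr_const card_ord -[RHS]mulr_natl [RHS]mulrA.
apply: lerD.
  rewrite normrM (ger0_norm E0); apply: (@le_trans _ _ (env e xi * g)).
    by rewrite ler_wpM2l.
  by rewrite lerDl mulr_ge0.
rewrite normrM normrX normrN1 expr1n mul1r; apply: le_trans (ler_norm_sum _ _ _) _.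
by apply: ler_sum => i _; exact: hl.
Qed.

Lemma measurable_leib2 (X : nat -> 'rV[R]_n -> R) (f : nat -> 'rV[R]_n * 'rV[R]_n -> R) k l m :
  (forall j, measurable_fun setT (X j : Tn R n -> R)) ->
  (forall j, measurable_fun setT (f j : Tn R n * Tn R n -> R)) ->
  measurable_fun setT (fun z : Tn R n * Tn R n => leib X (fun j xi => f j (z.1, xi)) k l m z.2).
Proof.
move=> mX mf; elim: k l m => [|k ih] l m /=; last exact: measurable_funD.
apply: measurable_funM; first exact: (measurableT_comp (mX l) measurable_snd).
by under eq_fun do rewrite -surjective_pairing; exact: mf.
Qed.

Lemma LopB (F G : 'rV[R]_n -> R) F_ G_ xi :
  Lop F F_ xi - Lop G G_ xi =
  Lop (fun xi => F xi - G xi) (fun i k xi => F_ i k xi - G_ i k xi) xi.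
Proof. by rewrite /Lop sumrB mulrBr; ring. Qed.

(** For rho = 0 each xi-derivative of [f] keeps the order -n, and derivatives of the envelope are
    bounded by it uniformly in [e] ([Lop_bound]); hence [B] is chosen before [e]. *)
Lemma cutsym_symhyp (K delta : R) : (0 < n)%N -> 0 <= delta -> delta <= 1 -> 0 <= K ->
  exists2 B : R, 0 <= B & forall e f f_, 0 < e -> e <= 1 ->
    (forall i, f_ i 0%N = f) ->
    measurable_fun setT (f : Tn R n * Tn R n -> R) ->
    (forall i k, measurable_fun setT (f_ i k : Tn R n * Tn R n -> R)) ->
    (forall i k x xi, is_derive xi (ebasis R i) (fun xi => f_ i k (x, xi)) (f_ i k.+1 (x, xi))) ->
    (forall x xi, `|f (x, xi)| <= K * jbr xi `^ (- n%:R)) ->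
    (forall i k x xi, (k <= 2 * n)%N -> `|f_ i k (x, xi)| <= K * jbr xi `^ (- n%:R)) ->
    (forall x x' d xi, 0 <= d -> (forall i, `|x ord0 i - x' ord0 i| <= d) ->
       `|f (x, xi) - f (x', xi)| <= n%:R * K * d * jbr xi `^ (- n%:R + delta)) ->
    (forall i k x x' d xi, (k <= 2 * n)%N -> 0 <= d -> (forall i, `|x ord0 i - x' ord0 i| <= d) ->
       `|f_ i k (x, xi) - f_ i k (x', xi)| <= n%:R * K * d * jbr xi `^ (- n%:R + delta)) ->
    symhyp (cutsym e f f_) B e (2 `^ delta) /\
    forall th z x, hw z * osc th z (fun xi => env e xi * f (x, xi)) =
      osc th z (fun xi => cutsym e f f_ (x, xi)).
Proof.
move=> n0 d0 d1 K0; have [D D1 hD] := Lop_bound.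
have D0 : 0 <= D by lra.
have n1 : 1 <= n%:R :> R by rewrite ler1n.
have p2 : 1 <= 2 ^+ n :> R by rewrite exprn_ege1 // ler1n.
have DK : 0 <= D * K by rewrite mulr_ge0.
exists (D * K * 2 ^+ n * n%:R); first by rewrite !mulr_ge0 // exprn_ge0.
move=> e f f_ e0 e1 f0 mf mf_ Df bf bf_ lf lf_.
have E0 xi : 0 <= env e xi by rewrite ltW // env_gt0.
have E1 xi : env e xi <= 1 by exact: env_le1.
have j0 xi : 0 <= jbr xi `^ (- n%:R) by exact: powR_ge0.
have bnd x xi := hD e (fun xi => f (x, xi)) (fun i k xi => f_ i k (x, xi)) xi _ e0 e1
  (bf x xi) (fun i k => bf_ i k x xi).
have KB : D * K <= D * K * 2 ^+ n * n%:R.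
  by rewrite -mulrA ler_peMr // mulr_ege1.
split; first split.
- apply: measurable_funD.
    apply: measurable_funM; first exact: (measurableT_comp (measurable_env e) measurable_snd).
    by under eq_fun do rewrite -surjective_pairing; exact: mf.
  apply: measurable_funM => //; apply: measurable_sum => i.
  by apply: measurable_leib2 => // j; exact: measurable_envd.
- move=> x xi; have [_ h] := bnd x xi; apply: le_trans h _.
  apply: (@le_trans _ _ (D * K * env e xi)); last by rewrite ler_wpM2r.
  rewrite -mulrA ler_wpM2l // [leRHS]mulrC ler_wpM2l //.
  by rewrite ler_piMr // jbr_powR_le1.
- move=> j x xi ax; have [_ h] := bnd x xi; apply: le_trans h _.
  have := jbr_powR_ann ax (lexx 0) (ler0n _ _); rewrite addr0 powRr0 expr1n mulr1 => h2.
  apply: (@le_trans _ _ (D * K * (2 ^+ n * 2^-1 ^+ (j * n)))).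
    rewrite -mulrA ler_wpM2l // -[leRHS]mul1r; apply: ler_pM => //; first exact: mulr_ge0.
    by rewrite ler_wpM2l.
  have t0 : 0 <= 2^-1 ^+ (j * n) :> R by rewrite exprn_ge0 // invr_ge0.
  rewrite mulrA ler_wpM2r // ler_peMr //; apply: mulr_ge0 => //; exact: le_trans p2.
- move=> j x x' d xi ax dd0 xd.
  have := jbr_powR_ann ax d0 (le_trans d1 n1) => h2.
  (* [cutsym] is linear in the symbol, so the bound used for [f] applies to the difference of its
     values at [x] and [x']. *)
  rewrite /cutsym LopB /=.
  have [_ h] := hD e (fun xi => f (x, xi) - f (x', xi))
    (fun i k xi => f_ i k (x, xi) - f_ i k (x', xi)) xi _ e0 e1
    (lf x x' d xi dd0 xd) (fun i k kn => lf_ i k x x' d xi kn dd0 xd).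
  have -> : Lop (fun xi => env e xi * f (x, xi) - env e xi * f (x', xi))
     (fun i k xi => leib (envd e i) (fun m xi => f_ i m (x, xi)) k 0 0 xi -
        leib (envd e i) (fun m xi => f_ i m (x', xi)) k 0 0 xi) xi =
     Lop (fun xi => env e xi * (f (x, xi) - f (x', xi)))
     (fun i k => leib (envd e i) (fun m xi => f_ i m (x, xi) - f_ i m (x', xi)) k 0 0) xi.
    rewrite /Lop mulrBr; congr (_ + _ * _); apply: eq_bigr => i _; exact: leibB.
  have nKd : 0 <= n%:R * K * d by do 2?apply: mulr_ge0.
  set P := 2 ^+ n * _ * _ in h2; apply: le_trans h _.
  apply: (@le_trans _ _ (D * (n%:R * K * d * P))); last first.
    by rewrite le_eqVlt; apply/orP; left; apply/eqP; rewrite /P; ring.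
  rewrite ler_wpM2l // -[leRHS]mul1r; apply: ler_pM => //; last by rewrite ler_wpM2l.
  by rewrite mulr_ge0 // powR_ge0.
move=> th z x.
have iF : itg lb (fun xi => env e xi * f (x, xi)).
  apply: (@itg_le _ (Tn R n) _ _ _ (fun xi => K * env e xi)); last by apply: itgZ; exact: itg_env.
    apply: measurable_funM; first exact: measurable_env.
    exact: (measurableT_comp mf (@pair1_measurable _ _ (Tn R n) (Tn R n) x)).
  move=> xi; rewrite normrM (ger0_norm (E0 xi)) mulrC ler_wpM2r //.
  by apply: le_trans (bf x xi) _; rewrite ler_piMr // jbr_powR_le1.
apply: (@osc_hw R n (fun xi => env e xi * f (x, xi))
  (fun i k => leib (envd e i) (fun m xi => f_ i m (x, xi)) k 0 0) (D * K) e th z) => //.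
- by move=> i; rewrite /= f0 envd0.
- move=> i k xi _; exact: (@is_derive_leib _ _ i _ _ _ _ _ _ (@is_derive_envd R n e i) (fun j u => Df i j x u)).
- move=> i k _; apply: measurable_leib => j; first exact: measurable_envd.
  exact: (measurableT_comp (mf_ i j) (@pair1_measurable _ _ (Tn R n) (Tn R n) x)).
- move=> i k xi kn; have [h _] := bnd x xi; apply: le_trans (h i k kn) _.
  rewrite -mulrA ler_wpM2l // mulrC ler_wpM2r // ler_piMr //; exact: jbr_powR_le1.
Qed.

End CutoffSymbol.

(** * Real and imaginary parts of the symbol *)

Section SymbolComponents.
Variables (R : realType) (n : nat).
Implicit Types (x xi : 'rV[R]_n) (a : 'rV[R]_n * 'rV[R]_n -> R[i]).

Lemma Re_le_cmod (z : R[i]) : `|complex.Re z| <= cmod z.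
Proof. by rewrite /cmod -sqrtr_sqr ler_sqrt ?lerDl ?sqr_ge0 // addr_ge0 ?sqr_ge0. Qed.

Lemma Im_le_cmod (z : R[i]) : `|complex.Im z| <= cmod z.
Proof. by rewrite /cmod -sqrtr_sqr ler_sqrt ?lerDr ?sqr_ge0 // addr_ge0 ?sqr_ge0. Qed.

Definition xid (f : 'rV[R]_n * 'rV[R]_n -> R) (i : 'I_n) (k : nat) :=
  dirs (@sdir R n) (map inr (nseq k i)) f.

Lemma smooth_slice f i k x xi : smoothR (@sdir R n) f ->
  is_derive xi (ebasis R i) (fun xi => xid f i k (x, xi)) (xid f i k.+1 (x, xi)).
Proof.
move=> sf; have dk := sf (map inr (nseq k i)) (x, xi).
have D : is_derive (x, xi) (sdir R (inr i)) (xid f i k) (xid f i k.+1 (x, xi)).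
  by split => //; exact: diff_derivable.
rewrite -[xi in is_derive xi]add0r -(scale0r (ebasis R i)); apply/is_derive_line.
have : is_derive (0 *: sdir R (inr i) + (x, xi)) (sdir R (inr i)) (xid f i k) (xid f i k.+1 (x, xi)).
  by rewrite scale0r add0r.
move/is_derive_line.
suff -> : (fun h : R => xid f i k (h *: sdir R (inr i) + (x, xi))) =
  (fun h : R => xid f i k (x, h *: ebasis R i + xi)) by [].
apply/funext => h; congr (xid f i k _); rewrite /sdir /=.
by congr pair; rewrite /= ?scaler0 ?add0r.
Qed.

(** Mean value theorem on the segment from x' to x, with the derivative along x - x' expanded in the
    n coordinate directions. *)
Lemma smooth_lip (g : 'rV[R]_n * 'rV[R]_n -> R) x x' xi (M d : R) :
  (forall p, differentiable g p) -> 0 <= d -> (forall i, `|x ord0 i - x' ord0 i| <= d) ->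
  (forall i y, `|'D_(sdir R (inl i)) g (y, xi)| <= M) ->
  `|g (x, xi) - g (x', xi)| <= n%:R * M * d.
Proof.
move=> dg d0 xd hM; pose v : 'rV[R]_n * 'rV[R]_n := (x - x', 0).
have D p : is_derive p v g ('D_v g p) by split => //; exact: diff_derivable.
have [c _ hc] := MVT_line (x', xi) ltr01 D.
have E1 : 1 *: v + (x', xi) = (x, xi).
  by rewrite scale1r /v; congr pair; rewrite /= ?subrK ?add0r.
have E2 : c *: v + (x', xi) = (c *: (x - x') + x', xi).
  by congr pair; rewrite /= scaler0 add0r.
rewrite E1 E2 mulr1 in hc; rewrite hc deriveE //.
have -> : v = \sum_(i < n) (x ord0 i - x' ord0 i) *: sdir R (inl i).
  have -> : v = (\sum_(i < n) (x ord0 i - x' ord0 i) *: ebasis R i, 0).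
    by congr pair; rewrite [LHS]row_sum_delta; apply: eq_bigr => i _; rewrite !mxE.
  apply: (big_ind2 (fun p (q : 'rV[R]_n * 'rV[R]_n) => (p, 0) = q)) => [//|p1 q1 p2 q2 <- <-|i _].
    by congr pair; rewrite /= addr0.
  by congr pair; rewrite /= scaler0.
rewrite linear_sum /=; apply: le_trans (ler_norm_sum _ _ _) _.
apply: (@le_trans _ _ (\sum_(i < n) M * d)); last first.
  by rewrite sumr_const card_ord -mulrA mulr_natl.
apply: ler_sum => i _; rewrite linearZ /= normrM mulrC; apply: ler_pM => //.
by rewrite -deriveE //; exact: hM.
Qed.

Definition part (b : bool) (z : R[i]) : R := if b then complex.Re z else complex.Im z.

Lemma part_le_cmod b z : `|part b z| <= cmod z.
Proof. by case: b; [exact: Re_le_cmod|exact: Im_le_cmod]. Qed.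

(** Seminorms of order 2n + 1 enter: 2n derivatives in xi, and one more in x for the Lipschitz
    bounds. *)
Lemma symbol_cutsym (K delta : R) a b : 0 <= K ->
  symbol_class (- n%:R) 0 delta a -> seminorms_le (- n%:R) 0 delta a (2 * n).+1 K ->
  let f := fun z => part b (a z) in
  [/\ continuous f, forall i k, continuous (xid f i k),
    (forall i k x xi, is_derive xi (ebasis R i) (fun xi => xid f i k (x, xi)) (xid f i k.+1 (x, xi))),
    (forall i k x xi, (k <= 2 * n)%N -> `|xid f i k (x, xi)| <= K * jbr xi `^ (- n%:R)) &
    (forall i k x x' d xi, (k <= 2 * n)%N -> 0 <= d -> (forall i, `|x ord0 i - x' ord0 i| <= d) ->
       `|xid f i k (x, xi) - xid f i k (x', xi)| <= n%:R * K * d * jbr xi `^ (- n%:R + delta))] /\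
    (forall x xi, `|f (x, xi)| <= K * jbr xi `^ (- n%:R)) /\
    (forall x x' d xi, 0 <= d -> (forall i, `|x ord0 i - x' ord0 i| <= d) ->
       `|f (x, xi) - f (x', xi)| <= n%:R * K * d * jbr xi `^ (- n%:R + delta)).
Proof.
move=> K0 [sa _] hK f.
have sf : smoothR (@sdir R n) f by rewrite /f; clear f; case: sa; case: b.
have hd s z : `|dirs (@sdir R n) s f z| <= cmod (dirsC (@sdir R n) s a z).
  by have := part_le_cmod b (dirsC (@sdir R n) s a z); rewrite /f; clear f sf; case: b.
have hb s x xi : (size s <= (2 * n).+1)%N ->
    `|dirs (@sdir R n) (map inr s) f (x, xi)| <= K * jbr xi `^ (- n%:R).
  move=> hs; apply: le_trans (hd _ _) _; have := hK [::] s hs x xi.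
  by rewrite /= mul0r subr0 mulr0 addr0.
have hl s x x' d xi : (size s <= 2 * n)%N -> 0 <= d -> (forall i, `|x ord0 i - x' ord0 i| <= d) ->
   `|dirs (@sdir R n) (map inr s) f (x, xi) - dirs (@sdir R n) (map inr s) f (x', xi)| <=
   n%:R * K * d * jbr xi `^ (- n%:R + delta).
  move=> hs d0 xd; have := @smooth_lip (dirs (@sdir R n) (map inr s) f) x x' xi
    (K * jbr xi `^ (- n%:R + delta)) d (sf _) d0 xd.
  have -> : n%:R * (K * jbr xi `^ (- n%:R + delta)) * d =
    n%:R * K * d * jbr xi `^ (- n%:R + delta) by ring.
  apply=> i y; have := hd (inl i :: map inr s) (y, xi) => h; apply: le_trans h _.
  by have := hK [:: i] s hs y xi; rewrite /= mul0r subr0 mulr1.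
split; last by split=> *; [exact: (hb [::])|exact: (hl [::])].
split=> [z|i k z|i k x xi|i k x xi kn|i k x x' d xi kn].
- exact: differentiable_continuous (sf [::] z).
- exact: differentiable_continuous (sf _ z).
- exact: smooth_slice.
- by apply: hb; rewrite size_nseq ltnW.
- by apply: hl; rewrite size_nseq.
Qed.

End SymbolComponents.

(** * A Borel version of the weight *)

Section BorelWeight.
Variables (R : realType) (n : nat).
Implicit Types (x y c : 'rV[R]_n) (w : 'rV[R]_n -> R).
Local Notation lb := (lebn R n).

Lemma lebn_null_bigcup (F : nat -> set (Tn R n)) :
  (forall k, measurable (F k) /\ lb (F k) = 0%E) ->
  measurable (\bigcup_k F k) /\ lb (\bigcup_k F k) = 0%E.
Proof.
move=> hF; have mU : measurable (\bigcup_k F k).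
  by apply: bigcupT_measurable => k; have [] := hF k.
split=> //; apply/(negligibleP _ mU); apply: negligible_bigcup => k.
by have [mk k0] := hF k; apply/negligibleP.
Qed.

(** Countably many levels suffice to determine a function, so the exceptional null sets can be
    merged into one. *)
Lemma lmeasurable_rat_null w : lmeasurable_fun w ->
  exists2 G : set (Tn R n), measurable G /\ lb G = 0%E &
    forall q : rat, exists2 B : set (Tn R n), measurable B &
      forall x, ~ G x -> (w x < ratr q <-> B x).
Proof.
move=> hw; have /choice[BG hBG] : forall q : rat, exists BG : set (Tn R n) * set (Tn R n),
    [/\ measurable BG.1, measurable BG.2 /\ lb BG.2 = 0%E &
        forall x, ~ BG.2 x -> (w x < ratr q <-> BG.1 x)].
  move=> q; have [B [N [mB [N0 BN]]]] := hw (ratr q).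
  have [G mG NG] := lnull_Borel N0; exists (B, G); split=> // x /= Gx.
  by split=> h; apply: contrapT => h2; apply/Gx/NG/BN; [left|right].
pose L (k : nat) : rat := odflt 0 (unpickle k).
exists (\bigcup_k (BG (L k)).2).
  by apply: lebn_null_bigcup => k; have [] := hBG (L k).
move=> q; have [mB _ hB] := hBG q; exists (BG q).1 => // x Gx; apply: hB => Gq.
by apply: Gx; exists (pickle q) => //; rewrite /L pickleK.
Qed.

Lemma measurable_rat_lt (f : 'rV[R]_n -> R) :
  (forall q : rat, measurable ([set x | f x < ratr q] : set (Tn R n))) ->
  measurable_fun setT (f : Tn R n -> R).
Proof.
move=> h; apply: (measurability _ (RGenInftyO.measurableE R)).
move=> _ [_ [r ->] <-]; rewrite setTI.
rewrite (_ : _ @^-1` _ = \bigcup_(q in [set q : rat | ratr q < r]) [set x | f x < ratr q]).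
  rewrite bigcup_mkcond; apply: countable_bigcupT_measurable => [//|q].
  by case: ifP.
apply/seteqP; split=> x /=; rewrite in_itv /=.
  by move=> /rat_in_itvoo[q]; rewrite in_itv /= => /andP[h1 h2]; exists q.
by move=> [q /= h1 h2]; exact: lt_trans h1.
Qed.

(** Outside one Borel null set [G], the rational sublevel sets of [w] are traces of Borel sets and
    the A_1 inequality holds. Setting [w] to 0 on [G] yields a Borel function with the same
    integrals over cubes. *)
Lemma borel_weight w (A : R) : (0 < n)%N -> A1_weight w -> A1_const w A ->
  exists (w' : 'rV[R]_n -> R) (G : set (Tn R n)),
    [/\ measurable G /\ lb G = 0%E, forall x, ~ G x -> w' x = w x,
        A1hyp w' (Num.max A 1) &
        forall y, ~ G y -> forall c l, 0 < l -> hcube c l y ->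
          avg w' c l <= Num.max A 1 * w' y].
Proof.
move=> n0 [w0 [[lw iw] _]] [N [N0 hN]].
have [G1 [mG1 G10] hG1] := lmeasurable_rat_null lw.
have [G2 [mG2 G20] hG2] := lnull_Borel N0.
pose G : set (Tn R n) := G1 `|` G2.
have mG : measurable G by exact: measurableU.
have G0 : lb G = 0%E.
  by apply/(negligibleP _ mG); apply: negligibleU; apply/negligibleP.
pose w' x := if x \in G then 0 else w x.
have w'E x : ~ G x -> w' x = w x by move=> Gx; rewrite /w' memNset.
have w'0 x : 0 <= w' x by rewrite /w'; case: ifP.
have mw : measurable_fun setT (w' : Tn R n -> R).
  apply: measurable_rat_lt => q; have [B mB hB] := hG1 q.
  (* Since [w'] is 0 on [G], the set [G] belongs to the sublevel set exactly when the level is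
     positive. *)
  rewrite (_ : [set x | _] = (B `\` G) `|` (if 0 < (ratr q : R) then G else set0)).
    by apply: measurableU; [exact: measurableD|case: ifP].
  apply/seteqP; split=> x /=.
    have [Gx|Gx] := pselect (G x); first by rewrite /w' mem_set // => ->; right.
    rewrite w'E // => h; left; split=> //; apply/hB => // Gx1; apply: Gx; by left.
  move=> [[Bx Gx]|]; first by rewrite w'E //; apply/hB => // Gx1; apply: Gx; left.
  by case: ifP => // q0 Gx; rewrite /w' mem_set.
have mcw c l : measurable_fun setT (fun x : Tn R n => \1_(cube c l) x * w' x).
  by apply: measurable_funM => //; apply: measurable_indic; exact: measurable_cube.
have cubeE c l : intRn (fun x => (\1_(cube c l) x * w x)%:E) =
    (\int[lb]_x (\1_(cube c l) x * w' x)%:E)%E.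
  rewrite -ge0_intRnE; last first.
  - by move=> x; rewrite lee_fin mulr_ge0.
  - exact/measurable_EFinP.
  apply: (eq_intRn_ae mG G0) => [x|x|x Gx]; rewrite ?lee_fin ?mulr_ge0 //.
  by rewrite w'E.
have hcubeE c l : (\int[lb]_(x in hcube c l) (w' x)%:E <=
    \int[lb]_x (\1_(cube c l) x * w' x)%:E)%E.
  rewrite integral_mkcond; apply: ge0_le_integral => //.
  - by move=> x _; rewrite patchE; case: ifP => // _; rewrite lee_fin.
  - apply/(measurable_restrictT _ (measurable_hcube c l)).
    by apply/measurable_EFinP; exact: measurable_funS mw.
  - exact/measurable_EFinP.
  move=> x _; rewrite patchE; case: ifPn => xQ; rewrite lee_fin ?mulr_ge0 //.
  rewrite indicE mem_set ?mul1r //; rewrite inE in xQ => i.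
  by have /andP[-> /ltW ->] := xQ i.
have lw' : lintg w'.
  move=> c l l0; apply/integrableP; split.
    by apply/measurable_EFinP; exact: measurable_funS mw.
  under eq_integral do rewrite /= ger0_norm //.
  apply: le_lt_trans (hcubeE c l) _; rewrite -cubeE.
  have := iw c l l0; congr (_ < _)%E; congr intRn; apply/funext => x.
  by rewrite ger0_norm.
have EcI c l : 0 < l -> (cI w' c l)%:E = (\int[lb]_(x in hcube c l) (w' x)%:E)%E.
  by move=> l0; rewrite /cI /Rintegral fineK //; apply: integrable_fin_num; [exact: measurable_hcube|exact: lw'].
have hA y : ~ G y -> forall c l, 0 < l -> hcube c l y -> avg w' c l <= Num.max A 1 * w' y.
  move=> Gy c l l0 yQ.
  have hMy : (maximal w y <= (A * w y)%:E)%E.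
    by apply: hN => Ny; apply: Gy; right; exact: hG2.
  have ln0 : 0 < l ^+ n by exact: exprn_gt0.
  have : (((l ^+ n)^-1)%:E * wmeas w (cube c l) <= (A * w y)%:E)%E.
    apply: le_trans hMy; apply: ereal_sup_ubound; exists c, l; split => //; split=> // i.
    by have /andP[-> /ltW ->] := yQ i.
  rewrite /wmeas cubeE => h.
  have : (((l ^+ n)^-1)%:E * (cI w' c l)%:E <= (A * w y)%:E)%E.
    by apply: le_trans h; rewrite EcI // lee_wpmul2l ?lee_fin ?invr_ge0 ?(ltW ln0) //.
  rewrite -EFinM lee_fin mulrC w'E // => h2; apply: le_trans h2 _.
  by rewrite ler_wpM2r // le_max lexx.
exists w', G; split=> //; split=> // c l c' l' l0 l'0 sub.
have A0 : 0 <= Num.max A 1 by rewrite le_max ler01 orbT.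
have ln0 : 0 < l' ^+ n by exact: exprn_gt0.
have a0 : 0 <= avg w' c l by rewrite /avg divr_ge0 ?cI_ge0 // exprn_ge0 // ltW.
(* The pointwise bound [hA] is integrated in [y] over the subcube. *)
rewrite [X in _ <= _ * X]/avg mulrA ler_pdivlMr // -(cI_cst _ c' l'0) -cIZ // -lee_fin.
have fE (g : 'rV[R]_n -> R) : lintg g -> (cI g c' l')%:E = (\int[lb]_x ((EFin \o g) \_ (hcube c' l')) x)%E.
  by move=> ig; rewrite -integral_mkcond /cI /Rintegral fineK //; apply: integrable_fin_num; [exact: measurable_hcube|exact: ig].
rewrite !fE; [|exact: lintgZ|exact: lintg_cst].
apply: (le_lower_integral mG G0) => [x|x|x Gx]; rewrite !patchE; case: ifPn => // xQ; rewrite /= lee_fin ?mulr_ge0 //.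
by apply: hA => //; apply: sub; rewrite inE in xQ.
Qed.

End BorelWeight.

(** * The operator with convergence factor *)

Section OperatorBound.
Variables (R : realType) (n : nat).
Implicit Types (x y z xi : 'rV[R]_n).
Local Notation lb := (lebn R n).

Lemma measurable_vsub d (X : measurableType d) (g h : X -> Tn R n) :
  measurable_fun setT g -> measurable_fun setT h ->
  measurable_fun setT ((fun p => (g p : 'rV[R]_n) - h p) : X -> Tn R n).
Proof.
move=> mg mh; apply: measurable_Tn => i; under eq_fun do rewrite !mxE.
apply: measurable_funB; first exact: (measurableT_comp (measurable_coord i) mg).
exact: (measurableT_comp (measurable_coord i) mh).
Qed.

(** Real form of e^{i<x,xi>} times the Fourier transform of [v], with a phase ([modfourierE]).
    Writing it through [osc] keeps its decay in xi visible. *)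
Definition modfourier (th : R) (v : 'rV[R]_n -> R) x xi : R :=
  cos (dotRn x xi + th) * osc 0 xi v + sin (dotRn x xi + th) * osc (- (pi / 2)) xi v.

Lemma modfourierE th v x xi : itg lb v ->
  modfourier th v x xi = \int[lb]_y (cos (dotRn (x - y) xi + th) * v y).
Proof.
move=> iv; rewrite /modfourier /osc -!RintegralZl //; [|exact: itg_osc..].
rewrite -RintegralD //; [|by apply: itgZ; exact: itg_osc..].
apply: eq_Rintegral => y _; rewrite [dotRn (x - y) xi]dotRnC dotRnBl !(dotRnC xi).
have -> : dotRn x xi - dotRn y xi + th = (dotRn x xi + th) - dotRn y xi by ring.
rewrite cosB addr0 cosB cos_pihalf sin_pihalf; ring.
Qed.

Lemma cutoff_exchange (e K th : R) (f v : 'rV[R]_n -> R) x : 0 < e -> e <= 1 ->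
  measurable_fun setT (f : Tn R n -> R) -> (forall xi, `|f xi| <= K) -> itg lb v ->
  \int[lb]_xi (env e xi * f xi * modfourier th v x xi) =
  \int[lb]_y (v y * osc th (x - y) (fun xi => env e xi * f xi)).
Proof.
move=> e0 e1 mf fK iv; have mv := itg_measurable iv.
pose F (p : 'rV[R]_n * 'rV[R]_n) := env e p.1 * f p.1 * (cos (dotRn (x - p.2) p.1 + th) * v p.2).
have E0 xi : 0 <= env e xi by rewrite ltW // env_gt0.
transitivity (\int[lb]_xi \int[lb]_y F (xi, y)).
  apply: eq_Rintegral => xi _; rewrite modfourierE // -RintegralZl //.
  apply: (@itg_le _ (Tn R n) _ _ _ (fun y => `|v y|)); last exact: itg_norm.
    apply: measurable_funM => //; apply: (@measurable_phase2 R n _ (Tn R n) (fun y => x - y) (fun=> xi)) => //.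
    exact: (@measurable_vsub _ (Tn R n) (fun=> x) id).
  by move=> y; exact: cosM_le.
rewrite (@Rintegral_fubini _ _ (Tn R n) (Tn R n) R lb lb F (fun xi => K * env e xi) (fun y => `|v y|)).
- apply: eq_Rintegral => y _; rewrite /osc -RintegralZl //.
    by apply: eq_Rintegral => xi _; rewrite /F /=; ring.
  apply: itg_osc; apply: (@itg_le _ (Tn R n) _ _ _ (fun xi => K * env e xi)).
  + by apply: measurable_funM => //; exact: measurable_env.
  + by move=> xi; rewrite normrM (ger0_norm (E0 xi)) mulrC ler_wpM2r.
  + by apply: itgZ; exact: itg_env.
- apply: measurable_funM.
    apply: measurable_funM; first exact: (measurableT_comp (measurable_env e) measurable_fst).
    exact: (measurableT_comp mf measurable_fst).
  apply: measurable_funM; last exact: (measurableT_comp mv measurable_snd).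
  apply: (@measurable_phase2 R n _ (Tn R n * Tn R n)%type (fun p => x - p.2) fst) => //.
  exact: (@measurable_vsub _ (Tn R n * Tn R n)%type (fun=> x) snd).
- move=> xi y; rewrite /F /= !normrM (ger0_norm (E0 xi)); apply: ler_pM; [exact: mulr_ge0|exact: mulr_ge0| |].
    by rewrite mulrC ler_wpM2r.
  by rewrite ler_piMl // cos_abs_le1.
- by move=> xi; rewrite mulr_ge0 //; exact: le_trans (fK xi).
- by [].
- by apply: itgZ; exact: itg_env.
- exact: itg_norm.
Qed.

(** The convergence factor allows the order of integration to be exchanged, so the operator has the
    kernel [osc th (x - y)] of the cut-off symbol. Tonelli then reduces the claim to the bound on
    the weighted kernel at almost every [y]. *)
Lemma cutoff_bound (C0 e K th : R) (f b : 'rV[R]_n * 'rV[R]_n -> R) (v w : 'rV[R]_n -> R)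
    (G : set (Tn R n)) : 0 < e -> e <= 1 ->
  measurable_fun setT (f : Tn R n * Tn R n -> R) -> (forall p, `|f p| <= K) ->
  measurable_fun setT (b : Tn R n * Tn R n -> R) ->
  (forall z x, hw z * osc th z (fun xi => env e xi * f (x, xi)) = osc th z (fun xi => b (x, xi))) ->
  itg lb v -> measurable_fun setT (w : Tn R n -> R) -> (forall x, 0 <= w x) ->
  measurable G -> lb G = 0%E ->
  (forall y, ~ G y -> (\int[lb]_x ((hw (x - y))^-1 *
     (`|osc th (x - y) (fun xi => b (x, xi))| * w x))%:E <= (C0 * w y)%:E)%E) -> 0 <= C0 ->
  (\int[lb]_x (`|\int[lb]_xi (env e xi * f (x, xi) * modfourier th v x xi)| * w x)%:E <=
   \int[lb]_y (`|v y| * (C0 * w y))%:E)%E.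
Proof.
move=> e0 e1 mf fK mb hwb iv mw w0 mG G0 hC C00; have mv := itg_measurable iv.
have K0 : 0 <= K by exact: le_trans (fK (0, 0)).
pose F x xi := env e xi * f (x, xi).
have mfx x : measurable_fun setT (fun xi : Tn R n => f (x, xi)).
  exact: (measurableT_comp mf (@pair1_measurable _ _ (Tn R n) (Tn R n) x)).
have E0 xi : 0 <= env e xi by rewrite ltW // env_gt0.
have mhV : measurable_fun setT (fun p : Tn R n * Tn R n => (hw (p.1 - p.2))^-1).
  rewrite (_ : (fun _ => _) = (fun p : Tn R n * Tn R n => hw (p.1 - p.2) `^ (-1))).
    apply: (measurableT_comp (measurable_powR _)).
    apply: measurable_funD => //; apply: measurable_sum => i; apply: measurable_funX.
    apply: (measurableT_comp (measurable_coord i)).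
    exact: (@measurable_vsub _ (Tn R n * Tn R n)%type fst snd).
  by apply/funext => p; rewrite powR_inv1 // ltW // hw_gt0.
have mosc : measurable_fun setT (fun p : Tn R n * Tn R n =>
    osc th (p.1 - p.2) (fun xi => b (p.1, xi))).
  apply: (@measurable_Rintegral _ _ (Tn R n * Tn R n)%type (Tn R n) R lb
    (fun p => cos (dotRn (p.1.1 - p.1.2) p.2 + th) * b (p.1.1, p.2))).
  have m11 : measurable_fun setT (fun p : (Tn R n * Tn R n) * Tn R n => p.1.1).
    exact: (measurableT_comp measurable_fst measurable_fst).
  have m12 : measurable_fun setT (fun p : (Tn R n * Tn R n) * Tn R n => p.1.2).
    exact: (measurableT_comp measurable_snd measurable_fst).
  apply: measurable_funM; last first.
    by apply: (measurableT_comp mb); apply: measurable_fun_pair => //; exact: measurable_snd.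
  apply: (@measurable_phase2 R n _ ((Tn R n * Tn R n) * Tn R n)%type (fun p => p.1.1 - p.1.2) snd) => //.
  exact: (@measurable_vsub _ ((Tn R n * Tn R n) * Tn R n)%type (fun p => p.1.1) (fun p => p.1.2)).
pose H x y := (hw (x - y))^-1 * (`|osc th (x - y) (fun xi => b (x, xi))| * w x).
have H0 x y : 0 <= H x y.
  by rewrite mulr_ge0 ?invr_ge0 ?(ltW (hw_gt0 _)) // mulr_ge0.
pose P (p : Tn R n * Tn R n) : \bar R := (`|v p.2| * H p.1 p.2)%:E.
have P0 p : (0 <= P p)%E by rewrite lee_fin mulr_ge0.
have mP : measurable_fun setT P.
  apply/measurable_EFinP; apply: measurable_funM.
    by apply: measurableT_comp => //; exact: (measurableT_comp mv measurable_snd).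
  apply: measurable_funM => //; apply: measurable_funM; first exact: measurableT_comp.
  exact: (measurableT_comp mw measurable_fst).
(* The integrations by parts, read as a formula for the kernel. *)
have oE x y : `|osc th (x - y) (F x)| * w x = H x y.
  rewrite /H -hwb normrM (ger0_norm (ltW (hw_gt0 _))) !mulrA mulVf ?mul1r //.
  by rewrite gt_eqF // hw_gt0.
have iF x : itg lb (F x).
  apply: (@itg_le _ (Tn R n) _ _ _ (fun xi => K * env e xi)); last by apply: itgZ; exact: itg_env.
    by apply: measurable_funM => //; exact: measurable_env.
  by move=> xi; rewrite normrM (ger0_norm (E0 xi)) mulrC ler_wpM2r.
have mFo x : measurable_fun setT (fun y : Tn R n => osc th (x - y) (F x)).
  apply: (@measurable_Rintegral _ _ (Tn R n) (Tn R n) R lb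
    (fun p => cos (dotRn (x - p.1) p.2 + th) * F x p.2)).
  apply: measurable_funM; last exact: (measurableT_comp (itg_measurable (iF x)) measurable_snd).
  apply: (@measurable_phase2 R n _ (Tn R n * Tn R n)%type (fun p => x - p.1) snd) => //.
  exact: (@measurable_vsub _ (Tn R n * Tn R n)%type (fun=> x) fst).
apply: (@le_trans _ _ (\int[lb]_x \int[lb]_y P (x, y))%E).
  apply: (le_lower_integral mG G0) => [x|x|x _].
  - by rewrite lee_fin mulr_ge0.
  - by apply: integral_ge0 => y _; exact: P0.
  rewrite (cutoff_exchange th x e0 e1 (mfx x) (fun xi => fK _) iv).
  have iQ : itg lb (fun y => v y * osc th (x - y) (F x)).
    apply: (@itg_le _ (Tn R n) _ _ _ (fun y => (\int[lb]_xi (K * env e xi)) * `|v y|)).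
    - exact: measurable_funM.
    - move=> y; rewrite normrM mulrC ler_wpM2r //; apply: osc_le.
      + exact: itg_measurable (iF x).
      + by move=> xi; rewrite normrM (ger0_norm (E0 xi)) mulrC ler_wpM2r.
      + by apply: itgZ; exact: itg_env.
    - by apply: itgZ; exact: itg_norm.
  apply: (@le_trans _ _ ((w x * \int[lb]_y `|v y * osc th (x - y) (F x)|)%:E)).
    rewrite lee_fin mulrC ler_wpM2l //; apply: Rintegral_norm_le => //; last exact: itg_norm.
    exact: measurable_funM.
  rewrite -RintegralZl //; last exact: itg_norm.
  rewrite EFin_Rintegral; last by apply: itgZ; exact: itg_norm.
  rewrite le_eqVlt; apply/orP; left; apply/eqP; apply: eq_integral => y _.
  by rewrite /P /= -oE normrM; congr EFin; ring.
have -> : (\int[lb]_x \int[lb]_y P (x, y) = \int[lb]_y \int[lb]_x P (x, y))%E.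
  exact: (@fubini_tonelli _ _ (Tn R n) (Tn R n) R lb lb P mP P0).
apply: (le_lower_integral mG G0) => [y|y|y Gy].
- by apply: integral_ge0 => x _; exact: P0.
- by rewrite lee_fin !mulr_ge0.
rewrite /P /=; under eq_integral do rewrite EFinM.
rewrite ge0_integralZl_EFin //; last first.
- apply/measurable_EFinP; rewrite /H.
  apply: measurable_funM.
    exact: (measurableT_comp mhV (@pair2_measurable _ _ (Tn R n) (Tn R n) y)).
  apply: measurable_funM => //; apply: measurableT_comp => //.
  exact: (measurableT_comp mosc (@pair2_measurable _ _ (Tn R n) (Tn R n) y)).
- by move=> x _; rewrite lee_fin.
by rewrite EFinM lee_wpmul2l ?lee_fin //; exact: hC.
Qed.

End OperatorBound.

(** * Removal of the convergence factor *)

Section StrongBound.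
Variables (R : realType) (n : nat).
Implicit Types (x y z xi : 'rV[R]_n).
Local Notation lb := (lebn R n).

Lemma fatou_le (f : nat -> 'rV[R]_n -> R) (g : 'rV[R]_n -> R) (M : \bar R) :
  (forall m, measurable_fun setT (f m : Tn R n -> R)) -> (forall m x, 0 <= f m x) ->
  (forall x, f m x @[m --> \oo] --> g x) ->
  (forall m, (\int[lb]_x (f m x)%:E <= M)%E) -> (\int[lb]_x (g x)%:E <= M)%E.
Proof.
move=> mf f0 fg fM.
have gE x : (g x)%:E = limn_einf (fun m => (f m x)%:E).
  by symmetry; apply: (cvg_limn_einf_sup _).1; apply: cvg_EFin; [exact: nearW|exact: fg].
under eq_integral do rewrite gE.
apply: le_trans (fatou lb measurableT (f := fun m x => (f m x)%:E) _ _) _.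
- by move=> m; apply/measurable_EFinP.
- by move=> m x _; rewrite lee_fin.
rewrite limn_einf_lim; apply: lime_le; first exact: is_cvg_einfs.
by apply: nearW => m; apply: le_trans (fM m); apply: ereal_inf_lbound; exists m => /=.
Qed.

Lemma env_cvg1 xi : env (m.+1%:R^-1) xi @[m --> \oo] --> (1 : R).
Proof.
rewrite [X in _ --> X](_ : _ = \prod_(i < n) lor (0 * xi ord0 i)); last first.
  by rewrite big1 // => i _; rewrite mul0r /lor expr0n addr0 invr1.
apply: cvg_big => [|i _]; first exact: mul_continuous.
apply: continuous_cvg; first exact: continuous_lor.
by apply: cvgMr_tmp; exact: cvg_harmonic.
Qed.

Lemma measurable_modfourier th (v : 'rV[R]_n -> R) : measurable_fun setT (v : Tn R n -> R) ->
  measurable_fun setT (fun p : Tn R n * Tn R n => modfourier th v p.1 p.2).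
Proof.
move=> mv.
have mo t : measurable_fun setT (fun p : Tn R n * Tn R n => osc t p.2 v).
  have := measurable_osc1 t 0 mv; under eq_fun do rewrite subr0.
  by move=> h; exact: (measurableT_comp h measurable_snd).
apply: measurable_funD; apply: measurable_funM => //.
  exact: (@measurable_phase2 R n _ (Tn R n * Tn R n)%type fst snd).
apply: (@measurableT_comp _ _ _ _ _ _ (@sin R)).
  by apply: continuous_measurable_fun; exact: continuous_sin.
by apply: measurable_funD => //; exact: (@measurable_dot2 R n _ (Tn R n * Tn R n)%type fst snd).
Qed.

(** Take e = 1/(m+1). For fixed [x] the xi-integral converges by domination, because the transform
    of [v] is integrable; Fatou handles the integral in [x]. *)
Lemma strong_bound (C0 K Cv th : R) (f : 'rV[R]_n * 'rV[R]_n -> R) (v w : 'rV[R]_n -> R) :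
  measurable_fun setT (f : Tn R n * Tn R n -> R) -> (forall p, `|f p| <= K) ->
  measurable_fun setT (v : Tn R n -> R) -> (forall t xi, `|osc t xi v| <= Cv * env 1 xi) ->
  measurable_fun setT (w : Tn R n -> R) -> (forall x, 0 <= w x) ->
  (forall e, 0 < e -> e <= 1 ->
    (\int[lb]_x (`|\int[lb]_xi (env e xi * f (x, xi) * modfourier th v x xi)| * w x)%:E <=
     \int[lb]_y (`|v y| * (C0 * w y))%:E)%E) ->
  (\int[lb]_x (`|\int[lb]_xi (f (x, xi) * modfourier th v x xi)| * w x)%:E <=
   \int[lb]_y (`|v y| * (C0 * w y))%:E)%E /\
  measurable_fun setT (fun x : Tn R n => \int[lb]_xi (f (x, xi) * modfourier th v x xi)) /\
  forall x, itg lb (fun xi => f (x, xi) * modfourier th v x xi).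
Proof.
move=> mf fK mv ov mw w0 he.
have K0 : 0 <= K by exact: le_trans (fK (0, 0)).
have E0 e xi : 0 <= env e xi by rewrite ltW // env_gt0.
have mm := measurable_modfourier th mv.
have mfm : measurable_fun setT (fun p : Tn R n * Tn R n => f p * modfourier th v p.1 p.2).
  exact: measurable_funM.
have bm x xi : `|modfourier th v x xi| <= 2 * Cv * env 1 xi.
  have h : `|cos (dotRn x xi + th) * osc 0 xi v| <= Cv * env 1 xi.
    exact: le_trans (cosM_le _ _) (ov _ _).
  have h2 : `|sin (dotRn x xi + th) * osc (- (pi / 2)) xi v| <= Cv * env 1 xi.
    apply: le_trans (ov (- (pi / 2)) xi); rewrite normrM ler_piMl //.
    by rewrite ler_norml sin_geN1 sin_le1.
  apply: le_trans (ler_normD _ _) _; apply: le_trans (lerD h h2) _.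
  by rewrite le_eqVlt; apply/orP; left; apply/eqP; ring.
have ienv : itg lb (fun xi => K * (2 * Cv * env 1 xi)).
  by do 2!apply: itgZ; exact: itg_env.
have bfm x xi : `|f (x, xi) * modfourier th v x xi| <= K * (2 * Cv * env 1 xi).
  by rewrite normrM ler_pM.
have mx x : measurable_fun setT (fun xi : Tn R n => f (x, xi) * modfourier th v x xi).
  exact: (measurableT_comp mfm (@pair1_measurable _ _ (Tn R n) (Tn R n) x)).
have ifm x : itg lb (fun xi => f (x, xi) * modfourier th v x xi).
  exact: (@itg_le _ (Tn R n) _ _ _ (fun xi => K * (2 * Cv * env 1 xi))).
split; last first.
  split=> //.
  exact: (@measurable_Rintegral _ _ (Tn R n) (Tn R n) R lb (fun p => f p * modfourier th v p.1 p.2)).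
pose g (m : nat) x := \int[lb]_xi (env (m.+1%:R^-1) xi * f (x, xi) * modfourier th v x xi).
have e0 m : 0 < m.+1%:R^-1 :> R by rewrite invr_gt0 ltr0n.
have e1 m : m.+1%:R^-1 <= 1 :> R by rewrite invf_le1 ?ltr0n // ler1n.
apply: (@fatou_le (fun m x => `|g m x| * w x)).
- move=> m; apply: measurable_funM => //; apply: measurableT_comp => //.
  apply: (@measurable_Rintegral _ _ (Tn R n) (Tn R n) R lb
    (fun p => env (m.+1%:R^-1) p.2 * f p * modfourier th v p.1 p.2)).
  apply: measurable_funM => //; apply: measurable_funM => //.
  exact: (measurableT_comp (measurable_env _) measurable_snd).
- by move=> m x; rewrite mulr_ge0.
- move=> x; apply: cvgMr_tmp; apply: cvg_norm.
  have [] := @dominated_convergence _ (Tn R n) R lb setT measurableT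
    (fun m xi => (env (m.+1%:R^-1) xi * f (x, xi) * modfourier th v x xi)%:E)
    (fun xi => (f (x, xi) * modfourier th v x xi)%:E) (fun xi => (K * (2 * Cv * env 1 xi))%:E).
  + move=> m; apply/measurable_EFinP; under eq_fun do rewrite -mulrA.
    by apply: measurable_funM => //; exact: measurable_env.
  + exact/measurable_EFinP.
  + apply: aeW => xi _; apply: cvg_EFin; first exact: nearW.
    under eq_fun do rewrite -mulrA.
    have : env (m.+1%:R^-1) xi * (f (x, xi) * modfourier th v x xi) @[m --> \oo] -->
        1 * (f (x, xi) * modfourier th v x xi) by apply: cvgMr_tmp; exact: env_cvg1.
    by rewrite mul1r.
  + exact: ienv.
  + apply: aeW => xi m _ /=; rewrite lee_fin -mulrA normrM (ger0_norm (E0 _ _)).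
    by apply: le_trans (bfm x xi); rewrite ler_piMl // env_le1.
  move=> _ _; rewrite -EFin_Rintegral // => /fine_cvg; exact.
- by move=> m; exact: he.
Qed.

End StrongBound.

(** * Decay of Schwartz functions and of their Fourier transforms *)

Section SchwartzFunctions.
Variables (R : realType) (n : nat).
Implicit Types (x z xi : 'rV[R]_n) (u : 'rV[R]_n -> R[i]).
Local Notation lb := (lebn R n).

(** The inverse of the envelope is the product of the 1 + x_i^2, which expands into one monomial for
    each subset of the coordinates. *)
Lemma schwartz_env u s : schwartz u ->
  exists C : R, forall x, cmod (dirsC (@ebasis R n) s u x) <= C * env 1 x.
Proof.
move=> [_ hu]; pose al (J : {set 'I_n}) (i : 'I_n) : nat := if i \in J then 0 else 2.
have /choice[c hc] : forall J, exists C : R, forall x,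
    `|monom (al J) x| * cmod (dirsC (@ebasis R n) s u x) <= C.
  by move=> J; exact: hu.
exists (\sum_J c J) => x.
rewrite /env prodfV ler_pdivlMr; last first.
  by apply: prodr_gt0 => i _; exact: lor_den_gt0.
rewrite bigA_distr mulr_sumr; apply: ler_sum => J _.
apply: le_trans (hc J x); rewrite mulrC ler_wpM2r ?sqrtr_ge0 //.
apply: le_trans (ler_norm _); rewrite le_eqVlt; apply/orP; left; apply/eqP.
apply: eq_bigr => i _; rewrite /al mul1r; by case: (i \in J).
Qed.

(** [osc_hw] with the derivatives of [u] gains 1/[hw], hence [env 1]. This makes the xi-integral of
    the operator absolutely convergent. *)
Lemma schwartz_osc u b : schwartz u ->
  itg lb (fun x => part b (u x)) /\
  exists Cv : R, forall th xi, `|osc th xi (fun x => part b (u x))| <= Cv * env 1 xi.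
Proof.
move=> su; pose v x := part b (u x).
have sv : smoothR (@ebasis R n) v by rewrite /v; clear v; case: su => -[]; case: b.
have hd s x : `|dirs (@ebasis R n) s v x| <= cmod (dirsC (@ebasis R n) s u x).
  by have := part_le_cmod b (dirsC (@ebasis R n) s u x); rewrite /v; clear v sv; case: b.
have /choice[c hc] : forall s, exists C : R, forall x, cmod (dirsC (@ebasis R n) s u x) <= C * env 1 x.
  by move=> s; exact: schwartz_env.
have E0 xi : 0 <= env 1 xi by rewrite ltW // env_gt0.
have hc' s x : `|dirs (@ebasis R n) s v x| <= `|c s| * env 1 x.
  by rewrite (le_trans (hd _ _)) // (le_trans (hc _ _)) // ler_wpM2r // ler_norm.
pose D := `|c [::]| + \sum_(i < n) \sum_(k < (2 * n).+1) `|c (nseq k i)|.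
have D1 : `|c [::]| <= D.
  by rewrite lerDl sumr_ge0 // => i _; rewrite sumr_ge0.
have Dik i k : (k <= 2 * n)%N -> `|c (nseq k i)| <= D.
  move=> kn; rewrite /D (bigD1 i) //= (bigD1 (Ordinal (kn : (k < (2 * n).+1)%N))) //=.
  set A := \sum_(j | _) _; set B := \sum_(j | _) _.
  have A0 : 0 <= A by apply: sumr_ge0.
  have B0 : 0 <= B by apply: sumr_ge0 => j _; exact: sumr_ge0.
  have := normr_ge0 (c [::]); lra.
have mv s : measurable_fun setT (dirs (@ebasis R n) s v : Tn R n -> R).
  by apply: cont_measurable_Tn => x; exact: differentiable_continuous (sv s x).
have ienv : itg lb (env 1) by exact: itg_env.
have iv : itg lb v.
  apply: (@itg_le _ (Tn R n) _ _ _ (fun x => `|c [::]| * env 1 x)); last exact: itgZ.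
    exact: (mv [::]).
  exact: (hc' [::]).
pose F_ i k := dirs (@ebasis R n) (nseq k i) v.
have bF i k x : (k <= 2 * n)%N -> `|F_ i k x| <= D * env 1 x.
  by move=> kn; rewrite (le_trans (hc' _ _)) // ler_wpM2r // Dik.
have hO th z : hw z * osc th z v = osc th z (Lop v F_).
  apply: (@osc_hw R n v F_ D 1 th z) => //.
    move=> i k x _; split => //; exact: diff_derivable (sv (nseq k i) x).
  by move=> i k _; exact: mv.
split=> //; exists ((\int[lb]_xi ((D + n%:R * D) * env 1 xi)) * 2 ^+ n) => th z.
rewrite -mulrA; apply: (@le_trans _ _ ((\int[lb]_xi ((D + n%:R * D) * env 1 xi)) * (hw z)^-1)); last first.
  rewrite ler_wpM2l ?hwV_le_env //; apply: Rintegral_ge0 => x _.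
  by rewrite mulr_ge0 // addr_ge0 ?mulr_ge0 // (le_trans _ D1).
rewrite ler_pdivlMr ?hw_gt0 // mulrC -[hw z in leLHS](ger0_norm (ltW (hw_gt0 z))) -normrM hO.
apply: osc_le.
- apply: measurable_funD; first exact: (mv [::]).
  by apply: measurable_funM => //; apply: measurable_sum => i; exact: mv.
- move=> x; apply: le_trans (ler_normD _ _) _; rewrite mulrDl; apply: lerD.
    by apply: le_trans (hc' [::] x) _; rewrite ler_wpM2r.
  rewrite normrM normrX normrN1 expr1n mul1r; apply: le_trans (ler_norm_sum _ _ _) _.
  apply: (@le_trans _ _ (\sum_(i < n) D * env 1 x)).
    by apply: ler_sum => i _; exact: bF.
  by rewrite sumr_const card_ord -mulrA mulr_natl.
- exact: itgZ.
Qed.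

End SchwartzFunctions.

(** * The strong bound for one real component *)

Section ComponentBound.
Variables (R : realType) (n : nat).
Implicit Types (x y z xi : 'rV[R]_n) (u : 'rV[R]_n -> R[i]).
Local Notation lb := (lebn R n).

Definition opart (a : 'rV[R]_n * 'rV[R]_n -> R[i]) u (th : R) (k l : bool) x : R :=
  \int[lb]_xi (part k (a (x, xi)) * modfourier th (fun y => part l (u y)) x xi).

(** tau = (q/2)^(1/8), so that 2 tau^8 = q and the scale 2 tau^4 is the geometric mean of q and
    2. *)
Lemma ratio_tau (q : R) : 1 <= q -> q < 2 -> exists tau : R,
  [/\ 0 < tau, tau < 1, 1 <= 2 * tau ^+ 4 & q <= 2 * tau ^+ 8].
Proof.
move=> q1 q2; have q0 : 0 < q / 2 by lra.
exists ((q / 2) `^ 8^-1).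
have t0 : 0 < (q / 2) `^ 8^-1 by exact: powR_gt0.
have t8 : ((q / 2) `^ 8^-1) ^+ 8 = q / 2.
  by rewrite -powR_mulrn ?powR_ge0 // -powRrM mulVf ?powRr1 // ltW.
move: t0 t8; set t := _ `^ _ => t0 t8; split=> //.
- by rewrite -(@expr_lt1 _ 8) ?(ltW t0) // t8; lra.
- have t4 : (t ^+ 4) ^+ 2 = q / 2 by rewrite -exprM.
  have : 0 < t ^+ 4 by exact: exprn_gt0.
  by move: (t ^+ 4) t4 => s s2 s0; nra.
- by rewrite t8; lra.
Qed.

Lemma measurable_cont2 (f : 'rV[R]_n * 'rV[R]_n -> R) : continuous f ->
  measurable_fun setT (f : Tn R n * Tn R n -> R).
Proof.
move=> cf; rewrite (_ : f = fun p => f (p.1, p.2)); last by apply/funext => -[].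
exact: (@measurable_Tn2 R _ (Tn R n * Tn R n)%type n n f fst snd cf).
Qed.

(** The order of the quantifiers matters: [C0] is fixed by n, [delta], [K] and [A] before the
    symbol, the weight and the function are given. *)
Lemma component_bound (K delta A : R) : (0 < n)%N -> 0 <= delta -> delta < 1 -> 0 <= K ->
  1 <= A -> exists2 C0 : R, 0 <= C0 & forall a w (G : set (Tn R n)) u th k l,
    symbol_class (- n%:R) 0 delta a ->
    seminorms_le (- n%:R) 0 delta a (2 * n).+1 K ->
    A1hyp w A -> measurable G -> lb G = 0%E ->
    (forall y, ~ G y -> forall c r, 0 < r -> hcube c r y -> avg w c r <= A * w y) ->
    schwartz u ->
    (\int[lb]_x (`|opart a u th k l x| * w x)%:E <=
     \int[lb]_y (`|part l (u y)| * (C0 * w y))%:E)%E /\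
    measurable_fun setT (opart a u th k l : Tn R n -> R) /\
    forall x, itg lb (fun xi => part k (a (x, xi)) * modfourier th (fun y => part l (u y)) x xi).
Proof.
move=> n0 d0 d1 K0 A1; have A0 : 0 <= A by lra.
have [B B0 hB] := @cutsym_symhyp R n K delta n0 d0 (ltW d1) K0.
have q1 : 1 <= 2 `^ delta :> R by rewrite -[leLHS](powRr0 2) ler_powR // ler1n.
have q2 : 2 `^ delta < 2 :> R.
  have d2 : 0 < 1 - delta by lra.
  have h : 1 `^ (1 - delta) < 2 `^ (1 - delta) :> R.
    by apply: (gt0_ltr_powR d2); rewrite ?nnegrE // ltr1n.
  rewrite powR1 in h.
  rewrite [ltRHS](_ : _ = 2 `^ delta * 2 `^ (1 - delta)); last first.
    by rewrite -powRD ?pnatr_eq0 ?implybT // addrC subrK powRr1.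
  by rewrite ltr_pMr // powR_gt0.
have [tau [t0 t1 t4 t8]] := ratio_tau q1 q2.
have [C1 C10 hC1] := @kernel_cube R n A B tau (2 `^ delta) n0 A1 B0 t0 t1 t4 (powR_ge0 _ _) t8.
have C00 : 0 <= 2 * 8 ^+ n * C1 * A.
  by apply: mulr_ge0 => //; apply: mulr_ge0 => //; rewrite mulr_ge0 // exprn_ge0.
exists (2 * 8 ^+ n * C1 * A) => // a w G u th k l sa hK hw mG G0 hav su.
have [w0 iw mw _] := hw.
pose f := fun p => part k (a p).
have [[cf cfx Df bfx lfx] [bf lf]] := symbol_cutsym (delta := delta) k K0 sa hK.
rewrite -/f in cf cfx Df bfx lfx bf lf.
have mf := measurable_cont2 cf.
have fK p : `|f p| <= K.
  by case: p => x xi; apply: le_trans (bf x xi) _; rewrite ler_piMr // jbr_powR_le1.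
have [iv [Cv hv]] := schwartz_osc l su.
apply: (@strong_bound R n _ K Cv th f _ w) => //; first exact: itg_measurable iv.
move=> e e0 e1.
have [hb hwb] := hB e f (xid f) e0 e1 (fun=> erefl) mf (fun i k => measurable_cont2 (cfx i k))
  Df bf bfx lf lfx.
have [mb be _ _] := hb.
apply: (@cutoff_bound R n _ e K th f (cutsym e f (xid f)) _ w G) => //.
move=> y Gy.
pose Bt := \int[lb]_xi (B * env e xi).
have mo : measurable_fun setT (fun x : Tn R n => `|osc th (x - y) (fun xi => cutsym e f (xid f) (x, xi))| * w x).
  by apply: measurable_funM => //; apply: measurableT_comp => //; exact: measurable_osc2.
apply: (@kernel_weight R n A C1 _ w y) => //.
- by move=> x; rewrite mulr_ge0.
- apply: (@lintg_le R n _ (fun x => Bt * w x)) => //; last exact: lintgZ.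
  move=> x; rewrite normrM normr_id (ger0_norm (w0 x)) ler_wpM2r //.
  apply: osc_le => //; last by apply: itgZ; exact: itg_env.
  exact: (measurableT_comp mb (@pair1_measurable _ _ (Tn R n) (Tn R n) x)).
- by move=> c r; exact: (hC1 w _ e th y c r hw e0 e1 hb).
- by move=> c r r0 yr; exact: hav.
Qed.

End ComponentBound.

(** * Complex operators in terms of real components *)

Section Assembly.
Variables (R : realType) (n : nat).
Implicit Types (x y z xi : 'rV[R]_n) (u : 'rV[R]_n -> R[i]).
Local Notation lb := (lebn R n).

Lemma Re_expiM (t : R) (z : R[i]) :
  complex.Re (expi t * z) = cos t * part true z - sin t * part false z.
Proof. by case: z. Qed.

Lemma Im_expiM (t : R) (z : R[i]) :
  complex.Im (expi t * z) = cos t * part false z + sin t * part true z.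
Proof. by case: z => a b; rewrite /expi /part /=; ring. Qed.

Lemma fine_intRn (g : 'rV[R]_n -> R) : itg lb g ->
  fine (intRn (fun x => (g x)%:E)) = \int[lb]_x g x.
Proof. by move=> ig; rewrite intRnE. Qed.

Lemma fourierE u xi : (forall b, itg lb (fun x => part b (u x))) ->
  part true (fourier u xi) = osc 0 xi (fun y => part true (u y)) +
    osc (- (pi / 2)) xi (fun y => part false (u y)) /\
  part false (fourier u xi) = osc 0 xi (fun y => part false (u y)) -
    osc (- (pi / 2)) xi (fun y => part true (u y)).
Proof.
move=> iu.
have c0 y : cos (dotRn xi y + 0) = cos (- dotRn y xi) by rewrite addr0 cosN dotRnC.
have s0 y : cos (dotRn xi y + - (pi / 2)) = - sin (- dotRn y xi).
  by rewrite sinN opprK cosB cos_pihalf sin_pihalf dotRnC; ring.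
have io b t := itg_osc t xi (iu b).
split.
- rewrite /osc -RintegralD //; [|exact: io..].
  rewrite -fine_intRn; last by apply: itgD; exact: io.
  congr (fine (intRn _)); apply/funext => y; rewrite Re_expiM c0 s0; congr EFin; ring.
- rewrite /osc -RintegralB //; [|exact: io..].
  rewrite -fine_intRn; last by apply: (integrableB _ (io _ _) (io _ _)).
  congr (fine (intRn _)); apply/funext => y; rewrite Im_expiM c0 s0; congr EFin; ring.
Qed.

Definition phase (t : bool) : R := if t then 0 else - (pi / 2).

Lemma cos_phase s : cos (s + phase false) = sin s.
Proof. by rewrite /phase cosB cos_pihalf sin_pihalf; ring. Qed.

Lemma sin_phase s : sin (s + phase false) = - cos s.
Proof. by rewrite /phase sinB cos_pihalf sin_pihalf; ring. Qed.

Lemma psidoE a u x : (forall b, itg lb (fun x => part b (u x))) ->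
  (forall t k l, itg lb (fun xi => part k (a (x, xi)) *
     modfourier (phase t) (fun y => part l (u y)) x xi)) ->
  let Q t k l := opart a u (phase t) k l x in
  part true (psido a u x) = (2 * pi) ^- n *
    (Q true true true - Q true false false - Q false true false - Q false false true) /\
  part false (psido a u x) = (2 * pi) ^- n *
    (Q true true false + Q true false true + Q false true true - Q false false false).
Proof.
move=> iu iQ Q.
pose m t k l xi := part k (a (x, xi)) * modfourier (phase t) (fun y => part l (u y)) x xi.
pose g b xi := part b (expi (dotRn x xi) * a (x, xi) * fourier u xi).
have gE xi : g true xi = m true true true xi - m true false false xi -
      m false true false xi - m false false true xi /\
    g false xi = m true true false xi + m true false true xi +
      m false true true xi - m false false false xi.
  have [f1 f2] := fourierE xi iu.
  rewrite /g -mulrA /m /modfourier !cos_phase !sin_phase !addr0.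
  rewrite /part -/(part _ _) Re_expiM Im_expiM.
  have Rm (z z' : R[i]) : part true (z * z') = part true z * part true z' - part false z * part false z'.
    by case: z => ? ?; case: z'.
  have Im (z z' : R[i]) : part false (z * z') = part true z * part false z' + part false z * part true z'.
    by case: z => ? ?; case: z'.
  by rewrite !Rm !Im f1 f2; split; ring.
have eT : g true = fun xi => m true true true xi - m true false false xi -
      m false true false xi - m false false true xi by apply/funext => xi; have [] := gE xi.
have eF : g false = fun xi => m true true false xi + m true false true xi +
      m false true true xi - m false false false xi by apply/funext => xi; have [] := gE xi.
have iB (f h : 'rV[R]_n -> R) : itg lb f -> itg lb h -> itg lb (fun xi => f xi - h xi).
  by move=> jf jh; exact: (integrableB _ jf jh).
have im t k l : itg lb (m t k l) by exact: iQ.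
split.
- rewrite -[LHS]/(_ * fine (intRn (fun xi => (g true xi)%:E)) - 0 * _) mul0r subr0.
  have i1 := iB _ _ (im true true true) (im true false false).
  have i2 := iB _ _ i1 (im false true false).
  rewrite eT fine_intRn; last exact: iB _ _ i2 (im false false true).
  by rewrite (RintegralB measurableT i2 (im false false true))
    (RintegralB measurableT i1 (im false true false))
    (RintegralB measurableT (im true true true) (im true false false)).
- rewrite -[LHS]/(_ * fine (intRn (fun xi => (g false xi)%:E)) + 0 * _) mul0r addr0.
  have i1 := itgD (im true true false) (im true false true).
  have i2 := itgD i1 (im false true true).
  rewrite eF fine_intRn; last exact: iB _ _ i2 (im false false false).
  by rewrite (RintegralB measurableT i2 (im false false false))
    (RintegralD measurableT i1 (im false true true))
    (RintegralD measurableT (im true true false) (im true false true)).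
Qed.

Lemma sum_bool3 (N : bool -> bool -> bool -> R) :
  N true true true + N true false false + N false true false + N false false true +
  (N true true false + N true false true + N false true true + N false false false) =
  \sum_(t : bool) \sum_(k : bool) \sum_(l : bool) N t k l.
Proof. by rewrite !big_bool /=; ring. Qed.

Lemma cmod_le (z : R[i]) : cmod z <= `|part true z| + `|part false z|.
Proof.
have h : 0 <= `|part true z| + `|part false z| by rewrite addr_ge0.
rewrite -[leRHS](ger0_norm h) -sqrtr_sqr /cmod ler_sqrt ?sqr_ge0 //.
rewrite -[complex.Re z ^+ 2]real_normK ?num_real // -[complex.Im z ^+ 2]real_normK ?num_real //.
have := normr_ge0 (part true z); have := normr_ge0 (part false z); rewrite /part; nra.
Qed.

End Assembly.

(** * From the strong bound to the weak-type inequality *)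

Theorem theorem1p2 (R : realType) (n : nat) (delta : R) :
  (1 <= n)%N -> 0 <= delta < 1 ->
  exists N : nat, forall K A : R, exists C : R, 0 < C /\
  forall (a : 'rV[R]_n * 'rV[R]_n -> R[i]) (w : 'rV[R]_n -> R),
    symbol_class (- n%:R) 0 delta a ->
    seminorms_le (- n%:R) 0 delta a N K ->
    A1_weight w -> A1_const w A ->
    forall u : 'rV[R]_n -> R[i], schwartz u ->
      (L1winf_norm w (psido a u) <= C%:E * L1w_norm w u)%E.
Proof.
move=> n0 /andP[d0 d1]; exists (2 * n).+1 => K A.
have A1 : 1 <= Num.max A 1 by rewrite le_max lexx orbT.
have [C0 C00 hC] := @component_bound R n `|K| delta (Num.max A 1) n0 d0 d1 (normr_ge0 K) A1.
pose ka : R := (2 * pi) ^- n.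
have ka0 : 0 <= ka by rewrite invr_ge0 exprn_ge0 // mulr_ge0 // pi_ge0.
(* Eight components, each with constant [C0], times the normalisation (2 pi)^(-n); the summand 1
   makes the constant strictly positive. *)
exists (ka * 8 * C0 + 1); split; first by rewrite ltr_pwDr // !mulr_ge0.
move=> a w sa hK hw hA u su.
(* [K] and [A] are arbitrary reals, hence the passage to |K| here and to the maximum of A and 1
   above. *)
have hK' : seminorms_le (- n%:R) 0 delta a (2 * n).+1 `|K|.
  move=> sx sxi hs x xi; apply: le_trans (hK sx sxi hs x xi) _.
  by rewrite ler_wpM2r ?powR_ge0 // ler_norm.
have [w' [G [[mG G0] w'E hw' hav]]] := borel_weight n0 hw hA.
have [w'0 _ mw' _] := hw'; have [w0 _] := hw.
have H t k l := hC a w' G u (phase R t) k l sa hK' hw' mG G0 hav su.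
have cm0 z : 0 <= @cmod R z by exact: sqrtr_ge0.
pose S x := \sum_(t : bool) \sum_(k : bool) \sum_(l : bool) `|opart a u (phase R t) k l x|.
have bT x : cmod (psido a u x) <= ka * S x.
  have iu b : itg (lebn R n) (fun x => part b (u x)) by have [] := schwartz_osc b su.
  have [E1 E2] := @psidoE R n a u x iu (fun t k l => (H t k l).2.2 x).
  apply: le_trans (cmod_le _) _; rewrite E1 E2 !normrM (ger0_norm ka0) -mulrDr ler_wpM2l //.
  have nB (y z : R) (s : R) : `|y| <= s -> `|y - z| <= s + `|z|.
    by move=> h; apply: le_trans (ler_normB _ _) _; rewrite lerD2r.
  have nD (y z : R) (s : R) : `|y| <= s -> `|y + z| <= s + `|z|.
    by move=> h; apply: le_trans (ler_normD _ _) _; rewrite lerD2r.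
  apply: le_trans (lerD (nB _ _ _ (nB _ _ _ (nB _ _ _ (lexx _))))
    (nB _ _ _ (nD _ _ _ (nD _ _ _ (lexx _))))) _.
  by rewrite (sum_bool3 (fun t k l => `|opart a u (phase R t) k l x|)).
have mop t k l := (H t k l).2.1.
have mS : measurable_fun setT (S : Tn R n -> R).
  by do 3!(apply: measurable_sum => ?); apply: measurableT_comp.
have S0 x : 0 <= S x by do 3!(apply: sumr_ge0 => ? _).
have mv l : measurable_fun setT (fun x : Tn R n => part l (u x)).
  by have [/itg_measurable] := schwartz_osc l su.
have Lw0 : (0 <= L1w_norm w u)%E by apply: intRn_ge0 => x; rewrite lee_fin mulr_ge0.
have hL t k l : (\int[lebn R n]_x (`|opart a u (phase R t) k l x| * w' x)%:E <= C0%:E * L1w_norm w u)%E.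
  apply: le_trans (H t k l).1 _.
  have mvw : measurable_fun setT (fun x : Tn R n => (`|part l (u x)| * w' x)%:E).
    by apply/measurable_EFinP; apply: measurable_funM => //; exact: measurableT_comp.
  have vw0 x : (0 <= (`|part l (u x)| * w' x)%:E)%E by rewrite lee_fin mulr_ge0.
  under eq_integral do rewrite mulrCA EFinM.
  rewrite ge0_integralZl_EFin // lee_wpmul2l ?lee_fin // -ge0_intRnE //.
  apply: (le_intRn_ae mG G0) => [//|x|x Gx]; first by rewrite lee_fin mulr_ge0.
  by rewrite w'E // lee_fin ler_wpM2r // part_le_cmod.
have hS : (\int[lebn R n]_x (S x * w' x)%:E <= (8 * C0)%:E * L1w_norm w u)%E.
  have E x : (S x * w' x)%:E = (\sum_(t : bool) \sum_(k : bool) \sum_(l : bool)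
      (`|opart a u (phase R t) k l x| * w' x)%:E)%E.
    rewrite /S mulr_suml -sumEFin; apply: eq_bigr => t _.
    rewrite mulr_suml -sumEFin; apply: eq_bigr => k _.
    by rewrite mulr_suml -sumEFin.
  have mt t k l : measurable_fun setT (fun x : Tn R n => (`|opart a u (phase R t) k l x| * w' x)%:E).
    by apply/measurable_EFinP; apply: measurable_funM => //; exact: measurableT_comp.
  have t0 t k l x : (0 <= (`|opart a u (phase R t) k l x| * w' x)%:E)%E.
    by rewrite lee_fin mulr_ge0.
  under eq_integral do rewrite E.
  rewrite ge0_integral_sum //; last 2 first.
  - by move=> t; do 2!(apply: emeasurable_sum => ?).
  - by move=> t x _; do 2!(apply: sume_ge0 => ? _).
  apply: (@le_trans _ _ (\sum_(t : bool) \sum_(k : bool) \sum_(l : bool) C0%:E * L1w_norm w u)%E).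
    apply: lee_sum => t _; rewrite ge0_integral_sum //; last 2 first.
    - by move=> k; apply: emeasurable_sum => ?.
    - by move=> k x _; apply: sume_ge0 => ? _.
    apply: lee_sum => k _; rewrite ge0_integral_sum //.
    by apply: lee_sum => l _; exact: hL.
  rewrite !big_bool /= -!ge0_muleDl ?lee_fin ?addr_ge0 //.
  rewrite -!EFinD [leRHS](_ : _ = (8 * C0)%:E * L1w_norm w u)%E //.
  by rewrite lee_wpmul2r // lee_fin; lra.
apply: (@le_trans _ _ ((ka * 8 * C0)%:E * L1w_norm w u)%E); last first.
  by rewrite lee_wpmul2r // lee_fin lerDl.
apply: ge_ereal_sup => _ [lam lam0 ->].
have mSw : measurable_fun setT (fun x : Tn R n => (S x * w' x)%:E).
  by apply/measurable_EFinP; exact: measurable_funM.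
have Sw0 x : (0 <= (S x * w' x)%:E)%E by rewrite lee_fin mulr_ge0.
have c0 : 0 <= lam^-1 * ka by rewrite mulr_ge0 // invr_ge0 ltW.
(* Chebyshev, applied to the Borel majorant [ka * S] of the operator and to the Borel weight
   [w']. *)
have hE : (wmeas w [set x | (lam < cmod (psido a u x))%R] <=
    (lam^-1 * ka)%:E * \int[lebn R n]_x (S x * w' x)%:E)%E.
  rewrite -ge0_integralZl_EFin // -ge0_intRnE; last 2 first.
  - by apply/measurable_EFinP; do 2!(apply: measurable_funM => //).
  - by move=> x; rewrite mule_ge0 // lee_fin.
  apply: (le_intRn_ae mG G0) => [x|x|x Gx]; first by rewrite lee_fin mulr_ge0.
    by rewrite mule_ge0 // lee_fin.
  rewrite -EFinM lee_fin mulrA w'E // ler_wpM2r // indicE.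
  have [xE|_] := boolP (x \in _); last by rewrite mulr_ge0.
  rewrite inE /= in xE; rewrite -mulrA ler_pdivlMl // mulr1.
  exact: le_trans (ltW xE) (bT x).
apply: (@le_trans _ _ (lam%:E * ((lam^-1 * ka)%:E * \int[lebn R n]_x (S x * w' x)%:E))%E).
  by rewrite lee_wpmul2l // lee_fin ltW.
rewrite muleA -EFinM mulrA mulfV ?gt_eqF // mul1r -mulrA EFinM -muleA.
by rewrite lee_wpmul2l ?lee_fin.
Qed.
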